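(* Let $\kappa>0$, let $(\eta_\varepsilon)_{\varepsilon>0}$ be positive numbers with $\eta_\varepsilon\to0$ and $\alpha:=\lim_{\varepsilon\to0}\eta_\varepsilon/\varepsilon\in(0,\infty)$, and let $\mathbf A_w,\mathbf A_s$ be isotropic: $\mathbf A_i\xi=\lambda_i(\operatorname{tr}\xi)\mathrm{Id}+2\mu_i\xi$ with $\lambda_i,\mu_i>0$ for $i\in\{w,s\}$. Setting $K:=\{\tau\in\mathbb M^{n\times n}_{\rm sym}:G(\tau)\le2\alpha\kappa\}$, one has, as $\varepsilon\to0$, $$SQW_\varepsilon\to\overline W:=(f^*+I_K)^*$$ pointwise on $\mathbb M^{n\times n}_{\rm sym}$.
   Context: $\mathbb M^{n\times n}_{\rm sym}$ is the space of real symmetric $n\times n$ matrices ($n\ge2$) with Frobenius product $\xi:\eta=\operatorname{tr}(\xi\eta)$. Let $$f(\xi):=\frac12\mathbf A_s\xi:\xi,\qquad W_\varepsilon(\xi):=\min\Big\{\frac12\mathbf A_s\xi:\xi,\ \frac{\eta_\varepsilon}{2}\mathbf A_w\xi:\xi+\frac\kappa\varepsilon\Big\}.$$ The symmetric quasiconvex envelope of $W_\varepsilon$ is $$SQW_\varepsilon(\xi):=\inf_{\varphi\in C_c^\infty((0,1)^n;\mathbb R^n)}\int_{(0,1)^n}W_\varepsilon(\xi+e(\varphi))\,dx,\qquad e(\varphi)=\tfrac12(\nabla\varphi+\nabla\varphi^T).$$ If $\tau_1\le\cdots\le\tau_n$ are the ordered eigenvalues of $\tau\in\mathbb M^{n\times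 n}_{\rm sym}$, $$G(\tau):=\begin{cases}\frac{\tau_1^2}{\lambda_w+2\mu_w}&\text{if }\frac{\lambda_w+2\mu_w}{2(\lambda_w+\mu_w)}(\tau_1+\tau_n)<\tau_1,\\[1mm]\frac{(\tau_1-\tau_n)^2}{4\mu_w}+\frac{(\tau_1+\tau_n)^2}{4(\lambda_w+\mu_w)}&\text{if }\tau_1\le\frac{\lambda_w+2\mu_w}{2(\lambda_w+\mu_w)}(\tau_1+\tau_n)\le\tau_n,\\[1mm]\frac{\tau_n^2}{\lambda_w+2\mu_w}&\text{if }\tau_n<\frac{\lambda_w+2\mu_w}{2(\lambda_w+\mu_w)}(\tau_1+\tau_n).\end{cases}$$ For $\psi:\mathbb M^{n\times n}_{\rm sym}\to[0,+\infty]$ proper, $\psi^*(\tau):=\sup_{\xi\in\mathbb M^{n\times n}_{\rm sym}}\{\tau:\xi-\psi(\xi)\}$ is the convex conjugate; $I_K$ is the indicator function of $K$ ($0$ on $K$, $+\infty$ elsewhere). *)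

(* Defs.v *)
From HB Require Import structures.
From mathcomp Require Import all_boot all_order all_algebra.
From mathcomp Require Import mathcomp_extra boolp classical_sets functions reals.
From mathcomp Require Import ereal topology normedtype sequences derive measure.
From mathcomp Require Import lebesgue_measure lebesgue_integral numfun.
From mathcomp Require complex.

Set Implicit Arguments.
Unset Strict Implicit.
Unset Printing Implicit Defensive.

Import Order.TTheory GRing.Theory Num.Theory.
Import numFieldNormedType.Exports.

Local Open Scope classical_set_scope.
Local Open Scope ring_scope.

Section lebesgue_measure_on_tuples.
Local Open Scope ereal_scope.
Context {R : realType}.
Local Notation mR := (measurableTypeR R).

Definition tcons n (p : mR * n.-tuple mR) : n.+1.-tuple mR :=
  [the n.+1.-tuple mR of p.1 :: p.2].

Lemma measurable_tcons n : measurable_fun [set: mR * n.-tuple mR] (@tcons n).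
Proof. exact: measurable_cons. Qed.

Section lebesgue_tcons.
Variables (n : nat) (mu : {sigma_finite_measure set (n.-tuple mR) -> \bar R}).

Definition lebesgue_tcons :=
  pushforward (@lebesgue_measure R \x mu) (@tcons n).

Let measurable_preimage_tcons A : measurable A -> measurable (@tcons n @^-1` A).
Proof.
by move=> mA; rewrite -[X in measurable X]setTI; exact: measurable_tcons.
Qed.

Let lebesgue_tcons0 : lebesgue_tcons set0 = 0.
Proof. by rewrite /lebesgue_tcons /pushforward preimage_set0 measure0. Qed.

Let lebesgue_tcons_ge0 A : 0 <= lebesgue_tcons A.
Proof. by apply: integral_ge0 => x _; exact: measure_ge0. Qed.

Let lebesgue_tcons_sigma_additive : semi_sigma_additive lebesgue_tcons.
Proof.
move=> F mF tF mUF; rewrite /lebesgue_tcons /pushforward preimage_bigcup.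
apply: measure_semi_sigma_additive.
- by move=> k; exact: measurable_preimage_tcons.
- apply/trivIsetP => /= i j _ _ ij; rewrite -preimage_setI.
  by move/trivIsetP : tF => /(_ _ _ _ _ ij) ->//; rewrite preimage_set0.
- by rewrite -preimage_bigcup; exact: measurable_preimage_tcons.
Qed.

HB.instance Definition _ := isMeasure.Build _ _ _ lebesgue_tcons
  lebesgue_tcons0 lebesgue_tcons_ge0 lebesgue_tcons_sigma_additive.

Let measurable_uncons :
  measurable_fun [set: n.+1.-tuple mR] (fun t => (thead t, [tuple of behead t])).
Proof.
apply/measurable_fun_pairP; split; first exact: measurable_tnth.
exact: measurable_behead.
Qed.

Let lebesgue_tcons_sigma_finite : sigma_finite setT lebesgue_tcons.
Proof.
have /sigma_finiteP[F [TF ndF Foo]] := sigma_finiteT (@lebesgue_measure R).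
have /sigma_finiteP[H [TH ndH Hoo]] := sigma_finiteT mu.
pose u (t : n.+1.-tuple mR) := (thead t, [tuple of behead t]).
have uK : u \o @tcons n = id.
  by apply/funext => -[x t]; congr pair; exact: val_inj.
exists (fun k => u @^-1` (F k `*` H k)).
  rewrite -preimage_bigcup -[LHS](preimage_setT u); congr (_ @^-1` _).
  rewrite -setXTT TF TH predeqE => -[x y]; split.
    move=> [/= [k _ Fx] [l _ Hy]]; exists (maxn k l) => //; split.
    - by move: x Fx; exact/subsetPset/ndF/leq_maxl.
    - by move: y Hy; exact/subsetPset/ndH/leq_maxr.
  by move=> [k _ []/= ? ?]; split; exists k.
move=> k; have [mF Fk] := Foo k; have [mH Hk] := Hoo k; split.
  rewrite -[X in measurable X]setTI; apply: measurable_uncons => //.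
  exact: measurableX.
rewrite /lebesgue_tcons /pushforward -comp_preimage uK preimage_id.
by rewrite product_measure1E// lte_mul_pinfty// ge0_fin_numE.
Qed.

HB.instance Definition _ := Measure_isSigmaFinite.Build _ _ _ lebesgue_tcons
  lebesgue_tcons_sigma_finite.

End lebesgue_tcons.

(* n-dimensional Lebesgue measure: the n-fold product of lebesgue_measure,
   transported along R * R^m ~ R^m.+1. *)
Fixpoint lebesgue_tuple (n : nat) :
    {sigma_finite_measure set (n.-tuple mR) -> \bar R} :=
  match n with
  | 0 => \d_[tuple]
  | m.+1 => lebesgue_tcons (lebesgue_tuple m)
  end.

Lemma lebesgue_tuple_box n (A : 'I_n -> set mR) :
  (forall i, measurable (A i)) ->
  lebesgue_tuple n [set t | forall i, A i (tnth t i)] =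
  \prod_(i < n) lebesgue_measure (A i).
Proof.
elim: n A => [|n IH] A mA.
  rewrite big_ord0 /= diracE mem_set//= => -[]//.
have mB : measurable [set t : n.-tuple mR |
                      forall i, A (lift ord0 i) (tnth t i)].
  rewrite (_ : [set _ | _] = \big[setI/setT]_(i < n)
                ((fun t => tnth t i) @^-1` A (lift ord0 i))).
    apply: bigsetI_measurable => i _; rewrite -[X in measurable X]setTI.
    exact: measurable_tnth.
  rewrite -bigcap_seq; apply/seteqP; split=> t /=.
    by move=> h i _; exact: h.
  by move=> h i; apply: h; rewrite /= mem_index_enum.
rewrite big_ord_recl /= -IH// /lebesgue_tcons /pushforward.
rewrite -product_measure1E//; congr product_measure1.
apply/seteqP; split => -[x t] /=.
  move=> h; split => [|i]; first exact: (h ord0).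
  by have := h (lift ord0 i); rewrite tnthS.
move=> [h0 h] i; have [j ->|->] := unliftP ord0 i; last exact: h0.
by rewrite tnthS; exact: h.
Qed.

End lebesgue_measure_on_tuples.

Section symmetric_matrices.
Context {R : realType} {n : nat}.
Implicit Types (xi eta tau : 'M[R]_n) (psi : 'M[R]_n -> \bar R).

Definition symmx : set 'M[R]_n := [set xi | xi^T = xi].

Definition frobenius xi eta : R := \tr (xi *m eta).

Definition isotropic (lam mu : R) xi : 'M[R]_n :=
  (lam * \tr xi)%:M + (2 * mu) *: xi.

(* The eigenvalues counted with algebraic multiplicity, in nondecreasing order;
   such a list is unique, and it exists when tau is symmetric. *)
Definition ordered_eigenvalues tau : seq R :=
  xget [::] [set s | sorted <=%R s /\
                     char_poly tau = \prod_(a <- s) ('X - a%:P)].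

Definition indicator (K : set 'M[R]_n) tau : \bar R :=
  if tau \in K then 0%E else +oo%E.

Definition conjugate psi tau : \bar R :=
  ereal_sup [set ((frobenius tau xi)%:E - psi xi)%E | xi in symmx].

End symmetric_matrices.

Section ordered_eigenvalues_spec.
Import complex.

Lemma ordered_eigenvaluesP (R : realType) n (tau : 'M[R]_n) : symmx tau ->
  sorted <=%R (ordered_eigenvalues tau) /\
  char_poly tau = \prod_(a <- ordered_eigenvalues tau) ('X - a%:P).
Proof.
move=> st; rewrite /ordered_eigenvalues; set E := [set s | _].
apply: (@xgetPex _ [::] E); rewrite {}/E /=.
suff [s sE] : exists s : seq R, char_poly tau = \prod_(a <- s) ('X - a%:P).
  exists (sort <=%R s); split; first exact: (sort_sorted (@le_total _ R)).
  by rewrite sE; apply: perm_big; rewrite perm_sym perm_sort.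
pose f := real_complex R.
case: n tau st => [|n] tau st.
  by exists [::]; rewrite big_nil /char_poly det_mx00.
pose A := map_mx f tau.
have hA : A \is hermsymmx.
  apply/is_hermitianmxP; rewrite expr0 scale1r; apply/matrixP => i j.
  by rewrite !mxE -[in LHS]st mxE /f /= /Num.conj /= oppr0.
have /orthomx_spectralP AE : A \is normalmx by exact: hermitian_normalmx.
have /mxOverP dr := hermitian_spectral_diag_real hA.
exists [seq complex.Re (spectral_diag A 0 i) | i <- enum 'I_n.+1].
apply: (map_poly_inj (real_complex R)).
rewrite map_char_poly -/A rmorph_prod big_map big_enum /=.
have PU := spectral_unit A.
rewrite [X in char_poly X = _]AE.
pose D := diag_mx (spectral_diag A).
have -> : char_poly (invmx (spectralmx A) *m D *m spectralmx A) = char_poly D.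
  rewrite /char_poly /char_poly_mx !map_mxM /=.
  set P := map_mx polyC (spectralmx A); set Q := map_mx polyC _.
  have QP : Q *m P = 1%:M by rewrite -map_mxM mulVmx // map_mx1.
  have PQ : P *m Q = 1%:M by rewrite -map_mxM mulmxV // map_mx1.
  have -> : 'X%:M - Q *m map_mx polyC D *m P =
            Q *m ('X%:M - map_mx polyC D) *m P.
    by rewrite mulmxBr mulmxBl (scalar_mxC _ Q) -(mulmxA _ Q P) QP mulmx1.
  by rewrite !det_mulmx mulrC mulrA -det_mulmx PQ det1 mul1r.
rewrite char_poly_trig; last exact: diag_mx_is_trig.
apply: eq_bigr => i _.
rewrite rmorphB /= map_polyX map_polyC /= mxE eqxx mulr1n.
by congr (_ - _%:P); apply/esym/RRe_real/dr.
Qed.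

End ordered_eigenvalues_spec.

Section symmetric_quasiconvexity.
Context {R : realType} {n : nat}.
Implicit Types (phi : 'rV[R]_n -> 'rV[R]_n) (x : 'rV[R]_n).

Definition unit_cube : set 'rV[R]_n := [set x | forall i, 0 < x 0 i < 1].

Definition partial (j : 'I_n) phi : 'rV[R]_n -> 'rV[R]_n :=
  fun x => 'D_(delta_mx 0 j) phi x.

(* All iterated partial derivatives exist everywhere and are continuous. *)
Definition smooth phi := forall s : seq 'I_n,
  continuous (foldr partial phi s) /\
  forall j x, derivable (foldr partial phi s) x (delta_mx 0 j).

Definition closed_support phi : set 'rV[R]_n := closure [set x | phi x != 0].

Definition test_field : set ('rV[R]_n -> 'rV[R]_n) :=
  [set phi | [/\ smooth phi, compact (closed_support phi)
               & closed_support phi `<=` unit_cube]].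

Definition gradient phi x : 'M[R]_n := \matrix_(i, j) partial j phi x 0 i.

Definition symgrad phi x : 'M[R]_n :=
  2^-1 *: (gradient phi x + (gradient phi x)^T).

(* The library's measurable structure is on tuples, hence the change of
   representation from t : n.-tuple R to the row vector of its entries. *)
Definition SQ (W : 'M[R]_n -> R) (xi : 'M[R]_n) : \bar R :=
  ereal_inf [set
    (\int[lebesgue_tuple n]_(t in [set t | unit_cube (\row_i tnth t i)])
       (W (xi + symgrad phi (\row_i tnth t i)))%:E)%E | phi in test_field].

End symmetric_quasiconvexity.

Section brittle_damage.
Context {R : realType} {n : nat}.
Implicit Types (xi tau : 'M[R]_n).

Definition elastic_energy (lam mu : R) xi : R :=
  2^-1 * frobenius (isotropic lam mu xi) xi.

Definition W_eps (lambda_w mu_w lambda_s mu_s kappa eta eps : R) xi : R :=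
  Num.min (elastic_energy lambda_s mu_s xi)
          (eta / 2 * frobenius (isotropic lambda_w mu_w xi) xi + kappa / eps).

Definition G (lambda_w mu_w : R) tau : R :=
  let t1 := (ordered_eigenvalues tau)`_0 in
  let tn := (ordered_eigenvalues tau)`_n.-1 in
  let c := (lambda_w + 2 * mu_w) / (2 * (lambda_w + mu_w)) * (t1 + tn) in
  if c < t1 then t1 ^+ 2 / (lambda_w + 2 * mu_w)
  else if c <= tn then
    (t1 - tn) ^+ 2 / (4 * mu_w) + (t1 + tn) ^+ 2 / (4 * (lambda_w + mu_w))
  else tn ^+ 2 / (lambda_w + 2 * mu_w).

Definition W_bar (lambda_w mu_w lambda_s mu_s kappa alpha : R) : 'M[R]_n -> \bar R :=
  let f xi := (elastic_energy lambda_s mu_s xi)%:E in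
  let K := [set tau | symmx tau /\ G lambda_w mu_w tau <= 2 * alpha * kappa] in
  conjugate (fun tau => (conjugate f tau + indicator K tau)%E).

End brittle_damage.

(* Main.v *)
(** Every [tau] with [G tau <= 2 alpha kappa] can be written [r Id + q] with [|q v| <= s |v|] and
    [r^2 / (lambda_w + mu_w) + s^2 / mu_w = G tau].  Exchanging indices in the quadratic minors of
    [grad phi] then shows that [(tau : e(phi))^2 <= G tau * (A_w e(phi) : e(phi))] holds after
    integration, although not pointwise.  Completing squares in both phases of [W_eps], this gives
    [SQ W_eps xi >= tau : xi - f^* tau - o(1)].

    Conversely, superpose oscillating fields whose strain is concentrated on thin layers: family [i]
    is orthogonal to [b_i], has volume fraction proportional to [c_i eps] and carries a strain of
    order [1 / eps] along [a_i (.) b_i].  If the families are shifted independently, their crossings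
    have volume of order [eps^2] and are negligible on average, whence
    [limsup SQ W_eps xi <=
       f (xi - sum_i c_i a_i (.) b_i) + sum_i c_i (alpha g (a_i (.) b_i) + kappa)],
    where [g xi = A_w xi : xi / 2].  The bounds match because the stress
    [A_s (xi - sum_i c_i a_i (.) b_i)] of a near minimiser of the right-hand side satisfies
    [tau : (a (.) b) <= alpha g (a (.) b) + kappa] up to a small error (insert one more layer), and
    this rank-one condition amounts to [G tau <= 2 alpha kappa]. *)

Require Import Defs.
From HB Require Import structures.
From mathcomp Require Import all_boot all_order all_algebra.
From mathcomp Require Import mathcomp_extra boolp classical_sets functions reals.
From mathcomp Require Import cardinality set_interval.
From mathcomp Require Import ereal topology normedtype sequences derive measure.
From mathcomp Require Import realfun exp measurable_realfun lebesgue_measure lebesgue_integral numfun ftc.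
From mathcomp Require Import ring lra.
From mathcomp Require Import sesquilinear spectral.
From mathcomp Require complex.
Set Implicit Arguments.
Unset Strict Implicit.
Unset Printing Implicit Defensive.
Import Order.TTheory GRing.Theory Num.Theory.
Import numFieldNormedType.Exports.
Local Open Scope classical_set_scope.
Local Open Scope ring_scope.

(** * Integration over the unit cube *)

(** Pointwise, the best constant in [(tau : e)^2 <= c (A_w e : e)] is [A_w^-1 tau : tau], reached at
    [e = A_w^-1 tau], which in general is no [a (.) b]. Testing with strains [a (.) b] only gives
    the constant [G tau]. It is also the least [r^2 / (lambda_w + mu_w) + s^2 / mu_w] over the
    intervals [[r - s, r + s]] that contain the spectrum of [tau]: both ends touch the spectrum in
    the middle regime, one end in the two others. Dual stresses are written [tau = A_s e]; then
    [f^* tau = f e], and every Legendre transform becomes a completed square. Competitors must be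
    smooth with compact support, hence a cutoff and layers with transition zones of relative width
    [d]. Here [d] depends on the tolerance only, [eps] tends to 0 with [d] fixed, and the frequency
    is chosen last, so that the gradient of the cutoff may be arbitrarily large. The shifts of the
    layers run through a finite grid: their average is a finite sum, and some shift does no worse
    than it. *)

Section unit_cube_integration.
Context {R : realType}.
Local Notation mR := (measurableTypeR R).

Definition tuple_row n (t : n.-tuple mR) : 'rV[R]_n := \row_i tnth t i.

Definition cube_tuple n : set (n.-tuple mR) := [set t | unit_cube (tuple_row t)].

Lemma measurable_box n (A : 'I_n -> set mR) : (forall i, measurable (A i)) ->
  measurable [set t : n.-tuple mR | forall i, A i (tnth t i)].
Proof.
move=> mA.
rewrite (_ : [set _ | _] = \big[setI/setT]_(i < n) ((fun t => tnth t i) @^-1` A i)).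
  apply: bigsetI_measurable => i _; rewrite -[X in measurable X]setTI.
  exact: measurable_tnth.
rewrite -bigcap_seq; apply/seteqP; split=> t /=.
  by move=> h i _; exact: h.
by move=> h i; apply: h; rewrite /= mem_index_enum.
Qed.

Lemma cube_tupleE n :
  @cube_tuple n = [set t | forall i, `]0, 1[%classic (tnth t i)].
Proof.
apply/seteqP; split=> t /= h i; by have := h i; rewrite ?mxE /= ?in_itv.
Qed.

Lemma measurable_cube n : measurable (@cube_tuple n).
Proof. by rewrite cube_tupleE; apply: (@measurable_box n (fun=> _)). Qed.

Lemma lebesgue_box_oo n (a b : R) : a <= b ->
  lebesgue_tuple n [set t | forall i, `]a, b[%classic (tnth t i)] =
  ((b - a) ^+ n)%:E.
Proof.
move=> ab; rewrite (@lebesgue_tuple_box _ n (fun=> `]a, b[%classic))//.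
under eq_bigr => i _ do rewrite lebesgue_measure_itv /= lte_fin.
rewrite (eq_bigr (fun=> (b - a)%:E)) => [|i _].
  by rewrite prodEFin prodr_const card_ord.
by case: ltgtP ab => [_ _|//|-> _]; rewrite ?subrr // EFinB.
Qed.

Lemma lebesgue_cube n : lebesgue_tuple n (@cube_tuple n) = 1%E.
Proof. by rewrite cube_tupleE lebesgue_box_oo ?ler01// subr0 expr1n. Qed.

Definition tuple_upd n (t : n.-tuple mR) i (x : mR) : n.-tuple mR :=
  [tuple if j == i then x else tnth t j | j < n].

Lemma tuple_upd0 n (t : n.-tuple mR) x y :
  tuple_upd (tcons (y, t)) ord0 x = tcons (x, t).
Proof.
apply: eq_from_tnth => j; rewrite tnth_mktuple.
by have [k ->|->] := unliftP ord0 j; rewrite ?eqxx ?tnthS.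
Qed.

Lemma tuple_updS n (t : n.-tuple mR) i x y :
  tuple_upd (tcons (y, t)) (lift ord0 i) x = tcons (y, tuple_upd t i x).
Proof.
apply: eq_from_tnth => j; rewrite tnth_mktuple.
have [k ->|->] := unliftP ord0 j; last by [].
by rewrite !tnthS tnth_mktuple (inj_eq lift_inj).
Qed.

Lemma cube_tupleS n (x : mR) (t : n.-tuple mR) :
  cube_tuple (tcons (x, t)) <-> `]0, 1[%classic x /\ cube_tuple t.
Proof.
rewrite !cube_tupleE /=; split=> [h|[hx h] i].
  by split=> [|i]; [exact: (h ord0)|have := h (lift ord0 i); rewrite tnthS].
by have [k ->|->] := unliftP ord0 i; rewrite ?tnthS //; exact: h.
Qed.

Lemma integrable_cube n (F : n.-tuple mR -> R) (M : R) :
  measurable_fun setT F -> (forall t, cube_tuple t -> `|F t| <= M) ->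
  (lebesgue_tuple n).-integrable (@cube_tuple n) (EFin \o F).
Proof.
move=> mF FM; apply: measurable_bounded_integrable.
- exact: measurable_cube.
- by rewrite [X in (X < _)%E]lebesgue_cube ltry.
- exact: measurable_funTS.
- exists M; split=> [|N MN t Ct]; first exact: num_real.
  exact: le_trans (FM _ Ct) (ltW MN).
Qed.

(** The induction removes the first coordinate by Fubini. If [i] is that coordinate, it is
    integrated first; otherwise it is kept outside and the induction hypothesis applies to each
    slice. *)
Lemma cube_integral_line0 n (F : n.-tuple mR -> R) (M : R) i :
  measurable_fun setT F -> (forall t, cube_tuple t -> `|F t| <= M) ->
  (forall t, cube_tuple t ->
     (\int[@lebesgue_measure R]_(x in `]0%R, 1%R[) (F (tuple_upd t i x))%:E = 0)%E) ->
  (\int[lebesgue_tuple n]_(t in @cube_tuple n) (F t)%:E = 0)%E.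
Proof.
elim: n F i => [|n IH] F i mF FM F0; first by case: i F0.
have mt := @measurable_tcons R n.
have mC : measurable (@cube_tuple n.+1) by exact: measurable_cube.
have mC0 : measurable (@cube_tuple n) by exact: measurable_cube.
set D := `]0%R, 1%R[%classic : set mR.
have mD : measurable D by exact: measurable_itv.
have DC : (@tcons R n) @^-1` (@cube_tuple n.+1) = D `*` @cube_tuple n.
  by apply/seteqP; split => -[x t] /= /cube_tupleS.
pose H := (EFin \o (F \o @tcons R n)) \_ (D `*` @cube_tuple n).
have mDC : measurable (D `*` @cube_tuple n) by exact: measurableX.
have HE x t : H (x, t) = if x \in D then (if t \in @cube_tuple n then (F (tcons (x, t)))%:E else 0%E) else 0%E.
  by rewrite /H patchE in_setX; case: (x \in D); case: (t \in _).
have iH0 : (lebesgue_measure \x (lebesgue_tuple n))%E.-integrable (D `*` @cube_tuple n) (EFin \o (F \o @tcons R n)).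
  apply: measurable_bounded_integrable => //.
  - rewrite [X in (X < _)%E]product_measure1E //=.
    rewrite lebesgue_measure_itv /= lte_fin ltr01 lebesgue_cube.
    by rewrite sube0 mule1 ltry.
  - by apply: measurable_funTS; exact: measurableT_comp.
  - exists M; split=> [|N MN [x t] [/= Dx Ct]]; first exact: num_real.
    by apply: le_trans (ltW MN); apply: FM; apply/cube_tupleS.
have iH : (lebesgue_measure \x (lebesgue_tuple n))%E.-integrable setT H.
  exact: (iffLR (integrable_mkcond _ mDC) iH0).
have -> : (\int[lebesgue_tuple n.+1]_(t in @cube_tuple n.+1) (F t)%:E = 
           \int[lebesgue_measure \x lebesgue_tuple n]_z H z)%E.
  rewrite /= integral_pushforward //=.
  - by rewrite DC integral_mkcond.
  - exact/measurable_EFinP.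
  - by rewrite DC.
have [j ij|i0] := unliftP ord0 i.
  rewrite {}ij in F0.
  rewrite -integral12_prod_meas1 //; apply: integral0_eq => x _.
  rewrite /fubini_F; under eq_integral => t _ do rewrite HE.
  have [/set_mem Dx|_] := boolP (x \in D); last by rewrite integral0.
  rewrite -(integral_mkcond (@cube_tuple n) (fun t => (F (tcons (x, t)))%:E)).
  apply: (IH (fun t => F (tcons (x, t))) j).
  - apply: measurableT_comp => //; apply: measurableT_comp => //.
  - by move=> t Ct; apply: FM; apply/cube_tupleS.
  - move=> t Ct; rewrite -[RHS](F0 (tcons (x, t))); last exact/cube_tupleS.
    by apply: eq_integral => y _; rewrite tuple_updS.
rewrite {}i0 in F0.
rewrite -integral21_prod_meas1 //; apply: integral0_eq => t _.
rewrite /fubini_G; under eq_integral => x _ do rewrite HE.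
have [/set_mem Ct|nCt] := boolP (t \in @cube_tuple n); last first.
  by rewrite integral0_eq // => x _; case: ifP.
rewrite -(integral_mkcond D (fun x => (F (tcons (x, t)))%:E)).
(* The entry [1 / 2] is overwritten by the update; it only supplies a point of the cube to which
   [F0] applies. *)
have D12 : D (2^-1) by rewrite /D /= in_itv /=; lra.
rewrite -[RHS](F0 (tcons (2^-1, t))); last exact/cube_tupleS.
by apply: eq_integral => y _; rewrite tuple_upd0.
Qed.

End unit_cube_integration.

(** * Measurability of continuous functions of a row vector *)

Section continuous_on_rows.
Context {R : realType}.
Local Notation mR := (measurableTypeR R).

(** The measurable structure on tuples comes from the coordinates, so an open set is exhausted by
    the countably many grid boxes, of all meshes [1 / (m + 1)], that it contains. *)
Lemma measurable_open_row n (U : set 'rV[R]_n) :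
  open U -> measurable [set t : n.-tuple mR | U (tuple_row t)].
Proof.
move=> oU.
pose box (m : nat) (k : {ffun 'I_n -> int}) : set (n.-tuple mR) :=
  [set t | forall i, `[(k i)%:~R / m.+1%:R, (k i + 1)%:~R / m.+1%:R[%classic (tnth t i)].
pose B (mk : nat * {ffun 'I_n -> int}) : set (n.-tuple mR) :=
  if `[< box mk.1 mk.2 `<=` [set t | U (tuple_row t)] >] then box mk.1 mk.2 else set0.
suff -> : [set t : n.-tuple mR | U (tuple_row t)] = \bigcup_mk B mk.
  apply: countable_bigcupT_measurable => [|[m k]]; first exact: countableP.
  rewrite /B; case: ifP => // _.
  apply: (@measurable_box _ _ (fun i => `[(k i)%:~R / m.+1%:R, (k i + 1)%:~R / m.+1%:R[%classic)) => i; exact: measurable_itv.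
apply/seteqP; split => [t /= Ut|t [[m k] _]]; last first.
  by rewrite /B; case: ifPn => // /asboolP; apply.
have /nbhs_ballP[e /= e0 eU] : nbhs (tuple_row t) U by exact: open_nbhs_nbhs.
have [m me] : exists m : nat, m.+1%:R^-1 < e.
  exists (Num.truncn e^-1); rewrite invf_plt ?posrE ?ltr0n//.
  exact: truncnS_gt.
have m0 : 0 < m.+1%:R :> R by rewrite ltr0n.
exists (m, [ffun i => Num.floor (tnth t i * m.+1%:R)]) => //.
rewrite /B; case: ifPn => [_|/asboolP []] /=.
  move=> i; rewrite /= in_itv /= ffunE ler_pdivrMr // ltr_pdivlMr //.
  by have /andP[-> ->] := floor_itv (tnth t i * m.+1%:R).
move=> s /= sb; apply: eU; split=> // a i; rewrite /ball /= !mxE.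
apply: le_lt_trans me; have := sb i; rewrite /= in_itv /= ffunE.
rewrite ler_pdivrMr // ltr_pdivlMr // intrD.
have /andP[] := floor_itv (tnth t i * m.+1%:R); rewrite intrD.
set q := (_ %:~R : R) => h1 h2 /andP[h3 h4].
rewrite -[leRHS]mul1r ler_pdivlMr // -[X in _ * X](gtr0_norm m0) -normrM mulrBl ler_norml.
by apply/andP; split; lra.
Qed.

Lemma measurable_continuous_row n (F : 'rV[R]_n -> R) : continuous F ->
  measurable_fun setT (fun t : n.-tuple mR => F (tuple_row t)).
Proof.
move=> /continuousP cF; apply: (measurability _ (RGenOpens.measurableE R)) => _ [_ [a [b ->] <-]].
rewrite setTI; apply: (@measurable_open_row _ (F @^-1` `]a, b[%classic)).
exact/cF/interval_open.
Qed.

End continuous_on_rows.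

(** * Symmetry of mixed directional derivatives *)

Section directional_derivatives.
Context {R : realType} {n : nat}.
Implicit Types (u : 'rV[R]_n -> R) (x v : 'rV[R]_n).

Lemma is_derive_line u x v (s : R) : derivable u (x + s *: v) v ->
  is_derive s 1 (fun r => u (x + r *: v)) ('D_v u (x + s *: v)).
Proof.
move=> du.
have E : (fun h : R => h^-1 *: (u (x + (h *: 1 + s) *: v) - u (x + s *: v))) =
         (fun h => h^-1 *: (u (h *: v + (x + s *: v)) - u (x + s *: v))).
  apply/funext => h; congr (_ *: (u _ - _)).
  by rewrite scalerDl addrCA [h *: 1]mulr1.
by split; rewrite /derivable /derive E.
Qed.

(** Two uses of the mean value theorem: along [v] for the increment of [u] under the translation
    [h *: w], then along [w] for ['D_v u]. *)
Lemma derivative_mixed_difference u v w x (h : R) : 0 < h ->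
  (forall y, derivable u y v) -> (forall y, derivable ('D_v u) y w) ->
  exists a b : R, [/\ 0 <= a <= h, 0 <= b <= h &
    u (x + h *: w + h *: v) - u (x + h *: v) - (u (x + h *: w) - u x) =
    'D_w ('D_v u) (x + a *: v + b *: w) * h * h].
Proof.
move=> h0 dv dvw.
pose g (r : R) := u (x + h *: w + r *: v) - u (x + r *: v).
pose g' (r : R) := 'D_v u (x + h *: w + r *: v) - 'D_v u (x + r *: v).
have dg (r : R) : is_derive r 1 g (g' r) by apply: is_deriveB; exact: is_derive_line.
have [|a ah gE] := @MVT R g g' 0 h h0 (fun r _ => dg r).
  by apply: derivable_within_continuous => r _; exact: ex_derive.
pose k (r : R) := 'D_v u (x + a *: v + r *: w).
have dk (r : R) : is_derive r 1 k ('D_w ('D_v u) (x + a *: v + r *: w)).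
  exact: is_derive_line.
have [|b bh kE] := @MVT R k _ 0 h h0 (fun r _ => dk r).
  by apply: derivable_within_continuous => r _; exact: ex_derive.
exists a, b; split.
- by move: ah; rewrite in_itv /= => /andP[/ltW -> /ltW ->].
- by move: bh; rewrite in_itv /= => /andP[/ltW -> /ltW ->].
have -> : u (x + h *: w + h *: v) - u (x + h *: v) - (u (x + h *: w) - u x) = g h - g 0.
  by rewrite /g !scale0r !addr0.
rewrite subr0 in kE; rewrite gE /g' subr0 -kE /k scale0r addr0.
by rewrite [x + h *: w + _]addrAC.
Qed.

(** The second difference is symmetric in [v] and [w], so for small [h] the two mixed derivatives
    take a common value at points whose distance to [x] is of order [h]; continuity at [x]
    concludes. *)
Lemma derivativeC u v w x :
  (forall y, derivable u y v) -> (forall y, derivable u y w) ->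
  (forall y, derivable ('D_v u) y w) -> (forall y, derivable ('D_w u) y v) ->
  continuous ('D_w ('D_v u)) -> continuous ('D_v ('D_w u)) ->
  'D_w ('D_v u) x = 'D_v ('D_w u) x.
Proof.
move=> dv dw dvw dwv cvw cwv.
apply/eqP; rewrite -subr_eq0 -normr_le0; apply/ler_addgt0Pl => e e0; rewrite addr0.
have e20 : 0 < e / 2 by rewrite divr_gt0.
have /cvgrPdist_lt/(_ _ e20)/nbhs_ballP[r1 /= r10 h1] := cvw x.
have /cvgrPdist_lt/(_ _ e20)/nbhs_ballP[r2 /= r20 h2] := cwv x.
pose N := `|v| + `|w| + 1.
have N0 : 0 < N by rewrite ltr_wpDl // addr_ge0.
pose h := Num.min r1 r2 / N.
have h0 : 0 < h by rewrite divr_gt0 // lt_min r10.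
have hN : h * N = Num.min r1 r2 by rewrite divfK // gt_eqF.
have near_x (a b : R) (y z : 'rV[R]_n) r : 0 <= a <= h -> 0 <= b <= h ->
    `|y| + `|z| + 1 = N -> Num.min r1 r2 <= r -> ball x r (x + a *: y + b *: z).
  move=> /andP[a0 ah] /andP[b0 bh] yzN rr.
  rewrite -ball_normE /ball_ /= -addrA opprD addNKr normrN.
  apply: le_lt_trans (ler_normD _ _) _; rewrite !normrZ !ger0_norm //.
  apply: lt_le_trans rr; rewrite -hN -yzN !mulrDr mulr1.
  by apply: ltr_pwDr => //; rewrite lerD // ler_wpM2r.
have minl : Num.min r1 r2 <= r1 by rewrite ge_min lexx.
have minr : Num.min r1 r2 <= r2 by rewrite ge_min lexx orbT.
have [a [b [ha hb E1]]] := @derivative_mixed_difference u v w x h h0 dv dvw.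
have [c [d [hc hd E2]]] := @derivative_mixed_difference u w v x h h0 dw dwv.
have EE : 'D_w ('D_v u) (x + a *: v + b *: w) = 'D_v ('D_w u) (x + c *: w + d *: v).
  have hn : h != 0 by rewrite gt_eqF.
  have L (p q r s : R) : p - q - (r - s) = p - r - (q - s) by ring.
  apply: (mulIf hn); apply: (mulIf hn).
  have C : x + h *: v + h *: w = x + h *: w + h *: v by exact: addrAC.
  rewrite C in E2; exact: (etrans (esym E1) (etrans (L _ _ _ _) E2)).
have A := h1 _ (near_x a b v w r1 ha hb erefl minl).
have B := h2 _ (near_x c d w v r2 hc hd (congr1 (+%R^~ 1) (addrC _ _)) minr).
have L (p q r : R) : p - q = (p - r) - (q - r) by ring.
have -> : 'D_w ('D_v u) x - 'D_v ('D_w u) x =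
   ('D_w ('D_v u) x - 'D_w ('D_v u) (x + a *: v + b *: w)) -
   ('D_v ('D_w u) x - 'D_v ('D_w u) (x + c *: w + d *: v)).
  rewrite EE; exact: L.
apply: le_trans (ler_normB _ _) _; rewrite (splitr e).
exact: lerD (ltW A) (ltW B).
Qed.

End directional_derivatives.

(** * Integrals of derivatives over the cube *)

Section divergence.
Context {R : realType} {n : nat}.
Local Notation mR := (measurableTypeR R).
Implicit Types (u : 'rV[R]_n -> R) (x v : 'rV[R]_n).

Lemma compact_closed_box (a b : R) :
  compact ([set x | forall i, `[a, b]%classic (x ord0 i)] : set 'rV[R]_n).
Proof.
by apply: (@rV_compact R n (fun=> `[a, b]%classic)) => i; exact: segment_compact.
Qed.

Lemma continuous_bounded_cube u : continuous u ->
  exists M, forall x, unit_cube x -> `|u x| <= M.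
Proof.
move=> cu.
pose C : set 'rV[R]_n := [set x | forall i, `[0, 1]%classic (x ord0 i)].
have cC : compact C by exact: compact_closed_box.
have cuC : compact (u @` C).
  by apply: continuous_compact => //; exact: continuous_subspaceT.
have [M [_ uM]] := compact_bounded cuC.
have M1 : M < M + 1 by rewrite ltrDl.
exists (M + 1) => x xC; apply: (uM _ M1 (u x)).
exists x => // i; have := xC i; rewrite /= in_itv /= => /andP[? ?].
by rewrite !ltW.
Qed.

(** On each line parallel to axis [i] this is the fundamental theorem of calculus: both ends of the
    segment lie outside the open cube, where [u] vanishes. *)
Lemma cube_integral_derivative u i :
  (forall x, derivable u x (delta_mx 0 i)) -> continuous ('D_(delta_mx 0 i) u) ->
  (forall x, ~ unit_cube x -> u x = 0) ->
  (\int[lebesgue_tuple n]_(t in @cube_tuple R n) ('D_(delta_mx 0 i) u (tuple_row t))%:E = 0)%E.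
Proof.
move=> du cu u0; have [M uM] := continuous_bounded_cube cu.
apply: (@cube_integral_line0 _ _ (fun t => 'D_(delta_mx 0 i) u (tuple_row t)) M i).
- exact: (@measurable_continuous_row _ _ ('D_(delta_mx 0 i) u) cu).
- by move=> t Ct; exact: uM.
move=> t Ct.
have E (s : mR) : tuple_row (tuple_upd t i s) = tuple_row (tuple_upd t i (0 : R)) + s *: delta_mx 0 i.
  apply/rowP => j; rewrite !mxE !tnth_mktuple eqxx /=.
  by case: eqP => _ /=; rewrite ?mulr1 ?mulr0 ?addr0 ?add0r.
set y := tuple_row _ in E.
pose g (s : R) := u (y + s *: delta_mx 0 i).
pose g' (s : R) := 'D_(delta_mx 0 i) u (y + s *: delta_mx 0 i).
have dg (s : R) : is_derive s 1 g (g' s) by exact: is_derive_line.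
have cg : continuous g.
  move=> s; have /derivable1_diffP/differentiable_continuous := @ex_derive _ _ _ _ _ _ _ (dg s).
  exact.
have cg' : continuous g'.
  move=> s.
  have cl : y + r *: delta_mx 0 i @[r --> s] --> y + s *: delta_mx 0 i.
    by apply: cvgD; [exact: cvg_cst|apply: cvgZr_tmp; exact: cvg_id].
  exact: (cvg_comp _ _ cl (cu _)).
have ge (s : R) : s = 0 \/ s = 1 -> g s = 0.
  move=> s01; apply: u0; rewrite -E => /(_ i); rewrite mxE tnth_mktuple eqxx.
  by case: s01 => ->; rewrite ltxx ?andbF.
transitivity (\int[@lebesgue_measure R]_(s in `]0%R, 1%R[) (g' s)%:E)%E.
  by apply: eq_integral => s _; rewrite E.
rewrite -(@integral_itv_bndoo _ _ _ _ true false); last first.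
  by apply/measurable_EFinP; apply: measurable_funTS; exact: continuous_measurable_fun.
rewrite (@continuous_FTC2 _ g' g) //.
- by rewrite !ge ?subee; [| |left|right].
- exact: continuous_subspaceT.
- split=> [s _||]; first exact: ex_derive.
  + exact/cvg_at_right_filter/cg.
  + exact/cvg_at_left_filter/cg.
- by move=> s _; rewrite derive1E; apply: derive_val.
Qed.

End divergence.

Section cube_integral.
Context {R : realType} {n : nat}.
Local Notation mR := (measurableTypeR R).
Implicit Types (u v : 'rV[R]_n -> R).

(** Real-valued, so that later estimates are plain real arithmetic; [cube_intE] identifies it with
    the extended integral of [SQ] for continuous [u]. *)
Definition cube_int u : R :=
  (\int[lebesgue_tuple n]_(t in @cube_tuple R n) u (tuple_row t))%R.

Lemma continuous_fun_cst (c : R) : continuous (fun _ : 'rV[R]_n => c).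
Proof. exact: cst_continuous. Qed.

Lemma continuous_funD u v : continuous u -> continuous v -> continuous (fun x => u x + v x).
Proof. by move=> cu cv x; exact: (cvgD (cu x) (cv x)). Qed.

Lemma continuous_funM u v : continuous u -> continuous v -> continuous (fun x => u x * v x).
Proof. by move=> cu cv x; exact: (cvgM (cu x) (cv x)). Qed.

Lemma continuous_fun_sum I (r : seq I) (P : pred I) (F : I -> 'rV[R]_n -> R) :
  (forall i, P i -> continuous (F i)) -> continuous (fun x => \sum_(i <- r | P i) F i x).
Proof.
move=> cF; elim: r => [|i r IH].
  by rewrite (funext (fun x => big_nil _ _ _ _)); exact: continuous_fun_cst.
rewrite (funext (fun x => big_cons _ _ _ _ _ _)).
have [Pi|//] := boolP (P i).
by apply: continuous_funD => //; exact: cF.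
Qed.

Lemma integrable_continuous u : continuous u ->
  (lebesgue_tuple n).-integrable (@cube_tuple R n) (EFin \o (fun t => u (tuple_row t))).
Proof.
move=> cu; have [M uM] := continuous_bounded_cube cu.
apply: (@integrable_cube _ _ _ M); first exact: measurable_continuous_row.
by move=> t Ct; exact: uM.
Qed.

Lemma cube_intE u : continuous u ->
  (\int[lebesgue_tuple n]_(t in @cube_tuple R n) (u (tuple_row t))%:E = (cube_int u)%:E)%E.
Proof.
move=> cu; rewrite /cube_int /Rintegral fineK //.
by apply: integrable_fin_num; [exact: measurable_cube|exact: integrable_continuous].
Qed.

Lemma cube_intD u v : continuous u -> continuous v ->
  cube_int (fun x => u x + v x) = cube_int u + cube_int v.
Proof.
move=> cu cv; rewrite /cube_int RintegralD //; first exact: measurable_cube.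
all: exact: integrable_continuous.
Qed.

Lemma cube_intZ (c : R) u : continuous u -> cube_int (fun x => c * u x) = c * cube_int u.
Proof.
move=> cu; rewrite /cube_int RintegralZl //; first exact: measurable_cube.
exact: integrable_continuous.
Qed.

Lemma cube_int_cst (c : R) : cube_int (fun _ => c) = c.
Proof.
rewrite /cube_int Rintegral_cst; last exact: measurable_cube.
by rewrite [X in fine X]lebesgue_cube mulr1.
Qed.

Lemma cube_int_sum I (r : seq I) (F : I -> 'rV[R]_n -> R) :
  (forall i, continuous (F i)) ->
  cube_int (fun x => \sum_(i <- r) F i x) = \sum_(i <- r) cube_int (F i).
Proof.
move=> cF; elim: r => [|i r IH].
  by rewrite (funext (fun x => big_nil _ _ _ _)) cube_int_cst big_nil.
rewrite (funext (fun x => big_cons _ _ _ _ _ _)).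
by rewrite big_cons cube_intD // ?IH //; exact: continuous_fun_sum.
Qed.

Lemma le_cube_int u v : continuous u -> continuous v ->
  (forall x, unit_cube x -> u x <= v x) -> cube_int u <= cube_int v.
Proof.
move=> cu cv uv; apply: le_Rintegral; first exact: measurable_cube.
- exact: integrable_continuous.
- exact: integrable_continuous.
- by move=> t Ct; exact: uv.
Qed.

End cube_integral.

(** * Null Lagrangians and the translation bound *)

Section null_lagrangian.
Context {R : realType} {n : nat}.
Implicit Types (u v : 'rV[R]_n -> R).

Lemma is_derive_fun u (e : 'rV[R]_n) (du : 'rV[R]_n -> R) :
  (forall x, is_derive x e u (du x)) -> (forall x, derivable u x e) /\ 'D_e u = du.
Proof.
by move=> hu; split=> [x|]; [exact: ex_derive|apply/funext => x; exact: derive_val].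
Qed.

Lemma cube_int_derivative u du j :
  (forall x, is_derive x (delta_mx 0 j) u (du x)) -> continuous du ->
  (forall x, ~ unit_cube x -> u x = 0) -> cube_int du = 0.
Proof.
move=> /is_derive_fun[hu <-] cdu u0; apply: EFin_inj.
by rewrite -cube_intE // cube_integral_derivative.
Qed.

Lemma is_deriveC (e1 e2 : 'rV[R]_n) (f f1 f2 f12 f21 : 'rV[R]_n -> R) :
  (forall x, is_derive x e1 f (f1 x)) -> (forall x, is_derive x e2 f (f2 x)) ->
  (forall x, is_derive x e2 f1 (f12 x)) -> (forall x, is_derive x e1 f2 (f21 x)) ->
  continuous f12 -> continuous f21 -> f12 =1 f21.
Proof.
move=> /is_derive_fun[d1 D1] /is_derive_fun[d2 D2] /is_derive_fun[d12 D12].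
move=> /is_derive_fun[d21 D21] c12 c21 x.
have := @derivativeC _ _ f e1 e2 x d1 d2; rewrite D1 D2 D12 D21; by move=> /(_ d12 d21 c12 c21) h; rewrite -D12 -D21.
Qed.

Variables (u v : 'rV[R]_n -> R) (du dv : 'I_n -> 'rV[R]_n -> R).
Variable (ddv : 'I_n -> 'I_n -> 'rV[R]_n -> R).
Hypotheses (hu : forall i x, is_derive x (delta_mx 0 i) u (du i x))
  (hv : forall i x, is_derive x (delta_mx 0 i) v (dv i x))
  (hdv : forall i j x, is_derive x (delta_mx 0 j) (dv i) (ddv i j x)).
Hypotheses (cu : continuous u) (cdu : forall i, continuous (du i))
  (cdv : forall i, continuous (dv i)) (cddv : forall i j, continuous (ddv i j)).
Hypothesis u0 : forall x, ~ unit_cube x -> u x = 0.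

Let by_parts i j : cube_int (fun x => u x * ddv j i x) + cube_int (fun x => du i x * dv j x) = 0.
Proof.
rewrite -cube_intD; [|exact: continuous_funM..].
apply: (@cube_int_derivative (fun x => u x * dv j x) _ i).
- move=> x; apply: (is_derive_eq (is_deriveM (hu i x) (hdv j i x))).
  by congr (_ + _); exact: mulrC.
- by apply: continuous_funD; exact: continuous_funM.
- by move=> x /u0 ->; rewrite mul0r.
Qed.

(** By parts, each side is minus the integral of [u] times a mixed second derivative of [v], and
    these derivatives commute. *)
Lemma cube_int_null_lagrangian i j :
  cube_int (fun x => du i x * dv j x) = cube_int (fun x => du j x * dv i x).
Proof.
have E : (fun x => u x * ddv j i x) = (fun x => u x * ddv i j x).
  by apply/funext => x; congr (_ * _); exact: (is_deriveC (hv j) (hv i) (hdv j i) (hdv i j)).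
by have := by_parts i j; have := by_parts j i; rewrite E => <- /addrI.
Qed.

End null_lagrangian.

Section test_fields.
Context {R : realType} {n : nat}.
Implicit Types (phi : 'rV[R]_n -> 'rV[R]_n) (x : 'rV[R]_n).

Lemma derivable_coord phi x v k : derivable phi x v -> derivable (fun y => phi y 0 k) x v.
Proof. by move/derivable_mxP => /(_ 0 k). Qed.

Lemma derive_coord phi x v k : derivable phi x v ->
  'D_v (fun y => phi y 0 k) x = 'D_v phi x 0 k.
Proof. by move=> dphi; rewrite derive_mx // mxE. Qed.

Lemma test_field0 phi x : test_field phi -> ~ unit_cube x -> phi x = 0.
Proof.
move=> [_ _ sphi] xC; apply: contra_notP xC => /eqP phix; apply: sphi.
exact: subset_closure.
Qed.

Definition iterated_partial phi s k : 'rV[R]_n -> R := fun x => foldr partial phi s x 0 k.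

Lemma is_derive_iterated_partial phi s k j x : smooth phi ->
  is_derive x (delta_mx 0 j) (iterated_partial phi s k) (iterated_partial phi (j :: s) k x).
Proof.
move=> sphi; have [_ dphi] := sphi s.
by split; [exact: derivable_coord|exact: derive_coord].
Qed.

Lemma continuous_iterated_partial phi s k : smooth phi ->
  continuous (iterated_partial phi s k).
Proof.
move=> sphi x; have [cphi _] := sphi s.
exact: (cvg_comp _ _ (cphi x) (@coord_continuous _ _ _ 0 k _)).
Qed.

Lemma gradientE phi i j : (fun x => gradient phi x i j) = iterated_partial phi [:: j] i.
Proof. by apply/funext => x; rewrite mxE. Qed.

Lemma continuous_gradient phi i j : smooth phi -> continuous (fun x => gradient phi x i j).
Proof. by move=> sphi; rewrite gradientE; exact: continuous_iterated_partial. Qed.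

Lemma cube_int_gradient phi i j : test_field phi ->
  cube_int (fun x => gradient phi x i j) = 0.
Proof.
move=> tphi; have [sphi _ _] := tphi; rewrite gradientE.
apply: (@cube_int_derivative _ _ (iterated_partial phi [::] i) _ j).
- by move=> x; exact: is_derive_iterated_partial.
- exact: continuous_iterated_partial.
- by move=> x /(test_field0 tphi) phix; rewrite /iterated_partial /= phix mxE.
Qed.

(** The vanishing integral of the quadratic minors, written as an exchange of differentiation
    indices so that it applies term by term to quadratic forms of the gradient. *)
Lemma cube_int_minor phi i j k l : test_field phi ->
  cube_int (fun x => gradient phi x i j * gradient phi x k l) =
  cube_int (fun x => gradient phi x i l * gradient phi x k j).
Proof.
move=> tphi; have [sphi _ _] := tphi.
have E a b c d : (fun x => gradient phi x a b * gradient phi x c d) =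
    (fun x => iterated_partial phi [:: b] a x * iterated_partial phi [:: d] c x).
  by apply/funext => x; rewrite !mxE.
rewrite !E; apply: (@cube_int_null_lagrangian _ _
    (iterated_partial phi [::] i) (iterated_partial phi [::] k)
    (fun a => iterated_partial phi [:: a] i) (fun a => iterated_partial phi [:: a] k)
    (fun a b => iterated_partial phi [:: b; a] k)) => *.
all: try exact: is_derive_iterated_partial.
all: try exact: continuous_iterated_partial.
by rewrite /iterated_partial /= (test_field0 tphi) ?mxE.
Qed.

End test_fields.

(** * Algebra of the elastic quadratic forms *)

Section quadratic_forms.
Context {R : realType} {n : nat}.
Implicit Types (x y z p : 'M[R]_n).

Lemma frobeniusE x y : frobenius x y = \sum_i \sum_j x i j * y j i.
Proof. by apply: eq_bigr => i _; rewrite mxE. Qed.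

Lemma frobeniusC x y : frobenius x y = frobenius y x.
Proof. exact: mxtrace_mulC. Qed.

Lemma frobeniusDl x y z : frobenius (x + y) z = frobenius x z + frobenius y z.
Proof. by rewrite /frobenius mulmxDl mxtraceD. Qed.

Lemma frobeniusDr x y z : frobenius x (y + z) = frobenius x y + frobenius x z.
Proof. by rewrite /frobenius mulmxDr mxtraceD. Qed.

Lemma frobeniusZl c x y : frobenius (c *: x) y = c * frobenius x y.
Proof. by rewrite /frobenius -scalemxAl mxtraceZ. Qed.

Lemma frobeniusZr c x y : frobenius x (c *: y) = c * frobenius x y.
Proof. by rewrite frobeniusC frobeniusZl frobeniusC. Qed.

Lemma frobenius_scalar c x : frobenius c%:M x = c * \tr x.
Proof. by rewrite /frobenius mul_scalar_mx mxtraceZ. Qed.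

Lemma frobenius_symm x : symmx x -> frobenius x x = \sum_i \sum_j x i j ^+ 2.
Proof.
move=> sx; rewrite frobeniusE; apply: eq_bigr => i _; apply: eq_bigr => j _.
by rewrite -[in x j i]sx mxE expr2.
Qed.

Lemma frobenius_ge0 x : symmx x -> 0 <= frobenius x x.
Proof.
by move=> sx; rewrite frobenius_symm //; do 2 apply: sumr_ge0 => ? _; rewrite sqr_ge0.
Qed.

Lemma symmxD x y : symmx x -> symmx y -> symmx (x + y).
Proof. by move=> sx sy; rewrite /symmx /= linearD /= sx sy. Qed.

Lemma symmxZ c x : symmx x -> symmx (c *: x).
Proof. by move=> sx; rewrite /symmx /= linearZ /= sx. Qed.

Lemma symmxB x y : symmx x -> symmx y -> symmx (x - y).
Proof. by move=> sx sy; rewrite /symmx /= linearB /= sx sy. Qed.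

Lemma symmx_scalar c : symmx (c%:M : 'M[R]_n).
Proof. exact: tr_scalar_mx. Qed.

Lemma symmx_sum I (r : seq I) (F : I -> 'M[R]_n) :
  (forall i, symmx (F i)) -> symmx (\sum_(i <- r) F i).
Proof.
by move=> sF; elim/big_rec : _ => [|i x _]; [exact: trmx0|exact: symmxD].
Qed.

Section energy.
Variables lam mu : R.
Local Notation E := (elastic_energy lam mu).

Definition elastic_form x y : R := 2^-1 * frobenius (isotropic lam mu x) y.
Local Notation B := elastic_form.

Lemma frobenius_isotropic x y :
  frobenius (isotropic lam mu x) y = lam * \tr x * \tr y + 2 * mu * frobenius x y.
Proof. by rewrite frobeniusDl frobenius_scalar frobeniusZl. Qed.

Lemma elastic_energyE x :
  E x = 2^-1 * (lam * \tr x ^+ 2 + 2 * mu * frobenius x x).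
Proof. by rewrite /elastic_energy frobenius_isotropic expr2 mulrA. Qed.

Lemma symmx_isotropic x : symmx x -> symmx (isotropic lam mu x).
Proof. by move=> sx; apply: symmxD; [exact: symmx_scalar|exact: symmxZ]. Qed.

Lemma elastic_formC x y : B x y = B y x.
Proof. by rewrite /B !frobenius_isotropic (frobeniusC x y) mulrAC. Qed.

Lemma elastic_formDr x y z : B x (y + z) = B x y + B x z.
Proof. by rewrite /B frobeniusDr mulrDr. Qed.

Lemma elastic_formDl x y z : B (x + y) z = B x z + B y z.
Proof. by rewrite elastic_formC elastic_formDr !(elastic_formC z). Qed.

Lemma elastic_formZr c x y : B x (c *: y) = c * B x y.
Proof. by rewrite /B frobeniusZr mulrCA. Qed.

Lemma elastic_formZl c x y : B (c *: x) y = c * B x y.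
Proof. by rewrite elastic_formC elastic_formZr elastic_formC. Qed.

Lemma elastic_energyB x : E x = B x x. Proof. by []. Qed.

Lemma elastic_energyD x y : E (x + y) = E x + 2 * B x y + E y.
Proof.
by rewrite !elastic_energyB !elastic_formDl !elastic_formDr (elastic_formC y x); ring.
Qed.

Lemma elastic_energyZ c x : E (c *: x) = c ^+ 2 * E x.
Proof. by rewrite !elastic_energyB elastic_formZl elastic_formZr mulrA expr2. Qed.

Lemma elastic_form_suml I (r : seq I) (F : I -> 'M[R]_n) y :
  B (\sum_(i <- r) F i) y = \sum_(i <- r) B (F i) y.
Proof.
elim: r => [|i r IH]; last by rewrite !big_cons elastic_formDl IH.
by rewrite !big_nil -(scale0r 0) elastic_formZl mul0r.
Qed.

Lemma elastic_form_sumr I (r : seq I) (F : I -> 'M[R]_n) y :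
  B y (\sum_(i <- r) F i) = \sum_(i <- r) B y (F i).
Proof.
by rewrite elastic_formC elastic_form_suml; under eq_bigr do rewrite elastic_formC.
Qed.

Hypotheses (lam0 : 0 < lam) (mu0 : 0 < mu).

Lemma elastic_energy_ge0 x : symmx x -> 0 <= E x.
Proof.
move=> sx; rewrite elastic_energyE mulr_ge0 ?invr_ge0 // addr_ge0 //.
  by rewrite mulr_ge0 ?sqr_ge0 // ltW.
by rewrite !mulr_ge0 ?frobenius_ge0 // ltW.
Qed.

Lemma elastic_energy_young (t : R) x y : 0 < t -> symmx x -> symmx y ->
  E (x + y) <= (1 + t) * E x + (1 + t^-1) * E y.
Proof.
move=> t0 sx sy.
(* Young's inequality is the expansion of [E (t x - y) >= 0], divided by [t]. *)
have := elastic_energy_ge0 (symmxD (symmxZ t sx) (symmxZ (-1) sy)).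
rewrite !elastic_energyD elastic_formZl elastic_formZr !elastic_energyZ sqrrN expr1n mul1r => h.
rewrite -subr_ge0.
have -> : (1 + t) * E x + (1 + t^-1) * E y - (E x + 2 * B x y + E y) =
  t^-1 * (t ^+ 2 * E x + 2 * (t * (-1 * B x y)) + E y) by field; rewrite gt_eqF.
by rewrite mulr_ge0 // invr_ge0 ltW.
Qed.

Lemma elastic_energyD_le x y : symmx x -> symmx y -> E (x + y) <= 2 * E x + 2 * E y.
Proof.
by move=> sx sy; have := elastic_energy_young ltr01 sx sy; rewrite invr1.
Qed.

End energy.

Lemma elastic_energy_compare (l m l' m' C : R) x : symmx x ->
  l <= C * l' -> m <= C * m' -> elastic_energy l m x <= C * elastic_energy l' m' x.
Proof.
move=> sx hl hm; rewrite !elastic_energyE [leRHS]mulrCA ler_wpM2l ?invr_ge0 // mulrDr.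
apply: lerD; rewrite [leRHS]mulrA ler_wpM2r ?sqr_ge0 ?frobenius_ge0 //.
by rewrite mulrCA ler_wpM2l.
Qed.

End quadratic_forms.

Section translation.
Context {R : realType} {n : nat}.
Implicit Types (phi : 'rV[R]_n -> 'rV[R]_n) (x : 'rV[R]_n) (p q M : 'M[R]_n).

Lemma symgradE phi x i j :
  symgrad phi x i j = 2^-1 * (gradient phi x i j + gradient phi x j i).
Proof. by rewrite !mxE. Qed.

Lemma symmx_symgrad phi x : symmx (symgrad phi x).
Proof. by apply/matrixP => i j; rewrite mxE !symgradE addrC. Qed.

Lemma continuous_symgrad phi i j : smooth phi -> continuous (fun x => symgrad phi x i j).
Proof.
move=> sphi; rewrite (funext (fun x => symgradE phi x i j)).
apply: continuous_funM; first exact: continuous_fun_cst.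
by apply: continuous_funD; exact: continuous_gradient.
Qed.

Lemma continuous_frobenius (F H : 'rV[R]_n -> 'M[R]_n) :
  (forall i j, continuous (fun x => F x i j)) -> (forall i j, continuous (fun x => H x i j)) ->
  continuous (fun x => frobenius (F x) (H x)).
Proof.
move=> cF cH; rewrite (funext (fun x => frobeniusE (F x) (H x))).
by do 2 (apply: continuous_fun_sum => ? _); exact: continuous_funM.
Qed.

Lemma continuous_mxtrace (F : 'rV[R]_n -> 'M[R]_n) :
  (forall i j, continuous (fun x => F x i j)) -> continuous (fun x => \tr (F x)).
Proof. by move=> cF; apply: continuous_fun_sum. Qed.

Lemma continuous_elastic_energy lam mu (F : 'rV[R]_n -> 'M[R]_n) :
  (forall i j, continuous (fun x => F x i j)) ->
  continuous (fun x => elastic_energy lam mu (F x)).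
Proof.
move=> cF; rewrite (funext (fun x => elastic_energyE lam mu (F x))).
apply: continuous_funM; first exact: continuous_fun_cst.
apply: continuous_funD; apply: continuous_funM; do ?exact: continuous_fun_cst.
  by apply: continuous_funM; exact: continuous_mxtrace.
exact: continuous_frobenius.
Qed.

Lemma cube_int_frobenius_symgrad p phi : test_field phi ->
  cube_int (fun x => frobenius p (symgrad phi x)) = 0.
Proof.
move=> tphi; have [sphi _ _] := tphi.
have cs := fun i j => @continuous_symgrad phi i j sphi.
rewrite (funext (fun x => frobeniusE p (symgrad phi x))) cube_int_sum => [|i]; last first.
  by apply: continuous_fun_sum => j _; apply: continuous_funM => //; exact: continuous_fun_cst.
rewrite big1 // => i _; rewrite cube_int_sum => [|j]; last first.
  by apply: continuous_funM => //; exact: continuous_fun_cst.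
rewrite big1 // => j _; rewrite cube_intZ // (funext (fun x => symgradE phi x j i)).
rewrite cube_intZ; last by apply: continuous_funD; exact: continuous_gradient.
rewrite cube_intD; [|exact: continuous_gradient..].
by rewrite !cube_int_gradient // addr0 !mulr0.
Qed.

Definition opnorm_le (s : R) q := forall v : 'cV[R]_n,
  \sum_i (q *m v) i 0 ^+ 2 <= s ^+ 2 * \sum_i v i 0 ^+ 2.

(** With [N = q M], one has [tr (N N) <= |N|^2] by [2 a b <= a^2 + b^2], and [|q M|^2 <= s^2 |M|^2]
    column by column. *)
Lemma trace_mulmx_opnorm_le s q M : opnorm_le s q ->
  \tr (q *m M *m (q *m M)) <= s ^+ 2 * \sum_i \sum_j M i j ^+ 2.
Proof.
move=> cq; apply: (@le_trans _ _ (\sum_i \sum_j (q *m M) i j ^+ 2)).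
  set N := q *m M; rewrite [leLHS]/mxtrace; under eq_bigr do rewrite mxE.
  have H (a b : R) : a * b <= 2^-1 * (a ^+ 2 + b ^+ 2) by have := sqr_ge0 (a - b); lra.
  apply: (@le_trans _ _ (\sum_i \sum_j 2^-1 * (N i j ^+ 2 + N j i ^+ 2))).
    by do 2 apply: ler_sum => ? _; exact: H.
  under eq_bigr do rewrite -mulr_sumr big_split.
  rewrite -mulr_sumr big_split /= [X in _ + X]exchange_big /=.
  by set S := \sum_i _; lra.
rewrite exchange_big [X in _ * X]exchange_big mulr_sumr; apply: ler_sum => j _ /=.
have := cq (col j M); rewrite colE mulmxA -!colE.
rewrite (eq_bigr (fun i => (q *m M) i j ^+ 2)) => [|i _]; last by rewrite mxE.
by rewrite [X in _ * X](eq_bigr (fun i => M i j ^+ 2)) // => i _; rewrite mxE.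
Qed.

(* The map [e |-> Gam (A e : e) - (p : e)^2] is a nonnegative form plus a null
   Lagrangian: writing [p = r Id + q], exchanging two indices turns the integral of
   [(q : grad phi)^2] into that of [tr (q grad phi q grad phi)]. *)
Lemma quasiconvex_translation (lam mu r s Gam : R) p phi : test_field phi ->
  0 < lam -> 0 < mu -> 0 < s -> symmx p -> opnorm_le s (p - r%:M) ->
  r ^+ 2 / (lam + mu) + s ^+ 2 / mu <= Gam ->
  cube_int (fun x => frobenius p (symgrad phi x) ^+ 2) <=
  Gam * cube_int (fun x => 2 * elastic_energy lam mu (symgrad phi x)).
Proof.
move=> tphi lam0 mu0 s0 sp; set q := p - r%:M => cq Gam_ge.
have [sphi _ _] := tphi.
have sq : symmx q by apply: symmxB => //; exact: symmx_scalar.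
pose M := gradient phi.
have cM i j : continuous (fun x => M x i j) by exact: continuous_gradient.
have cN i j : continuous (fun x => (q *m M x) i j).
  rewrite (funext (fun x => mxE _ _ _ _)).
  by apply: continuous_fun_sum => k _; apply: continuous_funM => //; exact: continuous_fun_cst.
pose T x := \tr (M x); pose D x := \tr (q *m M x); pose N x := \sum_i \sum_j M x i j ^+ 2.
have cT : continuous T by exact: continuous_mxtrace.
have cD : continuous D by exact: continuous_mxtrace.
have cN2 : continuous N.
  by do 2 (apply: continuous_fun_sum => ? _); exact: continuous_funM.
have cT2 : continuous (fun x => T x ^+ 2) by exact: continuous_funM.
have cD2 : continuous (fun x => D x ^+ 2) by exact: continuous_funM.
have cMM : continuous (fun x => \tr (M x *m M x)) by exact: continuous_frobenius.
have cqq : continuous (fun x => \tr (q *m M x *m (q *m M x))) by exact: continuous_frobenius.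
have ccst (c : R) : continuous (fun _ : 'rV[R]_n => c) by exact: continuous_fun_cst.
(* [(tr M)^2 - tr (M M)] is a sum of quadratic minors. *)
have E1 : cube_int (fun x => \tr (M x *m M x)) = cube_int (fun x => T x ^+ 2).
  transitivity (\sum_i \sum_j cube_int (fun x => M x i j * M x j i)).
    rewrite (funext (fun x => frobeniusE (M x) (M x))) cube_int_sum => [|i]; last first.
      by apply: continuous_fun_sum => j _; exact: continuous_funM.
    by apply: eq_bigr => i _; rewrite cube_int_sum // => j; exact: continuous_funM.
  rewrite (_ : (fun x => T x ^+ 2) = (fun x => \sum_i \sum_j M x i i * M x j j)).
    rewrite cube_int_sum => [|i]; last first.
      by apply: continuous_fun_sum => j _; exact: continuous_funM.
    apply: eq_bigr => i _; rewrite cube_int_sum => [|j]; last exact: continuous_funM.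
    by apply: eq_bigr => j _; exact: cube_int_minor.
  by apply/funext => x; rewrite expr2 mulr_suml; apply: eq_bigr => i _; rewrite mulr_sumr.
(* After the exchange of indices the spectral norm of [q] suffices ([E3]); a pointwise bound of
   [(tr (q M))^2] by [|M|^2] would cost the larger Frobenius norm. *)
have E2 : cube_int (fun x => D x ^+ 2) = cube_int (fun x => \tr (q *m M x *m (q *m M x))).
  have c4 a b c d (k : R) : continuous (fun x => k * (M x a b * M x c d)).
    by apply: continuous_funM => //; exact: continuous_funM.
  have S (F : 'I_n -> 'I_n -> 'I_n -> 'I_n -> 'rV[R]_n -> R) :
      (forall i j k l, continuous (F i j k l)) ->
      cube_int (fun x => \sum_i \sum_j \sum_k \sum_l F i j k l x) =
      \sum_i \sum_j \sum_k \sum_l cube_int (F i j k l).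
    move=> cF.
    rewrite cube_int_sum => [|i]; last by do 3 (apply: continuous_fun_sum => ? _).
    apply: eq_bigr => i _; rewrite cube_int_sum => [|j]; last by do 2 (apply: continuous_fun_sum => ? _).
    apply: eq_bigr => j _; rewrite cube_int_sum => [|k]; last by apply: continuous_fun_sum => ? _.
    by apply: eq_bigr => k _; rewrite cube_int_sum.
  transitivity (cube_int (fun x => \sum_i \sum_j \sum_k \sum_l
      (q i j * q k l) * (M x j i * M x l k))).
    congr cube_int; apply/funext => x.
    rewrite /D -/(frobenius _ _) frobeniusE expr2 mulr_suml; apply: eq_bigr => i _.
    rewrite mulr_suml; apply: eq_bigr => j _; rewrite mulr_sumr; apply: eq_bigr => k _.
    by rewrite mulr_sumr; apply: eq_bigr => l _; rewrite mulrACA.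
  rewrite S //.
  transitivity (cube_int (fun x => \sum_i \sum_j \sum_k \sum_l
      (q i j * q k l) * (M x j k * M x l i))).
    rewrite S //; do 4 (apply: eq_bigr => ? _).
    rewrite !cube_intZ; [|exact: continuous_funM..].
    by congr (_ * _); exact: cube_int_minor.
  congr cube_int; apply/funext => x.
  rewrite -/(frobenius _ _) frobeniusE; apply: eq_bigr => i _.
  rewrite exchange_big; apply: eq_bigr => k _; rewrite !mxE mulr_suml.
  apply: eq_bigr => j _; rewrite mulr_sumr; apply: eq_bigr => l _.
  by rewrite mulrACA.
have E3 : cube_int (fun x => D x ^+ 2) <= s ^+ 2 * cube_int N.
  rewrite E2 -cube_intZ //; apply: le_cube_int => //; first exact: continuous_funM.
  by move=> x _; exact: trace_mulmx_opnorm_le.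
have trF x : \tr (symgrad phi x) = T x.
  by rewrite /symgrad mxtraceZ mxtraceD mxtrace_tr -/(T x); field.
have pF x : frobenius p (symgrad phi x) = r * T x + D x.
  have -> : p = r%:M + q by rewrite /q addrC subrK.
  rewrite frobeniusDl frobenius_scalar trF; congr (_ + _).
  rewrite /symgrad frobeniusZr frobeniusDr /D.
  have -> : frobenius q (gradient phi x)^T = \tr (q *m M x).
    by rewrite /frobenius -mxtrace_tr trmx_mul trmxK mxtrace_mulC sq.
  by rewrite /frobenius -/(M x); field.
(* Integrated with [E1], this is [(lam + mu) T^2 + mu N]: the origin of the two denominators in the
   bound on [Gam]. *)
have elF x : 2 * elastic_energy lam mu (symgrad phi x) =
    lam * T x ^+ 2 + mu * (N x + \tr (M x *m M x)).
  rewrite elastic_energyE trF.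
  suff -> : frobenius (symgrad phi x) (symgrad phi x) = 2^-1 * (N x + \tr (M x *m M x)) by field.
  rewrite {1}/symgrad frobeniusZl frobeniusDl.
  have -> : frobenius (gradient phi x)^T (symgrad phi x) = frobenius (M x) (symgrad phi x).
    by rewrite /frobenius -mxtrace_tr trmx_mul trmxK mxtrace_mulC symmx_symgrad.
  rewrite -/(M x) /symgrad frobeniusZr frobeniusDr -/(M x) -[\tr _]/(frobenius _ _).
  have -> : frobenius (M x) (M x)^T = N x.
    by rewrite frobeniusE; do 2 (apply: eq_bigr => ? _); rewrite [_^T _ _]mxE expr2.
  by field.
rewrite (funext elF) (funext (fun x => congr1 (fun a => a ^+ 2) (pF x))).
have I0 (u : 'rV[R]_n -> R) : continuous u -> (forall x, 0 <= u x) -> 0 <= cube_int u.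
  by move=> cu u0; rewrite -[leLHS](@cube_int_cst R n 0); apply: le_cube_int.
rewrite cube_intD; [| |]; do ?[by apply: continuous_funM => //; exact: continuous_funD].
rewrite !cube_intZ // ?cube_intD //; last exact: continuous_funD.
rewrite E1.
have a0 : 0 <= cube_int (fun x => T x ^+ 2) by apply: I0 => // x; rewrite sqr_ge0.
have m0 : 0 <= cube_int N.
  by apply: I0 => // x; do 2 (apply: sumr_ge0 => ? _); rewrite sqr_ge0.
set G0 := r ^+ 2 / (lam + mu) + s ^+ 2 / mu in Gam_ge.
have lm0 : 0 < lam + mu by rewrite addr_gt0.
apply: (@le_trans _ _ (G0 * ((lam + mu) * cube_int (fun x => T x ^+ 2) +
    mu / s ^+ 2 * cube_int (fun x => D x ^+ 2)))).
  rewrite -!cube_intZ // -cube_intD //; do ?exact: continuous_funM.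
  rewrite -cube_intZ; last by apply: continuous_funD; exact: continuous_funM.
  apply: le_cube_int.
  - by apply: continuous_funM; apply: continuous_funD => //; exact: continuous_funM.
  - by apply: continuous_funM => //; apply: continuous_funD; exact: continuous_funM.
  (* Cauchy-Schwarz with the weights [lam + mu] and [mu / s^2]; the defect is a multiple of a
     square. *)
  move=> x _; rewrite -subr_ge0 /G0.
  have -> : (r ^+ 2 / (lam + mu) + s ^+ 2 / mu) *
      ((lam + mu) * T x ^+ 2 + mu / s ^+ 2 * D x ^+ 2) - (r * T x + D x) ^+ 2 =
      (lam + mu) * mu * (r / (lam + mu) * (D x / s) - s / mu * T x) ^+ 2.
    by field; rewrite !gt_eqF.
  by rewrite mulr_ge0 ?sqr_ge0 // mulr_ge0 // ltW.
apply: (@le_trans _ _ (G0 * ((lam + mu) * cube_int (fun x => T x ^+ 2) + mu * cube_int N))).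
  apply: ler_wpM2l; first by rewrite /G0 addr_ge0 // divr_ge0 ?sqr_ge0 // ltW.
  rewrite lerD2l -mulrA ler_pM2l // mulrC ler_pdivrMr ?exprn_gt0 // mulrC.
  exact: E3.
have -> : lam * cube_int (fun x => T x ^+ 2) + mu * (cube_int N + cube_int (fun x => T x ^+ 2)) =
  (lam + mu) * cube_int (fun x => T x ^+ 2) + mu * cube_int N by ring.
by apply: ler_wpM2r => //; rewrite addr_ge0 // mulr_ge0 // ltW.
Qed.

End translation.

(** * Lower bound for [SQ W_eps] at fixed [eps] *)

Section lower_bound.
Context {R : realType} {n : nat}.
Variables (lw mw ls ms : R).
Hypotheses (lw0 : 0 < lw) (mw0 : 0 < mw) (ls0 : 0 < ls) (ms0 : 0 < ms).
Implicit Types (xi p e F : 'M[R]_n).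

Lemma W_epsE kappa eta eps xi : W_eps lw mw ls ms kappa eta eps xi =
  Num.min (elastic_energy ls ms xi) (eta * elastic_energy lw mw xi + kappa / eps).
Proof. by rewrite /W_eps /elastic_energy mulrA. Qed.

Lemma continuous_W_eps kappa eta eps (F : 'rV[R]_n -> 'M[R]_n) :
  (forall i j, continuous (fun x => F x i j)) ->
  continuous (fun x => W_eps lw mw ls ms kappa eta eps (F x)).
Proof.
move=> cF; rewrite (funext (fun x => W_epsE kappa eta eps (F x))) => x.
apply: (@continuous_min _ _ (fun x => elastic_energy ls ms (F x))
  (fun x => eta * elastic_energy lw mw (F x) + kappa / eps)).
  exact: continuous_elastic_energy.
apply: continuous_funD; last exact: continuous_fun_cst.
by apply: continuous_funM; [exact: continuous_fun_cst|exact: continuous_elastic_energy].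
Qed.

Lemma continuous_translate (F : 'rV[R]_n -> 'M[R]_n) xi :
  (forall i j, continuous (fun x => F x i j)) ->
  forall i j, continuous (fun x => (xi + F x) i j).
Proof.
move=> cF i j; rewrite (_ : (fun x => _) = (fun x => xi i j + F x i j)).
  by apply: continuous_funD; [exact: continuous_fun_cst|].
by apply/funext => x; rewrite mxE.
Qed.

Lemma SQ_integralE (W : 'M[R]_n -> R) xi phi :
  continuous (fun x => W (xi + symgrad phi x)) ->
  (\int[lebesgue_tuple n]_(t in [set t | unit_cube (\row_i tnth t i)])
       (W (xi + symgrad phi (\row_i tnth t i)))%:E =
   (cube_int (fun x => W (xi + symgrad phi x)))%:E)%E.
Proof. exact: cube_intE. Qed.

Lemma energy_complete_square e0 e : symmx e0 -> symmx e ->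
  elastic_energy ls ms e = frobenius (isotropic ls ms e0) e -
    elastic_energy ls ms e0 + elastic_energy ls ms (e - e0).
Proof.
move=> se0 se; rewrite -{1}(subrK e0 e) addrC !elastic_energyD.
have -> : frobenius (isotropic ls ms e0) e = 2 * elastic_form ls ms e0 e.
  by rewrite /elastic_form; field.
have -> : elastic_form ls ms e0 e = elastic_energy ls ms e0 + elastic_form ls ms e0 (e - e0).
  by rewrite elastic_energyB -elastic_formDr addrC subrK.
ring.
Qed.

(** A single function [LB] lies below both phases. In the undamaged one, the square
    [f (xi + e(phi) - e0)] left over by the completion absorbs the terms in [eta]: this is where [C]
    and [2 eta C <= 1] enter, and [2 eta g e0] (with [g] the energy of [A_w]) is what remains. In
    the damaged one, the last hypothesis leaves enough room. *)
Lemma SQ_lower_bound (kappa eta eps : R) xi e0 (r s Gam C : R) :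
  let p := isotropic ls ms e0 in
  symmx xi -> symmx e0 -> 0 < s -> opnorm_le s (p - r%:M) -> 0 < Gam ->
  r ^+ 2 / (lw + mw) + s ^+ 2 / mw <= Gam -> 0 < eta ->
  lw <= C * ls -> mw <= C * ms -> 2 * eta * C <= 1 ->
  frobenius p xi - elastic_energy ls ms e0 <= kappa / eps - Gam / (2 * eta) ->
  ((frobenius p xi - elastic_energy ls ms e0 - 2 * eta * elastic_energy lw mw e0)%:E <=
   SQ (W_eps lw mw ls ms kappa eta eps) xi)%E.
Proof.
move=> p sxi se0 s0 cp G0 Gle eta0 Cl Cm etaC damaged.
have sp : symmx p by exact: symmx_isotropic.
apply: le_ereal_inf_tmp => _ [phi tphi <-]; have [sphi _ _] := tphi.
have cF := fun i j => @continuous_symgrad _ _ phi i j sphi.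
rewrite SQ_integralE; last by apply: continuous_W_eps; exact: continuous_translate.
rewrite lee_fin; set c := _ - _ - _.
(* This [a] makes [a * Gam * (2 g F)] equal to the quadratic part [eta * g F] of the damaged energy.
   The bracket multiplied by [a] in [LB] has nonnegative integral by [quasiconvex_translation], and
   the terms linear in [F] integrate to 0. *)
pose F := symgrad phi; pose a := eta / (2 * Gam).
have a0 : 0 <= a by rewrite divr_ge0 ?mulr_ge0 // ltW.
pose LB x := (c + (frobenius p (F x) + 2 * eta * elastic_form lw mw xi (F x))) +
  a * (Gam * (2 * elastic_energy lw mw (F x)) - frobenius p (F x) ^+ 2).
have cc (b : R) : continuous (fun _ : 'rV[R]_n => b) by exact: continuous_fun_cst.
have cpF q : continuous (fun x => frobenius q (F x)) by apply: continuous_frobenius.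
have cB : continuous (fun x => elastic_form lw mw xi (F x)).
  by apply: continuous_funM => //; exact: cpF.
have cE : continuous (fun x => 2 * elastic_energy lw mw (F x)).
  by apply: continuous_funM => //; exact: continuous_elastic_energy.
have cL1 : continuous (fun x => frobenius p (F x) + 2 * eta * elastic_form lw mw xi (F x)).
  by apply: continuous_funD => //; exact: continuous_funM.
have cQ1 : continuous (fun x => - 1 * frobenius p (F x) ^+ 2).
  by apply: continuous_funM => //; exact: continuous_funM.
have cQ2 : continuous (fun x => Gam * (2 * elastic_energy lw mw (F x))).
  exact: continuous_funM.
have LBE : LB = (fun x => (c + (frobenius p (F x) + 2 * eta * elastic_form lw mw xi (F x))) +
  a * (Gam * (2 * elastic_energy lw mw (F x)) + - 1 * frobenius p (F x) ^+ 2)).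
  by apply/funext => x; rewrite /LB mulN1r.
have cLB : continuous LB.
  by rewrite LBE; apply: continuous_funD; [|apply: continuous_funM => //];
     apply: continuous_funD.
apply: (@le_trans _ _ (cube_int LB)).
  rewrite LBE cube_intD; [|exact: continuous_funD|];
    last by apply: continuous_funM => //; exact: continuous_funD.
  rewrite cube_intD // cube_int_cst cube_intD //; last exact: continuous_funM.
  rewrite cube_int_frobenius_symgrad // [X in _ + (_ + X)]cube_intZ //.
  have -> : cube_int (fun x => elastic_form lw mw xi (F x)) = 0.
    by rewrite cube_intZ ?cube_int_frobenius_symgrad ?mulr0.
  rewrite mulr0 addr0 addr0 lerDl cube_intZ; last exact: continuous_funD.
  have cp2 : continuous (fun x => frobenius p (F x) ^+ 2) by exact: continuous_funM.
  rewrite mulr_ge0 // cube_intD // (cube_intZ Gam cE) (cube_intZ (- 1) cp2) mulN1r subr_ge0.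
  exact: (quasiconvex_translation tphi lw0 mw0 s0 sp cp Gle).
apply: le_cube_int => //; first by apply: continuous_W_eps; exact: continuous_translate.
move=> x _; rewrite W_epsE le_min /LB -/(F x).
have sF : symmx (F x) by exact: symmx_symgrad.
set pF := frobenius p (F x); set B := elastic_form _ _ _ _.
have gE := elastic_energyD lw mw xi (F x).
rewrite -/B in gE.
have g0 : 0 <= elastic_energy lw mw xi by exact: elastic_energy_ge0.
have aE : a * (Gam * (2 * elastic_energy lw mw (F x)) - pF ^+ 2) =
    eta * elastic_energy lw mw (F x) - a * pF ^+ 2 by rewrite /a; field; rewrite gt_eqF.
rewrite aE /c.
apply/andP; split.
  rewrite (energy_complete_square se0 (symmxD sxi sF)) -/p frobeniusDr -/pF.
  have sd : symmx (xi + F x - e0) by apply: symmxB => //; exact: symmxD.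
  have h1 : elastic_energy lw mw (xi + F x) <=
     2 * elastic_energy lw mw (xi + F x - e0) + 2 * elastic_energy lw mw e0.
    by rewrite -{1}(subrK e0 (xi + F x)); exact: elastic_energyD_le.
  have h2 : elastic_energy lw mw (xi + F x - e0) <= C * elastic_energy ls ms (xi + F x - e0).
    exact: elastic_energy_compare.
  have h3 : eta * elastic_energy lw mw (xi + F x) <=
     2 * eta * (C * elastic_energy ls ms (xi + F x - e0)) + 2 * eta * elastic_energy lw mw e0.
    have h3 : elastic_energy lw mw (xi + F x) <=
        2 * (C * elastic_energy ls ms (xi + F x - e0)) + 2 * elastic_energy lw mw e0 by lra.
    by have := ler_wpM2l (ltW eta0) h3; lra.
  have h4 : 2 * eta * (C * elastic_energy ls ms (xi + F x - e0)) <= elastic_energy ls ms (xi + F x - e0).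
    by rewrite mulrA ler_piMl // elastic_energy_ge0.
  have h5 : 0 <= a * pF ^+ 2 by rewrite mulr_ge0 // sqr_ge0.
  have h6 : eta * elastic_energy lw mw (xi + F x) = eta * elastic_energy lw mw xi +
     2 * eta * B + eta * elastic_energy lw mw (F x) by rewrite gE; ring.
  have h7 : 0 <= eta * elastic_energy lw mw xi by rewrite mulr_ge0 // ltW.
  lra.
(* The concave function [y - a y^2] has maximum [1 / (4 a) = Gam / (2 eta)]. *)
have h1 : pF - a * pF ^+ 2 <= Gam / (2 * eta).
  rewrite -subr_ge0; have -> : Gam / (2 * eta) - (pF - a * pF ^+ 2) =
    a * (pF - Gam / eta) ^+ 2 by rewrite /a; field; rewrite !gt_eqF.
  by rewrite mulr_ge0 // sqr_ge0.
have h6 : eta * elastic_energy lw mw (xi + F x) = eta * elastic_energy lw mw xi +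
     2 * eta * B + eta * elastic_energy lw mw (F x) by rewrite gE; ring.
have h7 : 0 <= eta * elastic_energy lw mw xi by rewrite mulr_ge0 // ltW.
have h8 : 0 <= 2 * eta * elastic_energy lw mw e0.
  by rewrite mulr_ge0 ?elastic_energy_ge0 // mulr_ge0 // ltW.
lra.
Qed.

End lower_bound.

(** * The yield function *)

Section spectral_bound.
Import complex.
Local Open Scope sesquilinear_scope.
Context {R : realType}.
Local Notation C := R[i].

Definition colsq m (w : 'cV[C]_m) : C := \sum_i `|w i 0| ^+ 2.

Lemma colsqE m (w : 'cV[C]_m) : colsq w = (w ^t* *m w) 0 0.
Proof. by rewrite mxE; apply: eq_bigr => i _; rewrite !mxE normCK mulrC. Qed.

Lemma colsq_unitary m (Q : 'M[C]_m) (w : 'cV[C]_m) : Q \is unitarymx ->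
  colsq (Q *m w) = colsq w.
Proof.
move=> uQ; rewrite !colsqE trmx_mul map_mxM /= -!mulmxA (mulmxA _ Q).
have uQ' : Q ^t* \is unitarymx by rewrite trmxC_unitary.
by move/unitarymxP: uQ'; rewrite trmxCK => ->; rewrite mul1mx.
Qed.

Lemma colsq_real m (v : 'cV[R]_m) :
  colsq (map_mx (real_complex R) v) = real_complex R (\sum_i v i 0 ^+ 2).
Proof.
rewrite rmorph_sum; apply: eq_bigr => i _; rewrite mxE rmorphXn /=.
by rewrite real_normK // complex_real.
Qed.

(** The matrix is diagonalised as a Hermitian matrix over [R[i]]. Its diagonal part is real, and the
    rows of the unitary factor are left eigenvectors, so each [rho i] is a root of the real
    characteristic polynomial. *)
Lemma symm_spectral m (tau : 'M[R]_m.+1) : symmx tau ->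
  exists P : 'M[C]_m.+1, exists rho : 'I_m.+1 -> R,
  [/\ P \is unitarymx, forall i, root (char_poly tau) (rho i) &
      map_mx (real_complex R) tau =
      P ^t* *m diag_mx (\row_i real_complex R (rho i)) *m P].
Proof.
move=> st; set A := map_mx _ tau.
have hA : A \is hermsymmx.
  apply/is_hermitianmxP; rewrite expr0 scale1r; apply/matrixP => i j.
  by rewrite !mxE -[in LHS]st mxE /Num.conj /= oppr0.
have /orthomx_spectralP AE : A \is normalmx by exact: hermitian_normalmx.
have /mxOverP dr := hermitian_spectral_diag_real hA.
have uP := spectral_unitarymx A.
pose rho i := complex.Re (spectral_diag A 0 i).
have dE : spectral_diag A = \row_i real_complex R (rho i).
  by apply/rowP => i; rewrite mxE /rho; exact/esym/RRe_real/dr.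
rewrite invmx_unitary // dE in AE.
exists (spectralmx A), rho; split => // i.
have : eigenvalue A (real_complex R (rho i)).
  apply/eigenvalueP; exists (row i (spectralmx A)).
    rewrite {2}AE -!mulmxA -row_mul (mulmxA (spectralmx A)).
    move/unitarymxP: (uP) => ->; rewrite mul1mx.
    by apply/rowP => j; rewrite mul_diag_mx !mxE.
  apply: contraTneq (spectral_unit A) => r0; rewrite unitmxE.
  have -> : \det (spectralmx A) = 0.
    rewrite (expand_det_row _ i) big1 // => j _.
    by have /rowP/(_ j) := r0; rewrite !mxE => ->; rewrite mul0r.
  by rewrite unitr0.
by rewrite eigenvalue_root_char -map_char_poly fmorph_root.
Qed.

(** In the unitary frame of [symm_spectral], [tau - r Id] multiplies the coordinates by [rho i - r],
    and unitary maps preserve [colsq]. *)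
Lemma opnorm_le_spectrum n (tau : 'M[R]_n) (r s : R) : symmx tau -> 0 <= s ->
  (forall a, root (char_poly tau) a -> `|a - r| <= s) -> opnorm_le s (tau - r%:M).
Proof.
case: n tau => [|m] tau st s0 hs v; first by rewrite !big_ord0 mulr0.
have [P [rho [uP rhoE AE]]] := symm_spectral st.
have uP' : P ^t* \is unitarymx by rewrite trmxC_unitary.
have E : map_mx (real_complex R) ((tau - r%:M) *m v) =
    P ^t* *m (diag_mx (\row_i real_complex R (rho i - r)) *m (P *m map_mx (real_complex R) v)).
  rewrite map_mxM map_mxB AE map_scalar_mx /= !mulmxA; congr (_ *m _).
  have -> : diag_mx (\row_i real_complex R (rho i - r)) =
      diag_mx (\row_i real_complex R (rho i)) - (real_complex R r)%:M.
    apply/matrixP => i j; rewrite !mxE rmorphB.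
    by case: eqP => _ /=; rewrite ?mulr1n // !mulr0n subr0.
  rewrite mulmxBr mulmxBl; congr (_ - _).
  rewrite scalar_mxC -mulmxA.
  move/unitarymxP: uP'; rewrite trmxCK => ->.
  by rewrite mulmx1.
rewrite -lecR -colsq_real E colsq_unitary // rmorphM /= -colsq_real.
rewrite -[X in _ <= _ * X](colsq_unitary _ uP) /colsq mulr_sumr.
apply: ler_sum => i _; rewrite mul_diag_mx mxE normrM exprMn mxE ler_wpM2r ?exprn_ge0 //.
rewrite rmorphXn /= lerXn2r ?nnegrE ?normr_ge0 //; first by rewrite lecR.
by rewrite normc_def /= expr0n addr0 sqrtr_sqr lecR hs.
Qed.

End spectral_bound.

(** * Symmetrised dyads and their energy *)

Section dyads.
Context {R : realType} {n : nat}.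
Implicit Types (a b k : 'rV[R]_n) (tau : 'M[R]_n).

Definition dot a b : R := (a *m b^T) 0 0.

Lemma dotE a b : dot a b = \sum_i a 0 i * b 0 i.
Proof. by rewrite /dot mxE; apply: eq_bigr => i _; rewrite mxE. Qed.

Lemma dotC a b : dot a b = dot b a.
Proof. by rewrite !dotE; apply: eq_bigr => i _; rewrite mulrC. Qed.

Lemma dotDl a b k : dot (a + b) k = dot a k + dot b k.
Proof. by rewrite /dot mulmxDl mxE. Qed.

Lemma dotZl c a b : dot (c *: a) b = c * dot a b.
Proof. by rewrite /dot -scalemxAl mxE. Qed.

Lemma dotDr a b k : dot k (a + b) = dot k a + dot k b.
Proof. by rewrite dotC dotDl !(dotC k). Qed.

Lemma dotZr c a b : dot a (c *: b) = c * dot a b.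
Proof. by rewrite dotC dotZl dotC. Qed.

Lemma dot_gt0 a : a != 0 -> 0 < dot a a.
Proof.
move=> a0; rewrite dotE lt_neqAle eq_sym psumr_neq0 => [|i _]; last by rewrite -expr2 sqr_ge0.
apply/andP; split; last by apply: sumr_ge0 => i _; rewrite -expr2 sqr_ge0.
have [i ai] : exists i, a 0 i != 0.
  apply/existsP; apply: contra_neqT a0; rewrite negb_exists => /forallP h.
  by apply/rowP => i; rewrite mxE; apply/eqP; rewrite -[_ == _]negbK h.
by apply/hasP; exists i; rewrite ?mem_index_enum //= -expr2 lt_def sqr_ge0 sqrf_eq0 ai.
Qed.

Lemma dot_symm tau a b : symmx tau -> dot (a *m tau) b = dot a (b *m tau).
Proof. by move=> st; rewrite /dot trmx_mul st mulmxA. Qed.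

Definition symdyad a b : 'M[R]_n := 2^-1 *: (a^T *m b + b^T *m a).

Lemma symmx_symdyad a b : symmx (symdyad a b).
Proof.
by rewrite /symmx /symdyad /= linearZ linearD /= !trmx_mul !trmxK addrC.
Qed.

Lemma symdyadZl c a b : symdyad (c *: a) b = c *: symdyad a b.
Proof.
by rewrite /symdyad linearZ /= -scalemxAl -scalemxAr -scalerDr scalerA mulrC -scalerA.
Qed.

Lemma frobenius_dyad tau a b : frobenius tau (a^T *m b) = dot (b *m tau) a.
Proof. by rewrite /frobenius mulmxA mxtrace_mulC mulmxA /mxtrace big_ord1. Qed.

Lemma frobenius_symdyad tau a b : symmx tau -> frobenius tau (symdyad a b) = dot (b *m tau) a.
Proof.
move=> st; rewrite /symdyad frobeniusZr frobeniusDr !frobenius_dyad.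
by rewrite (dot_symm a b st) (dotC a); field.
Qed.

Lemma tr_dyad a b : \tr (a^T *m b) = dot b a.
Proof. by rewrite mxtrace_mulC /mxtrace big_ord1. Qed.

(** From [|a (.) b|^2 = (|a|^2 |b|^2 + (a . b)^2) / 2]. The weights [mu] and [lam + mu] are those of
    the translation bound, which lets the two bounds meet. *)
Lemma elastic_energy_symdyad lam mu a b : elastic_energy lam mu (symdyad a b) =
  2^-1 * (mu * (dot a a * dot b b) + (lam + mu) * dot a b ^+ 2).
Proof.
have tE : \tr (symdyad a b) = dot a b.
  by rewrite mxtraceZ mxtraceD !tr_dyad (dotC b a); field.
have cE x y z : (x *m (y^T *m z)) = dot x y *: z.
  by rewrite mulmxA {1}[x *m y^T]mx11_scalar mul_scalar_mx.
rewrite elastic_energyE tE frobenius_symdyad; last exact: symmx_symdyad.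
rewrite [in X in dot X a]/symdyad -scalemxAr mulmxDr !cE dotZl dotDl !dotZl (dotC b a).
by field.
Qed.

End dyads.

Section yield_function.
Context {R : realType} {n : nat}.
Variables lam mu : R.
Hypotheses (lam0 : 0 < lam) (mu0 : 0 < mu) (n0 : (0 < n)%N).
Implicit Types (tau : 'M[R]_n) (k : 'rV[R]_n).
Local Notation t1 tau := (ordered_eigenvalues tau)`_0.
Local Notation tn tau := (ordered_eigenvalues tau)`_n.-1.

Lemma ordered_eigenvalues_bounds tau : symmx tau ->
  [/\ root (char_poly tau) (t1 tau), root (char_poly tau) (tn tau) &
      forall a, root (char_poly tau) a -> t1 tau <= a <= tn tau].
Proof.
move=> /ordered_eigenvaluesP[]; set s := ordered_eigenvalues tau => ss sE.
have sz : size s = n.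
  by have := size_char_poly tau; rewrite sE size_prod_XsubC => -[].
have rE a : root (char_poly tau) a = (a \in s) by rewrite sE root_prod_XsubC.
split=> [||a]; rewrite ?rE ?mem_nth ?sz ?prednK //.
move=> /(nthP 0)[i]; rewrite sz => i_n <-.
have le := @sorted_leq_nth _ _ le_trans (@le_refl _ R) 0 s ss.
apply/andP; split; apply: le; rewrite ?inE ?sz ?prednK //.
by rewrite -ltnS prednK.
Qed.

Let L := lam + 2 * mu.
Let M := lam + mu.
Let L0 : 0 < L. Proof. by rewrite addr_gt0 // mulr_gt0. Qed.
Let M0 : 0 < M. Proof. by rewrite addr_gt0. Qed.
Let LM : L = M + mu. Proof. by rewrite /L /M; ring. Qed.

(** It suffices that [[r - s, r + s]] contain the spectrum; the witnesses minimise
    [r^2 / M + s^2 / mu] under this constraint. *)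
Lemma G_opnorm tau : symmx tau -> exists r s,
  [/\ 0 <= s, opnorm_le s (tau - r%:M) & r ^+ 2 / (lam + mu) + s ^+ 2 / mu = G lam mu tau].
Proof.
move=> st; have [r1 rn bnd] := ordered_eigenvalues_bounds st.
suff [r [s [s0 h1 hn E]]] : exists r s, [/\ 0 <= s, r - s <= t1 tau, tn tau <= r + s &
    r ^+ 2 / (lam + mu) + s ^+ 2 / mu = G lam mu tau].
  exists r, s; split => //; apply: opnorm_le_spectrum => // a /bnd/andP[h1a hna].
  by rewrite ler_norml; lra.
have /andP[t1n _] := bnd _ rn.
rewrite /G -/L -/M; set a := t1 tau in t1n *; set b := tn tau in t1n *.
have cE : 2 * M * (L / (2 * M) * (a + b)) = L * (a + b) by field; rewrite gt_eqF.
case: ifPn => [ca|].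
  have h : L * (a + b) < 2 * M * a by rewrite -cE ltr_pM2l // mulr_gt0.
  have hab : 0 <= L * (b - a) by rewrite mulr_ge0 ?subr_ge0 // ltW.
  have a0 : mu * a < 0 by rewrite LM in h hab; lra.
  have aL : a <= 0 by rewrite -(pmulr_rle0 _ mu0) ltW.
  (* Only the lower end touches: the minimum of [r^2 / M + s^2 / mu] under [r - s = a] is [a^2 / L],
     at this pair, and the case condition says exactly that [r + s > b]. *)
  exists (M / L * a), (- (mu / L) * a); split.
  - by rewrite mulNr oppr_ge0 mulr_ge0_le0 // divr_ge0 // ltW.
  - have -> : M / L * a - - (mu / L) * a = a; last by [].
    by rewrite LM; field; rewrite -LM gt_eqF.
  - have -> : M / L * a + - (mu / L) * a = (2 * M * a - L * a) / L.
      by rewrite LM; field; rewrite -LM gt_eqF.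
    by rewrite ler_pdivlMr //; lra.
  - by rewrite LM; field; rewrite -LM !gt_eqF.
rewrite -leNgt => ac; case: ifPn => [cb|].
  by exists ((a + b) / 2), ((b - a) / 2); split; lra.
rewrite -ltNge => bc.
have h : 2 * M * b < L * (a + b) by rewrite -cE ltr_pM2l // mulr_gt0.
have hab : 0 <= L * (b - a) by rewrite mulr_ge0 ?subr_ge0 // ltW.
have b0 : 0 < mu * b by rewrite LM in h hab; lra.
have bL : 0 <= b by rewrite -(pmulr_rge0 _ mu0) ltW.
exists (M / L * b), (mu / L * b); split.
- by rewrite mulr_ge0 // divr_ge0 // ltW.
- have -> : M / L * b - mu / L * b = (2 * M * b - L * b) / L.
    by rewrite LM; field; rewrite -LM gt_eqF.
  by rewrite ler_pdivrMr //; lra.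
- have -> : M / L * b + mu / L * b = b; last by [].
  by rewrite LM; field; rewrite -LM gt_eqF.
- by rewrite LM; field; rewrite -LM !gt_eqF.
Qed.

Section rank_one_bound.
Variables (tau : 'M[R]_n) (gam : R).
Hypotheses (st : symmx tau)
  (tau_le : forall a b, frobenius tau (symdyad a b) <= elastic_energy lam mu (symdyad a b) + gam).

Let direction_bound k : dot k k = 1 ->
  (dot (k *m tau) (k *m tau) - dot (k *m tau) k ^+ 2) / mu + dot (k *m tau) k ^+ 2 / L <= 2 * gam.
Proof.
move=> k1; set h := k *m tau; set m := dot h k; set q := dot h h.
(* This vector [a] maximises [tau : (a (.) k) - E (a (.) k)]: the part of [k tau] orthogonal to [k]
   is divided by [mu], the part along [k] by [L]. At the maximum the linear term is [V] and the
   energy [V / 2]. *)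
have := tau_le (mu^-1 *: (h + (- m) *: k) + (m / L) *: k) k.
rewrite frobenius_symdyad // elastic_energy_symdyad -/h k1 mulr1.
rewrite !(dotDl, dotDr, dotZl, dotZr) -/q -/m (dotC k h) -/m k1 -/M => H.
set V := (q - m ^+ 2) / mu + m ^+ 2 / L.
suff : V <= 2^-1 * V + gam by lra.
apply: le_trans (le_trans H _).
  by rewrite le_eqVlt; apply/orP; left; apply/eqP; rewrite /V; field; rewrite !gt_eqF.
rewrite lerD2r le_eqVlt; apply/orP; left; apply/eqP.
by rewrite /V LM; field; rewrite -LM !gt_eqF.
Qed.

Let unit_eigenvector a : root (char_poly tau) a -> exists2 v : 'rV[R]_n, v *m tau = a *: v & dot v v = 1.
Proof.
rewrite -eigenvalue_root_char => /eigenvalueP[v vE v0].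
have vv := dot_gt0 v0.
exists ((Num.sqrt (dot v v))^-1 *: v).
  by rewrite -scalemxAl vE !scalerA mulrC.
rewrite dotZl dotZr mulrA -expr2 exprVn sqr_sqrtr ?(ltW vv) // mulVf // gt_eqF //.
Qed.

(** [G tau] is the maximum over unit [k] of the left side of [direction_bound]. In the plane of two
    extreme eigenvectors, with [m = k tau . k], that side is [(m - a) (b - m) / mu + m^2 / L],
    concave and stationary at [m = c]; the cases of [G] tell whether [c] lies left of, inside or
    right of [[a, b]]. *)
Lemma G_le_rank_one : G lam mu tau <= 2 * gam.
Proof.
have [r1 rn bnd] := ordered_eigenvalues_bounds st.
have /andP[t1n _] := bnd _ rn.
have gam0 : 0 <= gam.
  have := tau_le (0 *: 0) 0; rewrite symdyadZl frobeniusZr elastic_energyZ.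
  by rewrite expr2 !mul0r add0r.
have [v1 v1E v11] := unit_eigenvector r1.
have [vn vnE vn1] := unit_eigenvector rn.
rewrite /G -/L -/M; set a := t1 tau in t1n v1E *; set b := tn tau in t1n vnE *.
set c := L / (2 * M) * (a + b).
case: ifPn => [ca|].
  have := direction_bound v11; rewrite v1E !(dotZl, dotZr) v11 !mulr1.
  by rewrite -expr2 subrr mul0r add0r.
rewrite -leNgt => ac; case: ifPn => [cb|_]; last first.
  have := direction_bound vn1; rewrite vnE !(dotZl, dotZr) vn1 !mulr1.
  by rewrite -expr2 subrr mul0r add0r.
have cE : 2 * M * c = L * (a + b) by rewrite /c; field; rewrite gt_eqF.
(* If [a = b], the weight [th] below would divide by zero; but then [c = a] forces [a = 0], and [G]
   vanishes. *)
have [ab|ab] := eqVneq a b.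
  have ca : c = a by apply/eqP; rewrite eq_le ac [X in _ <= X]ab cb.
  have a0 : mu * a = 0 by rewrite ca -ab LM in cE; lra.
  have {}a0 : a = 0 by apply/eqP; move/eqP: a0; rewrite mulf_eq0 gt_eqF.
  by rewrite -ab a0 subrr addr0 expr2 !mul0r addr0 mulr_ge0.
have {}ab : a < b by rewrite lt_neqAle ab.
have orth : dot v1 vn = 0.
  have := dot_symm v1 vn st; rewrite v1E vnE dotZl dotZr => /eqP.
  by rewrite -subr_eq0 -mulrBl mulf_eq0 subr_eq0 lt_eqF //= => /eqP.
have ba : 0 < b - a by rewrite subr_gt0.
(* The weight for which [k tau . k = th a + (1 - th) b] equals [c]. *)
pose th := (b - c) / (b - a).
have th0 : 0 <= th by rewrite divr_ge0 ?subr_ge0 // ltW.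
have th1 : 0 <= 1 - th by rewrite subr_ge0 ler_pdivrMr // mul1r lerD2l lerN2.
pose k := Num.sqrt th *: v1 + Num.sqrt (1 - th) *: vn.
have x2 := sqr_sqrtr th0; have y2 := sqr_sqrtr th1.
set x := Num.sqrt th in x2 k *; set y := Num.sqrt (1 - th) in y2 k *.
have kE : k *m tau = (x * a) *: v1 + (y * b) *: vn.
  by rewrite mulmxDl -!scalemxAl v1E vnE !scalerA.
have dk p q p' q' : dot (p *: v1 + q *: vn) (p' *: v1 + q' *: vn) = p * p' + q * q'.
  by rewrite !(dotDl, dotDr, dotZl, dotZr) (dotC vn) orth v11 vn1; ring.
have kk : dot k k = 1 by rewrite dk -!expr2 x2 y2; ring.
have := direction_bound kk; rewrite kE !dk.
have -> : x * a * x + y * b * y = c.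
  rewrite (mulrAC x) (mulrAC y) -!expr2 x2 y2 /th; field.
  by rewrite gt_eqF.
have -> : x * a * (x * a) + y * b * (y * b) = th * a ^+ 2 + (1 - th) * b ^+ 2.
  by rewrite -y2 -x2; ring.
apply: le_trans; rewrite le_eqVlt; apply/orP; left; apply/eqP.
rewrite /th /c LM; field.
by rewrite -LM !gt_eqF.
Qed.

End rank_one_bound.
End yield_function.

(** * Smooth cutoffs and layered fields *)

Lemma is_derive1_compose (R : realType) (f g : R -> R) (x df dg : R) :
  is_derive (g x) 1 f df -> is_derive x 1 g dg ->
  is_derive x 1 (fun z => f (g z)) (df * dg).
Proof.
move=> hf hg.
have df' := @ex_derive _ _ _ _ _ _ _ hf; have dg' := @ex_derive _ _ _ _ _ _ _ hg.
move/derivable1_diffP : (df') => df2; move/derivable1_diffP : (dg') => dg2.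
split; first exact/derivable1_diffP/(differentiable_comp dg2 df2).
rewrite -derive1E; have -> := derive1_comp dg' df'; rewrite !derive1E.
by rewrite (@derive_val _ _ _ _ _ _ _ hf) (@derive_val _ _ _ _ _ _ _ hg).
Qed.

Lemma is_derive_inv (R : realType) (V : normedModType R) (f : V -> R) (x v : V) (df : R) :
  is_derive x v f df -> f x != 0 ->
  is_derive x v (fun z => (f z)^-1) (- (f x) ^- 2 * df).
Proof.
move=> hf f0; have df' := @ex_derive _ _ _ _ _ _ _ hf.
split; first exact: derivableV.
by rewrite deriveV // (@derive_val _ _ _ _ _ _ _ hf).
Qed.

Section flat_functions.
Context {R : realType}.
Implicit Types y v : R.

(* The family [y^-k exp(-1/y)] extended by 0 is closed under differentiation up to
   linear combinations, which makes every member smooth. *)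
Definition flat (k : nat) y : R := if 0 < y then y ^- k * expR (- y^-1) else 0.

Lemma flat_le0 k y : y <= 0 -> flat k y = 0.
Proof. by move=> y0; rewrite /flat ltNge y0. Qed.

Lemma flat_gt0 k y : 0 < y -> 0 < flat k y.
Proof. by move=> y0; rewrite /flat y0 mulr_gt0 ?expR_gt0 // invr_gt0 exprn_gt0. Qed.

Lemma flat_ge0 k y : 0 <= flat k y.
Proof. by have [/flat_le0->//|/(flat_gt0 k)/ltW] := leP y 0. Qed.

(** [exp (1 / y)] dominates the term of degree [k + 1] of its series. *)
Lemma flat_bounded k y : flat k.+1 y <= k.+1`!%:R.
Proof.
have [/flat_le0->//|y0] := leP y 0.
rewrite /flat y0 expRN ler_pdivrMr ?expR_gt0 // -exprVn.
have := expR_ge1Dxn k (ltW (_ : 0 < y^-1)); rewrite invr_gt0 => /(_ y0) h.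
have f0 : 0 < k.+1`!%:R :> R by rewrite ltr0n fact_gt0.
rewrite -ler_pdivrMl // mulrC; apply: le_trans h; lra.
Qed.

Lemma flat0_le1 y : flat 0 y <= 1.
Proof.
have [/flat_le0->//|y0] := leP y 0.
by rewrite /flat y0 expr0 invr1 mul1r -[leRHS]expR0 ler_expR oppr_le0 invr_ge0 ltW.
Qed.

Lemma flatS2 k y : flat k y = flat k.+2 y * y ^+ 2.
Proof.
rewrite /flat; case: ifPn => y0; last by rewrite mul0r.
by rewrite mulrAC -addn2 exprD invfM divfK // expf_eq0 /= gt_eqF.
Qed.

Lemma is_derive_flat k y :
  is_derive y 1 (flat k) (flat k.+2 y - k%:R * flat k.+1 y).
Proof.
have [y0|y0|->] := ltgtP y 0.
- rewrite !flat_le0 ?ltW // mulr0 subr0.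
  apply: (@near_eq_is_derive _ _ _ (cst (0 : R))).
  by near=> z; rewrite flat_le0 // ltW //; near: z; exact: lt_nbhsl.
- apply: (@near_eq_is_derive _ _ _ (fun z : R => (z^-1) ^+ k * expR (- z^-1))).
    near=> z; rewrite /flat exprVn ifT //; near: z; exact: lt_nbhsr.
  have yn : y != 0 by rewrite gt_eqF.
  have dV : is_derive y 1 (fun z : R => z^-1) (- y ^- 2).
    split; first exact: derivableV.
    by rewrite (@deriveV _ _ id) ?derive_id //; exact: mulr1.
  have dE : is_derive y 1 (fun z : R => expR (- z^-1)) (y ^- 2 * expR (- y^-1)).
    have dN : is_derive y 1 (fun z : R => - z^-1) (y ^- 2).
      by apply: (is_derive_eq (is_deriveN dV)); rewrite opprK.
    apply: (is_derive_eq (@is_derive1_compose R expR (fun z => - z^-1) y _ _ (is_derive_expR _) dN)).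
    exact: mulrC.
  have dX := is_deriveX k dV; rewrite exprfctE in dX.
  apply: (is_derive_eq (is_deriveM dX dE)).
  rewrite /flat y0 -!exprVn /GRing.scale /=.
  by case: k dX => [|k] _; rewrite ?expr0 ?mul0r ?mulr0 /= ?exprS; ring.
(* At 0 the difference quotient is [flat k.+2 h * h], which tends to 0 because [flat k.+2] is
   bounded. *)
- rewrite !flat_le0 // mulr0 subr0.
  have D : h^-1 *: (flat k (h *: 1 + 0) - flat k 0) @[h --> 0^'] --> (0 : R).
    have E : (fun h : R => h^-1 *: (flat k (h *: 1 + 0) - flat k 0)) =
        (fun h : R => flat k.+2 h * h).
      apply/funext => h; rewrite addr0 [h *: 1]mulr1 (flat_le0 _ (lexx 0)) subr0.
      have [->|h0] := eqVneq h 0; first by rewrite flat_le0 // scaler0 mulr0.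
      by rewrite flatS2 expr2 mulrA /GRing.scale /= mulrCA mulVf // mulr1.
    rewrite E; apply: norm_cvg0.
    have c0 : k.+2`!%:R * `|h| @[h --> (0 : R)^'] --> (0 : R).
      have h0 : `|h| @[h --> (0 : R)^'] --> `|0 : R|.
        by move/cvg_within_filter : (@norm_continuous R R (0 : R)) => h; exact: h.
      have := cvgM (cvg_cst (k.+2`!%:R : R)) h0.
      rewrite normr0 mulr0 => c1; exact: c1.
    apply: (squeeze_cvgr _ (cvg_cst 0) c0); near=> h.
    by rewrite normr_ge0 normrM ler_wpM2r // ger0_norm ?flat_ge0 // flat_bounded.
  split; first by apply/cvg_ex; exists 0.
  exact: cvg_lim.
Unshelve. all: by end_near. Qed.

Definition step v : R := flat 0 v / (flat 0 v + flat 0 (1 - v)).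

Definition step' v : R :=
  (flat 2 v * flat 0 (1 - v) + flat 0 v * flat 2 (1 - v)) /
  (flat 0 v + flat 0 (1 - v)) ^+ 2.

(** One of [v] and [1 - v] is at least [1 / 2], where [flat 0] is at least [exp (-2)]. A uniform
    lower bound, and not mere positivity, is what bounds [step']. *)
Lemma step_den_ge v : expR (- 2) <= flat 0 v + flat 0 (1 - v).
Proof.
have H y : 2^-1 <= y -> expR (- 2) <= flat 0 y.
  move=> y2; have y0 : 0 < y by apply: lt_le_trans y2.
  rewrite /flat y0 expr0 invr1 mul1r ler_expR lerN2 -[leRHS]invrK lef_pV2 //.
  by rewrite posrE.
have [/H h|/ltW v2] := leP 2^-1 v; first by rewrite (le_trans h) // lerDl flat_ge0.
have /H h : 2^-1 <= 1 - v by lra.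
by rewrite (le_trans h) // lerDr flat_ge0.
Qed.

Lemma step_den_gt0 v : 0 < flat 0 v + flat 0 (1 - v).
Proof. exact: lt_le_trans (expR_gt0 _) (step_den_ge v). Qed.

Lemma is_derive_step v : is_derive v 1 step (step' v).
Proof.
have d0 := is_derive_flat 0 v.
have d1 : is_derive v 1 (fun z : R => flat 0 (1 - z)) (- flat 2 (1 - v)).
  have dl : is_derive v 1 (fun z : R => 1 - z) (- 1).
    by apply: (is_derive_eq (is_deriveB (is_derive_cst (1 : R) v 1) (is_derive_id v (1 : R)))); rewrite sub0r.
  have := @is_derive1_compose _ (flat 0) (fun z : R => 1 - z) v _ _ (is_derive_flat 0 (1 - v)) dl.
  by rewrite mul0r subr0 mulrN1.
have dn0 : flat 0 v + flat 0 (1 - v) != 0 by rewrite gt_eqF // step_den_gt0.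
have ds : is_derive v 1 (fun z => flat 0 z + flat 0 (1 - z)) (flat 2 v - flat 2 (1 - v)).
  by apply: (is_derive_eq (is_deriveD d0 d1)); rewrite mul0r subr0.
have dd := is_derive_inv ds dn0.
apply: (is_derive_eq (is_deriveM d0 dd)).
by rewrite /step' mul0r subr0 /GRing.scale /=; field.
Qed.

Lemma step_le0 v : v <= 0 -> step v = 0.
Proof. by move=> v0; rewrite /step flat_le0 // mul0r. Qed.

Lemma step_ge1 v : 1 <= v -> step v = 1.
Proof.
move=> v1; have E : flat 0 (1 - v) = 0 by rewrite flat_le0 // subr_le0.
have := step_den_gt0 v; rewrite /step E addr0 => /gt_eqF h.
by rewrite divff // h.
Qed.

Lemma step_bounds v : 0 <= step v <= 1.
Proof.
rewrite /step divr_ge0 ?flat_ge0 ?addr_ge0 ?flat_ge0 //=.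
by rewrite ler_pdivrMr ?step_den_gt0 // mul1r lerDl flat_ge0.
Qed.

Lemma step'_out v : v <= 0 \/ 1 <= v -> step' v = 0.
Proof.
rewrite /step' => -[v0|v1].
  by rewrite !(flat_le0 _ v0) !mul0r addr0 mul0r.
by rewrite !(@flat_le0 _ (1 - v)) ?subr_le0 // !mulr0 addr0 mul0r.
Qed.

Lemma step'_bounded : exists C, forall v, 0 <= step' v <= C.
Proof.
exists (4 / expR (- 2) ^+ 2) => v.
have n0 : 0 <= flat 2 v * flat 0 (1 - v) + flat 0 v * flat 2 (1 - v).
  by rewrite addr_ge0 // mulr_ge0 // flat_ge0.
apply/andP; split; first by rewrite divr_ge0 // exprn_ge0 // ltW // step_den_gt0.
have h (a b : R) : flat 2 a * flat 0 b <= 2.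
  rewrite -[leRHS]mulr1 ler_pM ?flat_ge0 //; first exact: flat_bounded.
  exact: flat0_le1.
apply: ler_pM => //; first by rewrite invr_ge0 exprn_ge0 // ltW // step_den_gt0.
  by rewrite [X in _ + X]mulrC; have := h v (1 - v); have := h (1 - v) v; lra.
rewrite lef_pV2 ?posrE ?exprn_gt0 ?step_den_gt0 ?expR_gt0 //.
by rewrite lerXn2r ?nnegrE ?expR_ge0 ?(ltW (step_den_gt0 v)) // step_den_ge.
Qed.

Variable d : R.
Hypothesis d_bounds : 0 < d <= 2^-1.

(* A smoothed [min 1 (max 0 y)]: its slope is 1 on [[d, 1 - d]], and bounded by a constant
   independent of [d] on the two transition intervals. *)
Definition ramp y : R := y * step (y / d) * (1 - step ((y - 1) / d + 1)) + step ((y - 1) / d + 1).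

Definition ramp' y : R :=
  step (y / d) * (1 - step ((y - 1) / d + 1)) + y / d * step' (y / d) * (1 - step ((y - 1) / d + 1))
  + (1 - y * step (y / d)) / d * step' ((y - 1) / d + 1).

Let d0 : 0 < d. Proof. by case/andP: d_bounds. Qed.
Let d2 : d <= 2^-1. Proof. by case/andP: d_bounds. Qed.

Lemma is_derive_ramp y : is_derive y 1 ramp (ramp' y).
Proof.
have dA : is_derive y 1 (fun z : R => step (z / d)) (step' (y / d) / d).
  have dl : is_derive y 1 (fun z : R => z / d) d^-1.
    have -> : (fun z : R => z / d) = d^-1 \*: id by apply/funext => z; rewrite mulrC.
    by apply: is_derive_eq; rewrite [_ *: _]mulr1.
  exact: (@is_derive1_compose _ step (fun z : R => z / d) y _ _ (is_derive_step _) dl).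
have dB : is_derive y 1 (fun z : R => step ((z - 1) / d + 1)) (step' ((y - 1) / d + 1) / d).
  have dl : is_derive y 1 (fun z : R => (z - 1) / d + 1) d^-1.
    have -> : (fun z : R => (z - 1) / d + 1) = (d^-1 \*: id + cst (1 - d^-1)).
      by apply/funext => z; rewrite !fctE /= -[d^-1 *: z]/(d^-1 * z); ring.
    by apply: is_derive_eq; rewrite addr0 [_ *: _]mulr1.
  exact: (@is_derive1_compose _ step (fun z : R => (z - 1) / d + 1) y _ _ (is_derive_step _) dl).
have d1 := is_deriveB (is_derive_cst (1 : R) y 1) dB.
have dp := is_deriveM (is_deriveM (is_derive_id y (1 : R)) dA) d1.
apply: (is_derive_eq (is_deriveD dp dB)).
rewrite /ramp' !fctE /=.
have sE (p q : R) : p *: q = p * q by [].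
rewrite !sE.
by field; rewrite gt_eqF.
Qed.

Let B0 y : y <= 1 - d -> (y - 1) / d + 1 <= 0.
Proof. by move=> h; rewrite -lerBrDr sub0r ler_pdivrMr // mulN1r; have := d0; lra. Qed.

Let A1 y : d <= y -> 1 <= y / d.
Proof. by move=> h; rewrite ler_pdivlMr // mul1r. Qed.

Lemma ramp_le0 y : y <= 0 -> ramp y = 0 /\ ramp' y = 0.
Proof.
move=> y0; have A : y / d <= 0 by rewrite ler_pdivrMr // mul0r.
have B : (y - 1) / d + 1 <= 0 by apply: B0; have := d0; have := d2; lra.
rewrite /ramp /ramp' (step_le0 A) (step_le0 B) (step'_out (or_introl A)) (step'_out (or_introl B)).
by split; ring.
Qed.

Lemma ramp_ge1 y : 1 <= y -> ramp y = 1 /\ ramp' y = 0.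
Proof.
move=> y1; have A : 1 <= y / d by apply: A1; have := d0; have := d2; lra.
have B : 1 <= (y - 1) / d + 1 by rewrite lerDr divr_ge0 ?subr_ge0 // ltW.
rewrite /ramp /ramp' (step_ge1 A) (step_ge1 B) (step'_out (or_intror A)) (step'_out (or_intror B)).
by split; ring.
Qed.

Lemma ramp'_middle y : d <= y <= 1 - d -> ramp' y = 1.
Proof.
move=> /andP[/A1 A /B0 B].
by rewrite /ramp' (step_ge1 A) (step_le0 B) (step'_out (or_intror A)) (step'_out (or_introl B)); ring.
Qed.

Lemma ramp_bounds y : 0 <= ramp y <= 1.
Proof.
have [/ramp_le0[->]|y0] := leP y 0; first by rewrite lexx ler01.
have [/ramp_ge1[->]|y1] := leP 1 y; first by rewrite lexx ler01.
rewrite /ramp; have /andP[] := step_bounds (y / d); have /andP[] := step_bounds ((y - 1) / d + 1).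
set A := step (y / d); set B := step _ => b0 b1 a0 a1.
have yA : 0 <= y * A <= 1 by rewrite mulr_ge0 ?(ltW y0) //= mulr_ile1 // ltW.
have h1 : 0 <= y * A * (1 - B) by rewrite mulr_ge0 ?subr_ge0 //; case/andP: yA.
have h2 : y * A * (1 - B) <= 1 - B by rewrite ler_piMl ?subr_ge0 //; case/andP: yA.
by apply/andP; split; lra.
Qed.

Lemma ramp'_le C y : (forall v, 0 <= step' v <= C) -> 0 <= ramp' y <= 1 + C.
Proof.
move=> hC; have C0 : 0 <= C by have /andP[] := hC 0; apply: le_trans.
have [/ramp_le0[_ ->]|y0] := leP y 0; first by rewrite lexx addr_ge0 ?ler01.
have [/ramp_ge1[_ ->]|y1] := leP 1 y; first by rewrite lexx addr_ge0 ?ler01.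
(* The factor [1 / d] from the inner derivative always meets a factor that compensates it:
   [y / d <= 1] here, [(1 - y) / d <= 1] in the zone next to 1. Hence a bound free of [d]. *)
have [yd|yd] := leP y d.
  have B : (y - 1) / d + 1 <= 0 by apply: B0; have := d0; have := d2; lra.
  rewrite /ramp' (step_le0 B) (step'_out (or_introl B)) mulr0 addr0 subr0 !mulr1.
  have /andP[a0 a1] := step_bounds (y / d); have /andP[s0 s1] := hC (y / d).
  have q1 : y / d <= 1 by rewrite ler_pdivrMr // mul1r.
  have q0 : 0 <= y / d by rewrite divr_ge0 // ltW.
  apply/andP; split; first by rewrite addr_ge0 // mulr_ge0.
  by apply: lerD => //; apply: le_trans s1; rewrite ler_piMl.
have A := A1 (ltW yd).
rewrite /ramp' (step_ge1 A) (step'_out (or_intror A)) mulr0 mul0r addr0 mulr1 mul1r.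
have [yd1|yd1] := leP y (1 - d).
  have B := B0 yd1; rewrite (step_le0 B) (step'_out (or_introl B)) mulr0 addr0 subr0.
  by rewrite ler01 lerDl.
have /andP[b0 b1] := step_bounds ((y - 1) / d + 1); have /andP[s0 s1] := hC ((y - 1) / d + 1).
have q0 : 0 <= (1 - y) / d by rewrite divr_ge0 ?subr_ge0 // ltW.
have q1 : (1 - y) / d <= 1 by rewrite ler_pdivrMr // mul1r; have := d0; lra.
apply/andP; split; first by rewrite addr_ge0 ?subr_ge0 // mulr_ge0.
apply: lerD; first by rewrite gerDl oppr_le0.
by apply: le_trans s1; rewrite ler_piMl.
Qed.

End flat_functions.

(** * A class of smooth functions, and test fields built from it *)

Section smooth_functions.
Context {R : realType} {n : nat}.
Implicit Types (b x v : 'rV[R]_n) (f g u : 'rV[R]_n -> R).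

Lemma is_derive_of_line u x v d :
  is_derive (0 : R) 1 (fun r => u (x + r *: v)) d -> is_derive x v u d.
Proof.
have E : (fun h : R => h^-1 *: (u (x + (h *: 1 + 0) *: v) - u (x + 0 *: v))) =
         (fun h => h^-1 *: (u (h *: v + x) - u x)).
  apply/funext => h; congr (_ *: (u _ - u _)); last by rewrite scale0r addr0.
  by rewrite addr0 addrC [h *: 1]mulr1.
by case; rewrite /derivable /derive E => hd hv; split.
Qed.

Lemma is_derive_affine (h : R -> R) b c x v d :
  is_derive (dot b x + c) 1 h d -> is_derive x v (fun z => h (dot b z + c)) (dot b v * d).
Proof.
move=> hd; apply: is_derive_of_line.
have dl : is_derive (0 : R) 1 (fun r : R => dot b (x + r *: v) + c) (dot b v).
  have -> : (fun r : R => dot b (x + r *: v) + c) = (dot b v \*: id + cst (dot b x + c)).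
    apply/funext => r; rewrite !fctE /= dotDr dotZr -[dot b v *: r]/(dot b v * r); ring.
  apply: (is_derive_eq (is_deriveD (is_deriveZ _ (is_derive_id (0 : R) (1 : R))) (is_derive_cst _ _ _))).
  by rewrite addr0 [_ *: _]mulr1.
apply: (is_derive_eq (@is_derive1_compose R h (fun r => dot b (x + r *: v) + c) 0 d _ _ dl)).
  by rewrite scale0r addr0.
exact: mulrC.
Qed.

(** A syntactic class that is closed under directional derivatives and has continuous members only:
    derivatives of every order then come from one induction. It is just large enough for the cutoffs
    and layers used below. *)
Inductive smooth_fun : ('rV[R]_n -> R) -> Prop :=
| smooth_cst c : smooth_fun (fun=> c)
| smooth_affine b c : smooth_fun (fun x => dot b x + c)
| smooth_flat k b c : smooth_fun (fun x => flat k (dot b x + c))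
| smooth_add f g : smooth_fun f -> smooth_fun g -> smooth_fun (fun x => f x + g x)
| smooth_mul f g : smooth_fun f -> smooth_fun g -> smooth_fun (fun x => f x * g x)
| smooth_inv f : smooth_fun f -> (forall x, f x != 0) -> smooth_fun (fun x => (f x)^-1).

Lemma is_derive_cst_fun (c : R) x v : is_derive x v (fun _ : 'rV[R]_n => c) 0.
Proof. exact: is_derive_cst. Qed.

Lemma is_derive_add f g x v (df dg : R) : is_derive x v f df -> is_derive x v g dg ->
  is_derive x v (fun z => f z + g z) (df + dg).
Proof. by move=> hf hg; exact: is_deriveD hf hg. Qed.

Lemma is_derive_mul f g x v (df dg : R) : is_derive x v f df -> is_derive x v g dg ->
  is_derive x v (fun z => f z * g z) (df * g x + f x * dg).
Proof.
move=> hf hg; apply: (is_derive_eq (is_deriveM hf hg)).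
by rewrite addrC; congr (_ + _); exact: mulrC.
Qed.

Lemma smooth_fun_derive f v : smooth_fun f ->
  exists2 f', smooth_fun f' & forall x, is_derive x v f (f' x).
Proof.
elim=> {f}.
- move=> c; exists (fun=> 0); first exact: smooth_cst.
  by move=> x; exact: is_derive_cst_fun.
- move=> b c; exists (fun=> dot b v); first exact: smooth_cst.
  move=> x; apply: (is_derive_eq (is_derive_affine v (is_derive_id (dot b x + c) (1 : R)))).
  exact: mulr1.
- move=> k b c; exists (fun x => dot b v * (flat k.+2 (dot b x + c) + (- k%:R) * flat k.+1 (dot b x + c))).
    apply: smooth_mul; first exact: smooth_cst.
    apply: smooth_add; first exact: smooth_flat.
    by apply: smooth_mul; [exact: smooth_cst|exact: smooth_flat].
  by move=> x; rewrite mulNr; apply: is_derive_affine; exact: is_derive_flat.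
- move=> f g sf [f' sf' df] sg [g' sg' dg]; exists (fun x => f' x + g' x).
    exact: smooth_add.
  by move=> x; exact: is_derive_add.
- move=> f g sf [f' sf' df] sg [g' sg' dg]; exists (fun x => f' x * g x + f x * g' x).
    by apply: smooth_add; exact: smooth_mul.
  by move=> x; exact: is_derive_mul.
- move=> f sf [f' sf' df] f0; exists (fun x => (- 1 * ((f x)^-1 * (f x)^-1)) * f' x).
    apply: smooth_mul => //; apply: smooth_mul; first exact: smooth_cst.
    by apply: smooth_mul; exact: smooth_inv.
  move=> x; apply: (is_derive_eq (is_derive_inv (df x) (f0 x))).
  by rewrite mulN1r -invfM expr2.
Qed.

Lemma continuous_affine b c : continuous (fun x => dot b x + c).
Proof.
apply: continuous_funD; last exact: continuous_fun_cst.
rewrite (funext (fun x => dotE b x)); apply: continuous_fun_sum => i _.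
by apply: continuous_funM; [exact: continuous_fun_cst|exact: coord_continuous].
Qed.

Lemma smooth_fun_continuous f : smooth_fun f -> continuous f.
Proof.
elim=> {f}.
- by move=> c; exact: continuous_fun_cst.
- by move=> b c; exact: continuous_affine.
- move=> k b c x.
  have := @ex_derive _ _ _ _ _ _ _ (is_derive_flat k (dot b x + c)).
  move=> /derivable1_diffP/differentiable_continuous cf.
  exact: (cvg_comp _ _ (@continuous_affine b c x) cf).
- by move=> f g _ cf _ cg; exact: continuous_funD.
- by move=> f g _ cf _ cg; exact: continuous_funM.
- by move=> f _ cf f0 x; exact: (cvgV (f0 x) (cf x)).
Qed.

Lemma smooth_eq f g : smooth_fun f -> f =1 g -> smooth_fun g.
Proof. by move=> sf /funext <-. Qed.

Lemma smooth_scale c f : smooth_fun f -> smooth_fun (fun x => c * f x).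
Proof. by move=> sf; apply: smooth_mul => //; exact: smooth_cst. Qed.

Lemma smooth_sum I (r : seq I) (F : I -> 'rV[R]_n -> R) :
  (forall i, smooth_fun (F i)) -> smooth_fun (fun x => \sum_(i <- r) F i x).
Proof.
move=> sF; elim: r => [|i r IH].
  by apply: (smooth_eq (smooth_cst 0)) => x; rewrite big_nil.
by apply: (smooth_eq (smooth_add (sF i) IH)) => x; rewrite big_cons.
Qed.

Lemma smooth_prod I (r : seq I) (F : I -> 'rV[R]_n -> R) :
  (forall i, smooth_fun (F i)) -> smooth_fun (fun x => \prod_(i <- r) F i x).
Proof.
move=> sF; elim: r => [|i r IH].
  by apply: (smooth_eq (smooth_cst 1)) => x; rewrite big_nil.
by apply: (smooth_eq (smooth_mul (sF i) IH)) => x; rewrite big_cons.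
Qed.

Lemma smooth_step b c : smooth_fun (fun x => step (dot b x + c)).
Proof.
have s1 : smooth_fun (fun x => flat 0 (1 - (dot b x + c))).
  apply: (smooth_eq (smooth_flat 0 (- b) (1 - c))) => x.
  by rewrite -scaleN1r dotZl; congr flat; ring.
apply: smooth_mul; first exact: smooth_flat.
apply: smooth_inv; first by apply: smooth_add => //; exact: smooth_flat.
by move=> x; rewrite gt_eqF // step_den_gt0.
Qed.

Lemma smooth_ramp d b c : smooth_fun (fun x => ramp d (dot b x + c)).
Proof.
have sA : smooth_fun (fun x => step ((dot b x + c) / d)).
  apply: (smooth_eq (smooth_step (d^-1 *: b) (c / d))) => x.
  by rewrite dotZl; congr step; ring.
have sB : smooth_fun (fun x => step ((dot b x + c - 1) / d + 1)).
  apply: (smooth_eq (smooth_step (d^-1 *: b) ((c - 1) / d + 1))) => x.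
  by rewrite dotZl; congr step; ring.
apply: smooth_add => //; apply: smooth_mul.
  by apply: smooth_mul => //; exact: smooth_affine.
by apply: (smooth_eq (smooth_add (smooth_cst 1) (smooth_scale (-1) sB))) => x; rewrite mulN1r.
Qed.

Lemma smooth_row (F : 'I_n -> 'rV[R]_n -> R) : (forall k, smooth_fun (F k)) ->
  smooth (fun x => \row_k F k x).
Proof.
move=> sF s.
(* Each iterated partial derivative is again a row of members of [smooth_fun]. *)
have [H sH ->] : exists2 H : 'I_n -> 'rV[R]_n -> R, forall k, smooth_fun (H k) &
    foldr partial (fun x => \row_k F k x) s = (fun x => \row_k H k x).
  elim: s => [|j s [H sH IH]]; first by exists F.
  have /choice[H' hH'] k : exists f, smooth_fun f /\ forall x, is_derive x (delta_mx 0 j) (H k) (f x).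
    by have [f' ? ?] := smooth_fun_derive (delta_mx 0 j) (sH k); exists f'.
  exists H' => [k|]; first by have [] := hH' k.
  apply/funext => x /=; rewrite IH /partial derive_mx.
    apply/matrixP => a k; rewrite !mxE.
    have [_ /(_ x) h] := hH' k; rewrite -(@derive_val _ _ _ _ _ _ _ h).
    by congr ('D__ _ _); apply/funext => z; rewrite mxE.
  apply/derivable_mxP => a k; rewrite (_ : (fun z => _) = H k); last first.
    by apply/funext => z; rewrite mxE.
  by have [_ /(_ x) h] := hH' k; exact: (@ex_derive _ _ _ _ _ _ _ h).
split.
  move=> x.
  have FF : Filter (nbhs x) by exact: nbhs_filter.
  apply/cvgrPdist_lt => e e0.
  have N : \forall z \near nbhs x, forall k, `|H k x - H k z| < e.
    apply: filter_forall => i.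
    by have /cvgrPdist_lt := @smooth_fun_continuous _ (sH i) x; apply.
  apply: filterS N => z hz.
  rewrite /Num.norm /= mx_normrE; apply: bigmax_lt => // -[a k] _ /=.
  by rewrite !mxE.
move=> j x; apply/derivable_mxP => a k.
rewrite (_ : (fun z => _) = H k); last by apply/funext => z; rewrite mxE.
by have [f' _ /(_ x) h] := smooth_fun_derive (delta_mx 0 j) (sH k); exact: (@ex_derive _ _ _ _ _ _ _ h).
Qed.

(** The margin [d] puts the closed support in the compact box [[d, 1 - d]^n]; vanishing outside the
    open cube alone would let the support reach the boundary. *)
Lemma test_field_row (F : 'I_n -> 'rV[R]_n -> R) (d : R) : 0 < d ->
  (forall k, smooth_fun (F k)) ->
  (forall k x i, x 0 i < d \/ 1 - d < x 0 i -> F k x = 0) ->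
  test_field (fun x => \row_k F k x).
Proof.
move=> d0 sF F0.
pose B : set 'rV[R]_n := [set x | forall i, `[d, 1 - d]%classic (x ord0 i)].
have cB : compact B by exact: compact_closed_box.
have sB : closed_support (fun x => \row_k F k x) `<=` B.
  have clB : closed B by apply: compact_closed => //; exact: norm_hausdorff.
  move/closure_id : clB => clB; rewrite /closed_support clB.
  apply: closureS => x /=; apply: contraNP => nB.
  apply/eqP/rowP => k; rewrite !mxE.
  move/existsNP : nB => [i /= /negP]; rewrite in_itv /= negb_and -!ltNge => /orP h.
  exact: (F0 k x i).
split; first exact: smooth_row.
- apply: (subclosed_compact _ cB sB); exact: closed_closure.
- move=> x /sB Bx i; have := Bx i; rewrite /= in_itv /= => /andP[h1 h2].
  by apply/andP; split; lra.
Qed.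

Lemma gradient_row (F : 'I_n -> 'rV[R]_n -> R) (F' : 'I_n -> 'I_n -> R) x :
  (forall k l, is_derive x (delta_mx 0 l) (F k) (F' k l)) ->
  gradient (fun z => \row_k F k z) x = \matrix_(k, l) F' k l.
Proof.
move=> dF.
have E k : (fun z => (\row_k F k z) 0 k) = F k by apply/funext => z; rewrite mxE.
apply/matrixP => k l; rewrite !mxE /partial derive_mx ?mxE ?E.
  exact: derive_val.
by apply/derivable_mxP => a i; rewrite ord1 E; exact: ex_derive.
Qed.

End smooth_functions.

Section cutoff.
Context {R : realType} {n : nat}.
Variable d : R.
Hypothesis d0 : 0 < d.
Implicit Types x : 'rV[R]_n.

Definition cutoff x : R := \prod_i (step ((x 0 i - d) / d) * step ((1 - d - x 0 i) / d)).

Lemma dot_delta x i : dot (delta_mx 0 i) x = x 0 i.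
Proof.
rewrite dotE (bigD1 i) //= mxE !eqxx mul1r big1 ?addr0 // => j ji.
by rewrite mxE eqxx (negbTE ji) mul0r.
Qed.

Lemma smooth_cutoff : smooth_fun cutoff.
Proof.
apply: smooth_prod => i; apply: smooth_mul.
  apply: (smooth_eq (smooth_step (d^-1 *: delta_mx 0 i) (- d / d))) => x.
  by rewrite dotZl dot_delta; congr step; ring.
apply: (smooth_eq (smooth_step (- d^-1 *: delta_mx 0 i) ((1 - d) / d))) => x.
by rewrite dotZl dot_delta; congr step; ring.
Qed.

Lemma cutoff_bounds x : 0 <= cutoff x <= 1.
Proof.
have h i : 0 <= step ((x 0 i - d) / d) * step ((1 - d - x 0 i) / d) <= 1.
  have /andP[a0 a1] := step_bounds ((x 0 i - d) / d).
  have /andP[b0 b1] := step_bounds ((1 - d - x 0 i) / d).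
  by rewrite mulr_ge0 //= mulr_ile1.
rewrite /cutoff; elim/big_ind : _ => [|u v /andP[u0 u1] /andP[v0 v1]|i _] //.
  by rewrite ler01 lexx.
by rewrite mulr_ge0 //= mulr_ile1.
Qed.

Lemma cutoff_out x i : x 0 i < d \/ 1 - d < x 0 i -> cutoff x = 0.
Proof.
move=> h; rewrite /cutoff (bigD1 i) //=.
case: h => h; last rewrite [X in X * _]mulrC.
  by rewrite step_le0 ?mul0r // ler_pdivrMr // mul0r subr_le0 ltW.
by rewrite step_le0 ?mul0r // ler_pdivrMr // mul0r subr_le0 ltW.
Qed.

Lemma cutoff_in x : (forall i, 2 * d <= x 0 i <= 1 - 2 * d) -> cutoff x = 1.
Proof.
move=> h; rewrite /cutoff big1 // => i _; have /andP[h1 h2] := h i.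
by rewrite !step_ge1 ?mulr1 // ler_pdivlMr // mul1r; lra.
Qed.

(** [M] may depend on [d] in any way: it is eventually divided by a frequency that is chosen after
    [d]. *)
Lemma cutoff_gradient : exists D : 'rV[R]_n -> 'rV[R]_n, exists M : R,
  (forall x l, is_derive x (delta_mx 0 l) cutoff (D x 0 l)) /\
  (forall x l, unit_cube x -> `|D x 0 l| <= M).
Proof.
have /choice[D hD] l : exists f, smooth_fun f /\ forall x, is_derive x (delta_mx 0 l) cutoff (f x).
  by have [f' ? ?] := smooth_fun_derive (delta_mx 0 l) smooth_cutoff; exists f'.
have /choice[M hM] l : exists M, forall x, unit_cube x -> `|D l x| <= M.
  by apply: continuous_bounded_cube => x; apply: smooth_fun_continuous; have [] := hD l.
exists (fun x => \row_l D l x), (\sum_l `|M l|); split=> [x l|x l Cx].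
  by rewrite mxE; have [] := hD l.
rewrite mxE (le_trans (hM l x Cx)) // (le_trans (ler_norm _)) //.
by rewrite (bigD1 l) //= lerDl sumr_ge0.
Qed.

(** The cutoff equals 1 on the concentric cube of side [1 - 4 d]. *)
Lemma cube_int_cutoff : d <= 4^-1 -> (1 - 4 * d) ^+ n <= cube_int cutoff.
Proof.
move=> d4; have cc : continuous cutoff by exact: (@smooth_fun_continuous _ _ _ smooth_cutoff).
rewrite -lee_fin -cube_intE //.
pose B : set (n.-tuple (measurableTypeR R)) :=
  [set t | forall i, `]2 * d, 1 - 2 * d[%classic (tnth t i)].
have mB : measurable B by apply: (@measurable_box _ _ (fun=> `]2 * d, 1 - 2 * d[%classic)) => i; exact: measurable_itv.
have BC : B `<=` @cube_tuple R n.
  move=> t Bt i; have := Bt i; rewrite /= in_itv /= mxE => /andP[h1 h2].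
  by apply/andP; split; have := d0; lra.
have <- : lebesgue_tuple n B = ((1 - 4 * d) ^+ n)%:E.
  by rewrite [LHS]lebesgue_box_oo; [congr (_ ^+ _)%:E; ring|lra].
have mC := @measurable_cube R n.
rewrite -[X in lebesgue_tuple n X](setIidl BC) -integral_indic //.
apply: ge0_le_integral => //.
- apply/measurable_EFinP; exact: measurable_funTS.
- apply/measurable_EFinP; apply: measurable_funTS; exact: (measurable_continuous_row cc).
move=> t _; rewrite lee_fin indicE.
case: (boolP (t \in B)) => [/set_mem Bt|_]; last by case/andP: (cutoff_bounds (tuple_row t)).
rewrite cutoff_in // => i; have := Bt i; rewrite /= in_itv /= mxE => /andP[h1 h2].
by rewrite !ltW.
Qed.

End cutoff.

(** * Periodic layers and the oscillating field *)

Section zigzag.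
Context {R : realType}.
Variables (d th : R) (m : nat).
Hypotheses (d_bounds : 0 < d <= 2^-1) (th_bounds : 0 < th <= 1).
Implicit Type z : R.

(* In every unit period of [[0, m]] the slope is positive on a fraction [th] only, where it
   is mostly [1 / th - 1], and it is -1 on the rest. *)
Definition zigzag z : R := \sum_(0 <= k < m) ramp d ((z - k%:R) / th) - z.
Definition zigzag' z : R := \sum_(0 <= k < m) ramp' d ((z - k%:R) / th) / th - 1.

Let th0 : 0 < th. Proof. by case/andP: th_bounds. Qed.
Let th1 : th <= 1. Proof. by case/andP: th_bounds. Qed.

Lemma is_derive_sum_fun (V : normedModType R) I (r : seq I) (F : I -> V -> R) (F' : I -> R) x v :
  (forall i, is_derive x v (F i) (F' i)) ->
  is_derive x v (fun y => \sum_(i <- r) F i y) (\sum_(i <- r) F' i).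
Proof.
move=> hF; elim: r => [|i r IH].
  rewrite big_nil (funext (fun x => big_nil _ _ _ _)); exact: is_derive_cst.
rewrite big_cons (funext (fun x => big_cons _ _ _ _ _ _)).
exact: (is_deriveD (hF i) IH).
Qed.

Lemma is_derive_zigzag z : is_derive z 1 zigzag (zigzag' z).
Proof.
apply: (is_deriveB _ (is_derive_id z (1 : R))).
apply: is_derive_sum_fun => k.
have dl : is_derive z 1 (fun y : R => (y - k%:R) / th) th^-1.
  have -> : (fun y : R => (y - k%:R) / th) = (th^-1 \*: id + cst (- k%:R / th)).
    by apply/funext => y; rewrite !fctE /= -[th^-1 *: y]/(th^-1 * y); ring.
  apply: (is_derive_eq (is_deriveD (is_deriveZ _ (is_derive_id z (1 : R))) (is_derive_cst _ _ _))).
  by rewrite addr0 [_ *: _]mulr1.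
exact: (@is_derive1_compose _ (ramp d) _ z _ _ (is_derive_ramp d_bounds _) dl).
Qed.

Lemma smooth_zigzag n (b : 'rV[R]_n) c : smooth_fun (fun x => zigzag (dot b x + c)).
Proof.
apply: smooth_add.
  apply: smooth_sum => k.
  apply: (smooth_eq (smooth_ramp d (th^-1 *: b) ((c - k%:R) / th))) => x.
  by rewrite dotZl; congr ramp; ring.
apply: (smooth_eq (smooth_affine (- b) (- c))) => x.
by rewrite -scaleN1r dotZl; ring.
Qed.

(** Periods before that of [z] are saturated at [v], later ones have not started, and only the
    current one contributes [F]. The saturation value is 1 for the ramp and 0 for its derivative. *)
Let sum_cells (F : R -> R) z v : 0 <= z < m%:R -> (forall y, y < 0 -> F y = 0) ->
  (forall y, 1 <= y -> F y = v) ->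
  \sum_(0 <= k < m) F (z - k%:R) = (Num.truncn z)%:R * v + F (z - (Num.truncn z)%:R).
Proof.
move=> /andP[z0 zm] F0 F1; set q := Num.truncn z.
have /andP[qz zq] : q%:R <= z < q.+1%:R by exact: truncn_itv.
have qm : (q < m)%N by rewrite -(ltr_nat R); exact: le_lt_trans zm.
rewrite (@big_cat_nat _ _ _ q.+1) //= [X in _ + X]big_nat_cond [X in _ + X]big1 => [|k]; last first.
  rewrite andbT => /andP[qk _]; apply: F0; rewrite subr_lt0.
  by apply: (lt_le_trans zq); rewrite ler_nat.
rewrite addr0 big_nat_recr //= big_nat_cond (eq_bigr (fun=> v)) => [|k]; last first.
  rewrite andbT => /= kq; apply: F1; rewrite lerBrDr.
  by apply: le_trans qz; rewrite addrC natr1 ler_nat.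
by rewrite -big_nat_cond big_const_nat subn0 iter_addr_0 -[v *+ q]mulr_natl.
Qed.

Lemma zigzag_le z : 0 <= z < m%:R -> `|zigzag z| <= 1.
Proof.
move=> hz; rewrite /zigzag (@sum_cells (fun y => ramp d (y / th)) z 1 hz).
- set q := Num.truncn z; have /andP[z0 zm] := hz.
  have /andP[qz] : q%:R <= z < q.+1%:R by exact: truncn_itv.
  rewrite -natr1 => zq.
  have /andP[h1 h2] := ramp_bounds d_bounds ((z - q%:R) / th).
  by rewrite ler_norml; apply/andP; split; lra.
- by move=> y y0; have [] := @ramp_le0 _ d d_bounds (y / th) _; rewrite // ler_pdivrMr // mul0r ltW.
- move=> y y1; have [] := @ramp_ge1 _ d d_bounds (y / th) _; rewrite // ler_pdivlMr // mul1r.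
  exact: le_trans y1.
Qed.

Lemma zigzag'E z : 0 <= z < m%:R ->
  zigzag' z = ramp' d ((z - (Num.truncn z)%:R) / th) / th - 1.
Proof.
move=> hz; rewrite /zigzag' (@sum_cells (fun y => ramp' d (y / th) / th) z 0 hz).
- by rewrite mulr0 add0r.
- move=> y y0; have yth : y / th <= 0 by rewrite ler_pdivrMr // mul0r ltW.
  by have [_ ->] := ramp_le0 d_bounds yth; rewrite mul0r.
- move=> y y1; have yth : 1 <= y / th by rewrite ler_pdivlMr // mul1r; exact: le_trans y1.
  by have [_ ->] := ramp_ge1 d_bounds yth; rewrite mul0r.
Qed.

End zigzag.

Section laminate.
Context {R : realType} {n p : nat}.
Variables (d M : R) (m : nat) (c th s : 'I_p -> R) (a b : 'I_p -> 'rV[R]_n).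
Hypotheses (d_bounds : 0 < d <= 2^-1) (th_bounds : forall i, 0 < th i <= 1) (M0 : 0 < M).
Implicit Type x : 'rV[R]_n.

Let z i x := dot (M *: b i) x + s i.

(** Amplitude [1 / M] against frequency [M]: differentiating [zigzag] gives strains whose size is
    independent of [M], differentiating the cutoff gives strains of order [1 / M]. *)
Definition laminate x : 'rV[R]_n :=
  \row_k (cutoff d x * \sum_i c i / M * a i 0 k * zigzag d (th i) m (z i x)).

Let d0 : 0 < d. Proof. by case/andP: d_bounds. Qed.

Lemma test_field_laminate : test_field laminate.
Proof.
apply: (@test_field_row _ _ _ d) => // [k|k x i h]; last by rewrite (cutoff_out d0 h) mul0r.
apply: smooth_mul; first exact: smooth_cutoff.
by apply: smooth_sum => i; apply: smooth_scale; exact: smooth_zigzag.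
Qed.

Lemma symgrad_laminate x (D : 'rV[R]_n) :
  (forall l, is_derive x (delta_mx 0 l) (cutoff d) (D 0 l)) ->
  symgrad laminate x =
  M^-1 *: \sum_i (c i * zigzag d (th i) m (z i x)) *: symdyad (a i) D +
  cutoff d x *: \sum_i (c i * zigzag' d (th i) m (z i x)) *: symdyad (a i) (b i).
Proof.
move=> hD.
pose F' k l := D 0 l * (\sum_i c i / M * a i 0 k * zigzag d (th i) m (z i x)) +
  cutoff d x * \sum_i c i / M * a i 0 k * (dot (M *: b i) (delta_mx 0 l) * zigzag' d (th i) m (z i x)).
have E : gradient laminate x = \matrix_(k, l) F' k l.
  apply: gradient_row => k l.
  apply: (is_derive_mul (hD l)).
  apply: is_derive_sum_fun => i.
  have dz := @is_derive_affine _ _ (zigzag d (th i) m) (M *: b i) (s i) x (delta_mx 0 l) _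
    (@is_derive_zigzag R d (th i) m d_bounds _).
  apply: (is_derive_eq (is_derive_mul (is_derive_cst_fun (c i / M * a i 0 k) x (delta_mx 0 l)) dz)).
  by rewrite mul0r add0r.
rewrite /symgrad E; apply/matrixP => k l; rewrite !mxE !summxE /F'.
have bE i j : dot (M *: b i) (delta_mx 0 j) = M * b i 0 j.
  by rewrite dotZl dotC dot_delta.
have -> : M^-1 * (\sum_i ((c i * zigzag d (th i) m (z i x)) *: symdyad (a i) D) k l) =
   \sum_i 2^-1 * (D 0 l * (c i / M * a i 0 k * zigzag d (th i) m (z i x)) +
                  D 0 k * (c i / M * a i 0 l * zigzag d (th i) m (z i x))).
  rewrite mulr_sumr; apply: eq_bigr => i _; rewrite !mxE !big_ord1 !mxE.
  by ring.
have -> : cutoff d x * (\sum_i ((c i * zigzag' d (th i) m (z i x)) *: symdyad (a i) (b i)) k l) =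
   \sum_i 2^-1 * (cutoff d x * (c i / M * a i 0 k * (dot (M *: b i) (delta_mx 0 l) * zigzag' d (th i) m (z i x))) +
                  cutoff d x * (c i / M * a i 0 l * (dot (M *: b i) (delta_mx 0 k) * zigzag' d (th i) m (z i x)))).
  rewrite mulr_sumr; apply: eq_bigr => i _; rewrite !mxE !big_ord1 !mxE !bE.
  by field; rewrite gt_eqF.
rewrite -!mulr_sumr !big_split /= -!mulr_sumr.
by ring.
Qed.

End laminate.

(** * Averages over independent shifts of the layers *)

Section averages.
Context {R : realType}.

Definition avg (T : finType) (F : T -> R) : R := #|T|%:R^-1 * \sum_t F t.

Lemma avgD (T : finType) (F G : T -> R) : avg (fun t => F t + G t) = avg F + avg G.
Proof. by rewrite /avg big_split mulrDr. Qed.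

Lemma avgZ (T : finType) c (F : T -> R) : avg (fun t => c * F t) = c * avg F.
Proof. by rewrite /avg -mulr_sumr mulrCA. Qed.

Lemma avg_sum (T I : finType) (P : pred I) (F : I -> T -> R) :
  avg (fun t => \sum_(i | P i) F i t) = \sum_(i | P i) avg (F i).
Proof. by rewrite /avg exchange_big mulr_sumr. Qed.

Lemma le_avg (T : finType) (F G : T -> R) : (forall t, F t <= G t) -> avg F <= avg G.
Proof. by move=> FG; rewrite ler_wpM2l ?invr_ge0 // ler_sum. Qed.

Lemma avg_cst (T : finType) (c : R) : (0 < #|T|)%N -> avg (fun _ : T => c) = c.
Proof.
move=> T0; rewrite /avg sumr_const -[c *+ _]mulr_natl mulKf //.
by rewrite pnatr_eq0 -lt0n.
Qed.

Lemma exists_le_avg (T : finType) (F : T -> R) : (0 < #|T|)%N -> exists t, F t <= avg F.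
Proof.
move=> T0; apply/not_existsP => h.
have lt t : avg F < F t by rewrite ltNge; apply/negP/h.
have /card_gt0P[t0 _] := T0.
suff : avg (fun _ : T => avg F) < avg F by rewrite avg_cst // ltxx.
rewrite ltr_pM2l ?invr_gt0 ?ltr0n //.
by apply: ltr_sum => //; apply/hasP; exists t0; rewrite ?mem_index_enum.
Qed.

Section independent_shifts.
Variables (p N : nat).
Hypothesis N0 : (0 < N)%N.
Local Notation shifts := {ffun 'I_p -> 'I_N}.

Lemma card_shifts_gt0 : (0 < #|{: shifts}|)%N.
Proof. by rewrite card_ffun !card_ord expn_gt0 N0. Qed.

(** Independence of the shifts: a sum over all families of shifts of a product of one-coordinate
    functions is a product of sums. *)
Let avg_prod (H : 'I_p -> 'I_N -> R) :
  avg (fun t : shifts => \prod_k H k (t k)) = \prod_k avg (H k).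
Proof.
rewrite /avg -(bigA_distr_bigA (fun k s => H k s)) card_ffun !card_ord.
by rewrite big_split /= prodr_const card_ord natrX exprVn.
Qed.

Lemma avg_coord i (F : 'I_N -> R) : avg (fun t : shifts => F (t i)) = avg F.
Proof.
transitivity (\prod_k avg (if k == i then F else fun=> 1)).
  rewrite -(avg_prod (fun k => if k == i then F else fun=> 1)).
  congr avg; apply/funext => t; rewrite (bigD1 i) //= eqxx big1 ?mulr1 // => k /negbTE -> //.
rewrite (bigD1 i) //= eqxx big1 ?mulr1 // => k /negbTE ->.
by rewrite avg_cst // card_ord.
Qed.

Lemma avg_coord2 i j (F G : 'I_N -> R) : i != j ->
  avg (fun t : shifts => F (t i) * G (t j)) = avg F * avg G.
Proof.
move=> ij; have ji : (j == i) = false by rewrite eq_sym (negbTE ij).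
transitivity (\prod_k avg (if k == i then F else if k == j then G else fun=> 1)).
  rewrite -(avg_prod (fun k => if k == i then F else if k == j then G else fun=> 1)).
  congr avg; apply/funext => t; rewrite (bigD1 i) //= eqxx (bigD1 j) ?ji //=.
  rewrite eqxx big1 ?mulr1 // => k /andP[/negbTE -> /negbTE -> //].
rewrite (bigD1 i) //= eqxx (bigD1 j) ?ji //= eqxx.
rewrite big1 ?mulr1 // => k /andP[/negbTE -> /negbTE ->].
by rewrite avg_cst // card_ord.
Qed.

End independent_shifts.

Section cells.
Variable N : nat.
Hypothesis N0 : (0 < N)%N.

(** Adding [q] modulo [N] permutes the cells, so averages over the shifts do not depend on the cell
    in which the point starts. *)
Lemma sum_rotate q (F : nat -> R) : \sum_(j < N) F ((q + j) %% N)%N = \sum_(j < N) F j.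
Proof.
pose h (j : 'I_N) : 'I_N := Ordinal (ltn_pmod (q + j) N0).
rewrite [RHS](reindex_inj (h := h)) //= => i j /(congr1 val) /= /eqP.
by rewrite eqn_modDl !modn_small // => /eqP /val_inj.
Qed.

Lemma sum_below v : (v <= N)%N -> \sum_(j < N) (j < v)%:R = v%:R :> R.
Proof.
move=> vN; rewrite -(big_mkord xpredT (fun j => (j < v)%:R)) (big_cat_nat (n := v)) //=.
rewrite big_nat_cond (eq_bigr (fun=> 1)) => [|j]; last by rewrite andbT => /andP[_ ->].
rewrite -big_nat_cond [X in _ + X]big_nat_cond [X in _ + X]big1 => [|j]; last first.
  by rewrite andbT => /andP[vj _]; rewrite ltnNge vj.
by rewrite addr0 big_const_nat subn0 iter_addr_0.
Qed.

(** Shifts are multiples of the cell width [1 / N]: a shift by [j] cells moves the point from cell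
    [q] to cell [q + j], modulo the period. *)
Lemma cell_bounds (w z : R) (j r : nat) : 0 <= w -> z = w + j%:R / N%:R ->
  r = ((Num.truncn (N%:R * w) + j) %% N)%N ->
  r%:R / N%:R <= z - (Num.truncn z)%:R < r.+1%:R / N%:R.
Proof.
set q := Num.truncn (N%:R * w) => w0 zE rE.
have N0' : 0 < N%:R :> R by rewrite ltr0n.
have /andP[qw wq] : q%:R <= N%:R * w < q.+1%:R by apply: truncn_itv; rewrite mulr_ge0.
pose u := ((q + j) %/ N)%N.
have qj : q%:R + j%:R = u%:R * N%:R + r%:R :> R by rewrite -natrM -!natrD /u rE -divn_eq.
have Nz : N%:R * z = N%:R * w + j%:R by rewrite zE; field; rewrite gt_eqF.
have rN : r.+1%:R <= N%:R :> R by rewrite rE ler_nat ltn_pmod.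
rewrite -natr1 in wq; rewrite -natr1 in rN.
have zu : Num.truncn z = u.
  apply: truncn_def; rewrite -(ler_pM2l N0') -(ltr_pM2l N0') Nz -natr1.
  by apply/andP; split; [have : 0 <= r%:R :> R by []; lra|lra].
rewrite zu ler_pdivrMr // ltr_pdivlMr // -natr1 mulrBl [z * _]mulrC Nz.
by apply/andP; split; lra.
Qed.

End cells.

Section layer.
Variables (J L k : nat) (C : R).
Hypotheses (J0 : (0 < J)%N) (L2 : (1 < L)%N) (k0 : (0 < k)%N) (kJ : (k <= J)%N).
Hypotheses (C1 : 1 <= C) (hC : forall y, 0 <= ramp' L%:R^-1 y <= C).
Local Notation N := (J * L)%N.
Local Notation th := (k%:R / J%:R : R).

(* A period is cut into [J * L] cells, of which the first [k * L] carry the layer; [C] accounts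
   for its two transition zones, of relative width [1 / L]. *)
Definition layer_weight (r : nat) : R :=
  (r < k * L)%:R * (if (k <= r < k * L.-1)%N then 1 else C).

Let L0 : (0 < L)%N. Proof. exact: ltnW L2. Qed.
Let N0 : (0 < N)%N. Proof. by rewrite muln_gt0 J0. Qed.
Let N0' : 0 < N%:R :> R. Proof. by rewrite ltr0n. Qed.
Let J0' : 0 < J%:R :> R. Proof. by rewrite ltr0n. Qed.
Let L0' : 0 < L%:R :> R. Proof. by rewrite ltr0n. Qed.
Let k0' : 0 < k%:R :> R. Proof. by rewrite ltr0n. Qed.
Let th0 : 0 < th. Proof. by rewrite divr_gt0. Qed.
Let d_bounds : 0 < (L%:R^-1 : R) <= 2^-1.
Proof. by rewrite invr_gt0 L0' lef_pV2 ?posrE // ler_nat. Qed.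

(** Since [th / L = k / N], each transition zone of the layer fills exactly [k] cells. The grid has
    [J * L] cells per period so that the ends of these zones fall on cell boundaries. *)
Lemma ramp'_cell (fr : R) r : r%:R / N%:R <= fr < r.+1%:R / N%:R ->
  0 <= ramp' L%:R^-1 (fr / th) / th <= layer_weight r / th.
Proof.
move=> /andP[f0 f1]; have /andP[h0 h1] := hC (fr / th).
rewrite divr_ge0 ?(ltW th0) //= ler_pM2r ?invr_gt0 // /layer_weight.
have NE : N%:R = J%:R * L%:R :> R by rewrite natrM.
have [rk|kr] := ltnP; last first.
  have fr1 : 1 <= fr / th.
    rewrite ler_pdivlMr // mul1r; apply: le_trans f0; rewrite ler_pdivlMr // NE.
    have -> : k%:R / J%:R * (J%:R * L%:R) = k%:R * L%:R :> R by field; rewrite gt_eqF.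
    by rewrite -natrM ler_nat.
  by have [_ ->] := ramp_ge1 d_bounds fr1; rewrite mul0r.
rewrite mul1r; case: ifPn => // /andP[kr rk1].
rewrite (ramp'_middle d_bounds) //; apply/andP; split.
  rewrite ler_pdivlMr //; apply: le_trans f0.
  rewrite NE ler_pdivlMr ?mulr_gt0 //.
  have -> : L%:R^-1 * (k%:R / J%:R) * (J%:R * L%:R) = k%:R :> R by field; rewrite !gt_eqF.
  by rewrite ler_nat.
rewrite ler_pdivrMr //; apply: le_trans (ltW f1) _.
rewrite NE ler_pdivrMr ?mulr_gt0 //.
have -> : (1 - L%:R^-1) * (k%:R / J%:R) * (J%:R * L%:R) = k%:R * (L%:R - 1) :> R.
  by field; rewrite !gt_eqF.
have -> : L%:R - 1 = L.-1%:R :> R by rewrite -[in LHS](prednK L0) -natr1 addrK.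
by rewrite -natrM ler_nat.
Qed.

Let avg_ord (F : 'I_N -> R) : avg F = N%:R^-1 * \sum_j F j.
Proof. by rewrite /avg card_ord. Qed.

Let kLN : (k * L <= N)%N. Proof. by rewrite leq_mul2r kJ orbT. Qed.

Lemma avg_layer q : avg (fun j : 'I_N => ((q + j) %% N < k * L)%:R) = th.
Proof.
rewrite avg_ord (sum_rotate N0 q (fun r => (r < k * L)%:R)) sum_below //.
by rewrite !natrM; field; rewrite !gt_eqF.
Qed.

Let C0 : 0 <= C. Proof. exact: le_trans ler01 C1. Qed.

Lemma layer_weight_ge0 r : 0 <= layer_weight r.
Proof. by rewrite mulr_ge0 //; case: ifP. Qed.

Lemma avg_layer_weight q : avg (fun j : 'I_N => layer_weight ((q + j) %% N)) <= C * th.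
Proof.
rewrite -(avg_layer q) -avgZ; apply: le_avg => j; rewrite /layer_weight mulrC.
by rewrite ler_wpM2r //; case: ifP.
Qed.

(** At most [2 k] of the [k L] cells of the layer carry the weight [C], whence the relative excess
    [2 C^2 / L]. *)
Lemma avg_layer_weight_sq q :
  avg (fun j : 'I_N => layer_weight ((q + j) %% N) ^+ 2) <= th * (1 + 2 * C ^+ 2 / L%:R).
Proof.
rewrite avg_ord (sum_rotate N0 q (fun r => layer_weight r ^+ 2)).
have kk : (k * L.-1 <= k * L)%N by rewrite leq_mul2l leq_pred orbT.
have kkL : (k <= k * L)%N by rewrite leq_pmulr.
have C2 : 0 <= C ^+ 2 by rewrite exprn_ge0.
have le_cells r : layer_weight r ^+ 2 <= (r < k * L)%:R +
    C ^+ 2 * ((r < k)%:R + (r < k * L)%:R + - 1 * (r < k * L.-1)%:R).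
  have : (r < k)%N -> (r < k * L)%N by move=> rk; exact: leq_trans rk kkL.
  have : (r < k * L.-1)%N -> (r < k * L)%N by move=> rk; exact: leq_trans rk kk.
  rewrite /layer_weight (leqNgt k r).
  case: (r < k)%N; case: (r < k * L)%N; case: (r < k * L.-1)%N => /= ga ba;
    first [by have := ga isT | by have := ba isT | lra].
apply: (@le_trans _ _ (N%:R^-1 * \sum_(r < N) ((r < k * L)%:R +
    C ^+ 2 * ((r < k)%:R + (r < k * L)%:R + - 1 * (r < k * L.-1)%:R)))).
  by rewrite ler_wpM2l ?invr_ge0 // ler_sum.
rewrite big_split /= -mulr_sumr !big_split /= -mulr_sumr !sum_below ?(leq_trans kk kLN) ?(leq_trans kkL kLN) //.
rewrite le_eqVlt; apply/orP; left; apply/eqP.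
rewrite !natrM.
have -> : L.-1%:R = L%:R - 1 :> R by rewrite -[in RHS](prednK L0) -natr1 addrK.
by field; rewrite !gt_eqF.
Qed.

End layer.
End averages.

Section energy_bounds.
Context {R : realType} {n : nat}.
Variables lam mu : R.
Hypotheses (lam0 : 0 < lam) (mu0 : 0 < mu).
Implicit Types x y : 'M[R]_n.
Local Notation E := (elastic_energy lam mu).
Local Notation B := (elastic_form lam mu).

Lemma elastic_form_le x y : symmx x -> symmx y -> B x y <= 2^-1 * (E x + E y).
Proof.
move=> sx sy; have := elastic_energy_ge0 lam0 mu0 (symmxD sx (symmxZ (-1) sy)).
by rewrite elastic_energyD elastic_formZr elastic_energyZ sqrrN expr1n; lra.
Qed.

Lemma elastic_energy_sum_le p (F : 'I_p -> 'M[R]_n) : (forall i, symmx (F i)) ->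
  E (\sum_i F i) <= p%:R * \sum_i E (F i).
Proof.
move=> sF; rewrite elastic_energyB elastic_form_suml.
apply: (@le_trans _ _ (\sum_i \sum_j 2^-1 * (E (F i) + E (F j)))).
  apply: ler_sum => i _; rewrite elastic_form_sumr; apply: ler_sum => j _.
  exact: elastic_form_le.
under eq_bigr do rewrite -mulr_sumr big_split /= sumr_const card_ord.
rewrite -mulr_sumr big_split /= sumr_const card_ord -sumrMnl -mulr_natl.
have -> : \sum_i E (F i) *+ p = p%:R * \sum_i E (F i).
  by rewrite mulr_sumr; apply: eq_bigr => i _; rewrite mulr_natl.
by rewrite le_eqVlt; apply/orP; left; apply/eqP; field.
Qed.

Lemma elastic_energy_segment (z : R) x y : symmx x -> symmx y -> 0 <= z <= 1 ->
  E (x - z *: y) <= z * E (x - y) + (1 - z) * E x.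
Proof.
move=> sx sy /andP[z0 z1].
have -> : x - z *: y = x + (- z) *: y by rewrite scaleNr.
have -> : x - y = x + (-1) *: y by rewrite scaleN1r.
rewrite !elastic_energyD !elastic_formZr !elastic_energyZ sqrrN sqrrN expr1n -subr_ge0.
have -> : z * (E x + 2 * (-1 * B x y) + 1 * E y) + (1 - z) * E x -
   (E x + 2 * (- z * B x y) + z ^+ 2 * E y) = z * (1 - z) * E y by ring.
by apply: mulr_ge0; [rewrite mulr_ge0 ?subr_ge0|exact: elastic_energy_ge0].
Qed.

Lemma dot_CauchySchwarz (a b : 'rV[R]_n) : dot a b ^+ 2 <= dot a a * dot b b.
Proof.
have [->|b0] := eqVneq b 0.
  have z u : dot u 0 = 0 by rewrite dotE big1 // => i _; rewrite mxE mulr0.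
  by rewrite !z expr0n mulr0.
have bb := dot_gt0 b0; rewrite -subr_ge0 -(pmulr_rge0 _ bb).
have -> : dot b b * (dot a a * dot b b - dot a b ^+ 2) =
  dot (dot b b *: a + (- dot a b) *: b) (dot b b *: a + (- dot a b) *: b).
  by rewrite !(dotDl, dotDr, dotZl, dotZr) (dotC b a); ring.
by rewrite dotE sumr_ge0 // => i _; rewrite -expr2 sqr_ge0.
Qed.

(** Meant for the strain produced by the gradient [D] of the cutoff; one [K] has to serve all points
    and all shifts. *)
Lemma elastic_energy_symdyads_bounded p (a : 'I_p -> 'rV[R]_n) (c : 'I_p -> R) (m : R) :
  exists K, forall (D : 'rV[R]_n) (al : 'I_p -> R), (forall l, `|D 0 l| <= m) ->
  (forall i, `|al i| <= `|c i|) -> E (\sum_i al i *: symdyad (a i) D) <= K.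
Proof.
exists (p%:R * \sum_i (c i ^+ 2 * (2^-1 * ((lam + 2 * mu) * (dot (a i) (a i) * (n%:R * m ^+ 2)))))).
move=> D al hD hal; apply: le_trans.
  by apply: elastic_energy_sum_le => i; apply: symmxZ; exact: symmx_symdyad.
rewrite ler_wpM2l // ler_sum // => i _; rewrite elastic_energyZ.
have aa : 0 <= dot (a i) (a i) by rewrite dotE sumr_ge0 // => j _; rewrite -expr2 sqr_ge0.
have DD : dot D D <= n%:R * m ^+ 2.
  rewrite dotE -[n in n%:R]card_ord mulr_natl -sumr_const; apply: ler_sum => l _.
  rewrite -expr2 -[leLHS]real_normK ?num_real // lerXn2r ?nnegrE //.
  exact: le_trans (hD l).
apply: ler_pM; rewrite ?sqr_ge0 ?elastic_energy_ge0 //.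
- exact: symmx_symdyad.
- rewrite -[leLHS]real_normK ?num_real // -[leRHS]real_normK ?num_real //.
  by rewrite lerXn2r ?nnegrE.
rewrite elastic_energy_symdyad ler_wpM2l ?invr_ge0 //.
have CS := dot_CauchySchwarz (a i) D.
have h : dot (a i) (a i) * dot D D <= dot (a i) (a i) * (n%:R * m ^+ 2) by rewrite ler_wpM2l.
have lm : 0 <= lam + mu by rewrite addr_ge0 // ltW.
have := ler_wpM2l lm CS; have l2 : 0 <= lam + 2 * mu by rewrite addr_ge0 ?mulr_ge0 // ltW.
by have := ler_wpM2l l2 h; lra.
Qed.

End energy_bounds.

(** * Upper bound *)

Section laminate_energy.
Context {R : realType} {n p : nat}.
Variables (lw mw ls ms kappa eta eps d : R).
Hypotheses (lw0 : 0 < lw) (mw0 : 0 < mw) (ls0 : 0 < ls) (ms0 : 0 < ms).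
Hypotheses (kappa0 : 0 < kappa) (eta0 : 0 < eta) (eps0 : 0 < eps) (d0 : 0 < d).
Variables (c th : 'I_p -> R) (S : 'I_p -> 'M[R]_n).
Hypotheses (th0 : forall i, 0 < th i) (sS : forall i, symmx (S i)).
Local Notation f := (elastic_energy ls ms).
Local Notation g := (elastic_energy lw mw).
Local Notation B := (elastic_form lw mw).

Definition self_coef i : R := (c i / th i) ^+ 2 * g (S i).
Definition cross_coef i j : R := `|c i * c j * B (S i) (S j)| / (th i * th j).

(* [act i] tells whether the point lies in a layer of the [i]-th family: the undamaged phase is
   kept where no family is active. *)
Lemma W_eps_layers_le (E0 : 'M[R]_n) (z : R) (rho h : 'I_p -> R) (act : 'I_p -> bool) :
  symmx E0 -> 0 <= z <= 1 -> (forall i, 0 <= rho i <= h i / th i) ->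
  (forall i, ~~ act i -> rho i = 0) ->
  W_eps lw mw ls ms kappa eta eps (E0 + z *: \sum_i (rho i * c i) *: S i) <=
  f E0 + eta * (1 + d^-1) * g E0 + kappa / eps * \sum_i (act i)%:R +
  eta * (1 + d) * (\sum_i self_coef i * h i ^+ 2 +
                   \sum_i \sum_(j | j != i) cross_coef i j * (h i * h j)).
Proof.
move=> sE0 /andP[z0 z1] rho_le rho0.
have h0 i : 0 <= h i.
  have /andP[r0 rh] := rho_le i; have := le_trans r0 rh.
  by rewrite pmulr_lge0 // invr_gt0.
have fE0 : 0 <= f E0 by exact: elastic_energy_ge0.
have gE0 : 0 <= g E0 by exact: elastic_energy_ge0.
have ke : 0 < kappa / eps by rewrite divr_gt0.
have g1 : 0 <= eta * (1 + d^-1) * g E0.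
  by apply: mulr_ge0 => //; rewrite mulr_ge0 ?addr_ge0 ?invr_ge0 ?(ltW eta0) ?(ltW d0) ?ler01.
have ed : 0 <= eta * (1 + d) by rewrite mulr_ge0 ?addr_ge0 ?(ltW eta0) ?(ltW d0) ?ler01.
have s0 i : 0 <= self_coef i by rewrite mulr_ge0 ?sqr_ge0 // elastic_energy_ge0.
have x0 i j : 0 <= cross_coef i j by rewrite mulr_ge0 // invr_ge0 mulr_ge0 // ltW.
set Q := \sum_i self_coef i * h i ^+ 2 + _.
have Q0 : 0 <= Q.
  rewrite addr_ge0 // sumr_ge0 // => i _; first by rewrite mulr_ge0 ?sqr_ge0.
  by rewrite sumr_ge0 // => j _; rewrite mulr_ge0 // mulr_ge0.
have a0 : 0 <= \sum_i (act i)%:R :> R by rewrite sumr_ge0.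
have [/forallP noact|] := boolP [forall i, ~~ act i].
  rewrite big1 => [|i _]; last by rewrite rho0 // mul0r scale0r.
  rewrite scaler0 addr0 W_epsE ge_min; apply/orP; left.
  have := mulr_ge0 (ltW ke) a0; have := mulr_ge0 ed Q0; lra.
rewrite negb_forall => /existsP[i0]; rewrite negbK => acti.
(* The damaged phase costs [kappa / eps] once, which the number of active families covers. *)
rewrite W_epsE ge_min; apply/orP; right.
have a1 : 1 <= \sum_i (act i)%:R :> R.
  by rewrite (bigD1 i0) //= acti lerDl sumr_ge0.
set X := \sum_i (rho i * c i) *: S i.
have sX : symmx X by apply: symmx_sum => i; exact: symmxZ.
have gX : g X <= Q.
  rewrite elastic_energyB elastic_form_suml /Q -big_split /=; apply: ler_sum => i _.
  have rle j : rho j <= h j / th j by case/andP: (rho_le j).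
  have r0 j : 0 <= rho j by case/andP: (rho_le j).
  rewrite elastic_form_sumr (bigD1 i) //=; apply: lerD.
    rewrite elastic_formZl elastic_formZr -elastic_energyB /self_coef.
    have -> : rho i * c i * (rho i * c i * g (S i)) = rho i ^+ 2 * (c i ^+ 2 * g (S i)) by ring.
    have -> : (c i / th i) ^+ 2 * g (S i) * h i ^+ 2 = (h i / th i) ^+ 2 * (c i ^+ 2 * g (S i)).
      by ring.
    apply: ler_wpM2r; first by apply: mulr_ge0; [exact: sqr_ge0|exact: elastic_energy_ge0].
    by rewrite lerXn2r ?nnegrE //; exact: le_trans (rle i).
  apply: ler_sum => j _; rewrite elastic_formZl elastic_formZr /cross_coef.
  have -> : rho i * c i * (rho j * c j * B (S i) (S j)) = rho i * rho j * (c i * c j * B (S i) (S j)) by ring.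
  have -> : `|c i * c j * B (S i) (S j)| / (th i * th j) * (h i * h j) =
     (h i / th i) * (h j / th j) * `|c i * c j * B (S i) (S j)| by rewrite invfM; ring.
  apply: (@le_trans _ _ (rho i * rho j * `|c i * c j * B (S i) (S j)|)).
    by rewrite ler_wpM2l ?mulr_ge0 // ler_norm.
  by rewrite ler_wpM2r // ler_pM.
(* Young's inequality with weight [d]: the concentrated strain keeps a factor close to 1, and the
   large factor [1 + 1 / d] falls on [g E0], which is only multiplied by [eta]. *)
have gE : g (E0 + z *: X) <= (1 + d^-1) * g E0 + (1 + d) * Q.
  rewrite addrC; apply: le_trans (elastic_energy_young lw0 mw0 d0 (symmxZ z sX) sE0) _.
  rewrite addrC lerD2l ler_wpM2l ?addr_ge0 ?ler01 ?(ltW d0) //.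
  rewrite elastic_energyZ; apply: le_trans gX.
  by rewrite ler_piMl ?elastic_energy_ge0 // exprn_ile1.
have := ler_wpM2l (ltW eta0) gE; have := ler_wpM2l (ltW ke) a1.
rewrite mulr1; lra.
Qed.

End laminate_energy.

(** * Energy of the laminate, averaged over the shifts *)

Section laminate_upper_bound.
Context {R : realType} {n p : nat}.
Variables (lw mw ls ms kappa eta eps C : R) (J L : nat) (k : 'I_p -> nat).
Variables (xi : 'M[R]_n) (c : 'I_p -> R) (a b : 'I_p -> 'rV[R]_n).
Hypotheses (lw0 : 0 < lw) (mw0 : 0 < mw) (ls0 : 0 < ls) (ms0 : 0 < ms).
Hypotheses (kappa0 : 0 < kappa) (eta0 : 0 < eta) (eps0 : 0 < eps) (sxi : symmx xi).
Hypotheses (J0 : (0 < J)%N) (L4 : (4 <= L)%N) (kJ : forall i, (0 < k i <= J)%N).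
Hypotheses (C1 : 1 <= C) (hC : forall y, 0 <= ramp' L%:R^-1 y <= C).
Local Notation f := (elastic_energy ls ms).
Local Notation g := (elastic_energy lw mw).
Local Notation d := (L%:R^-1 : R).
Local Notation N := (J * L)%N.
Local Notation S i := (symdyad (a i) (b i)).
Local Notation Z := (\sum_i c i *: S i).
Local Notation W := (W_eps lw mw ls ms kappa eta eps).

Let th i : R := (k i)%:R / J%:R.

Let J0' : 0 < J%:R :> R. Proof. by rewrite ltr0n. Qed.
Let L0 : (0 < L)%N. Proof. exact: leq_trans L4. Qed.
Let L0' : 0 < L%:R :> R. Proof. by rewrite ltr0n. Qed.
Let N0 : (0 < N)%N. Proof. by rewrite muln_gt0 J0. Qed.
Let N0' : 0 < N%:R :> R. Proof. by rewrite ltr0n. Qed.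
Let d0 : 0 < d. Proof. by rewrite invr_gt0. Qed.
Let d4 : d <= 4^-1. Proof. by rewrite lef_pV2 ?posrE // ler_nat. Qed.
Let d_bounds : 0 < d <= 2^-1.
Proof. by rewrite d0 /=; apply: le_trans d4 _; rewrite lef_pV2 ?posrE // ler_nat. Qed.
Let th_bounds i : 0 < th i <= 1.
Proof.
have /andP[k0 kj] := kJ i.
by rewrite divr_gt0 ?ltr0n //= ler_pdivrMr // mul1r ler_nat.
Qed.
Let th0 i : 0 < th i. Proof. by case/andP: (th_bounds i). Qed.
Let sS i : symmx (S i). Proof. exact: symmx_symdyad. Qed.
Let sZ : symmx Z. Proof. by apply: symmx_sum => i; apply: symmxZ. Qed.
Let fx0 : 0 <= f xi. Proof. exact: elastic_energy_ge0. Qed.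
Let fZ0 : 0 <= f (xi - Z). Proof. by apply: elastic_energy_ge0 => //; exact: symmxB. Qed.
Let gx0 : 0 <= g xi. Proof. exact: elastic_energy_ge0. Qed.
Let gZ0 : 0 <= g (xi - Z). Proof. by apply: elastic_energy_ge0 => //; exact: symmxB. Qed.

Let self i := self_coef lw mw c th (fun i => S i) i.
Let cross i j := cross_coef lw mw c th (fun i => S i) i j.

(** Bounds the averaged layer terms of [pointwise]: volume fractions for [kappa / eps], mean squares
    within a family, products of means for two distinct families. *)
Let oscillation : R := kappa / eps * \sum_i th i +
  eta * (1 + d) * (\sum_i self i * (th i * (1 + 2 * C ^+ 2 / L%:R)) +
                   \sum_i \sum_(j | j != i) cross i j * (C * th i * (C * th j))).

Section fixed_frequency.
Variables (M e : R) (D : 'rV[R]_n -> 'rV[R]_n) (Kf Kg mD : R).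
Hypotheses (M0 : 0 < M) (hD : forall x l, is_derive x (delta_mx 0 l) (cutoff d) (D x 0 l)).
Hypothesis hmD : forall x l, unit_cube x -> `|D x 0 l| <= mD.
Hypothesis hKf : forall (D : 'rV[R]_n) (al : 'I_p -> R), (forall l, `|D 0 l| <= mD) ->
  (forall i, `|al i| <= `|c i|) -> f (\sum_i al i *: symdyad (a i) D) <= Kf.
Hypothesis hKg : forall (D : 'rV[R]_n) (al : 'I_p -> R), (forall l, `|D 0 l| <= mD) ->
  (forall i, `|al i| <= `|c i|) -> g (\sum_i al i *: symdyad (a i) D) <= Kg.
Hypothesis he : (1 + d^-1) * (Kf + 2 * eta * Kg) / M ^+ 2 <= e.

(** [zigzag] is controlled only on [[0, m)]. Translating the phases by [K] makes them nonnegative on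
    the cube, and [2 K + 1] periods leave room for a further shift below 1. *)
Let K : nat := (Num.truncn (\sum_i \sum_l `|M * b i 0 l|)).+1.

Let w i (x : 'rV[R]_n) : R := dot (M *: b i) x + K%:R.

Let w_bounds i (x : 'rV[R]_n) : unit_cube x -> 0 <= w i x <= (K + K)%:R.
Proof.
move=> Cx; have : `|dot (M *: b i) x| <= K%:R.
  apply: (@le_trans _ _ (\sum_i \sum_l `|M * b i 0 l|)); last first.
    by rewrite ltW // truncnS_gt.
  rewrite (bigD1 i) //= ler_wpDr //; first by do 2 (apply: sumr_ge0 => ? _).
  rewrite dotE (le_trans (ler_norm_sum _ _ _)) // ler_sum // => l _.
  rewrite mxE normrM; have /andP[x0 x1] := Cx l.
  by rewrite ler_piMr // gtr0_norm // ltW.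
by rewrite ler_norml natrD /w => /andP[h1 h2]; apply/andP; split; lra.
Qed.

Let shifts := {ffun 'I_p -> 'I_N}.
Let phi (t : shifts) : 'rV[R]_n -> 'rV[R]_n :=
  laminate d M (K + K).+1 c th (fun i => K%:R + (t i)%:R / N%:R) a b.

Let test_phi t : test_field (phi t).
Proof. exact: test_field_laminate. Qed.

Let q i (x : 'rV[R]_n) : nat := Num.truncn (N%:R * w i x).
Let cell i (x : 'rV[R]_n) (j : 'I_N) : nat := ((q i x + j) %% N)%N.

Let upper (x : 'rV[R]_n) : R := (1 + d) * (f (xi - Z) + (1 - cutoff d x) * f xi) +
  eta * (1 + d^-1) * (2 * (g (xi - Z) + g xi)) + e.

Let pointwise (x : 'rV[R]_n) (t : shifts) : unit_cube x ->
  W (xi + symgrad (phi t) x) <= upper x +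
  kappa / eps * \sum_i (cell i x (t i) < k i * L)%:R +
  eta * (1 + d) * (\sum_i self i * layer_weight L (k i) C (cell i x (t i)) ^+ 2 +
     \sum_i \sum_(j | j != i) cross i j *
       (layer_weight L (k i) C (cell i x (t i)) * layer_weight L (k j) C (cell j x (t j)))).
Proof.
move=> Cx.
pose z i := dot (M *: b i) x + (K%:R + (t i)%:R / N%:R).
have zE i : z i = w i x + (t i)%:R / N%:R by rewrite /z /w addrA.
have tN i : 0 <= ((t i)%:R / N%:R : R) < 1.
  by rewrite divr_ge0 //= ltr_pdivrMr // mul1r ltr_nat.
have z_bounds i : 0 <= z i < (K + K).+1%:R.
  have /andP[w0 w1] := w_bounds i Cx; have /andP[t0 t1] := tN i.
  by rewrite zE -natr1; apply/andP; split; lra.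
pose rho i := ramp' d ((z i - (Num.truncn (z i))%:R) / th i) / th i.
have rho_le i : 0 <= rho i <= layer_weight L (k i) C (cell i x (t i)) / th i.
  have /andP[w0 _] := w_bounds i Cx; have /andP[k0 kj] := kJ i.
  apply: (@ramp'_cell _ J L (k i) C) => //; first exact: leq_trans L4.
  exact: (@cell_bounds _ _ N0 (w i x) (z i) (t i)).
pose Rm := \sum_i (c i * zigzag d (th i) (K + K).+1 (z i)) *: symdyad (a i) (D x).
have sRm : symmx Rm by apply: symmx_sum => i; apply: symmxZ; exact: symmx_symdyad.
have alc i : `|c i * zigzag d (th i) (K + K).+1 (z i)| <= `|c i|.
  by rewrite normrM ler_piMr // zigzag_le.
have /andP[z0 z1] := cutoff_bounds d x.
pose A := xi - cutoff d x *: Z.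
have sA : symmx A by apply: symmxB => //; exact: symmxZ.
(* The slope [-1] present everywhere in [zigzag] produces the relaxation [- Z] of the macroscopic
   strain; the compensating slope [rho] is supported in the layers. *)
have z'E : \sum_i (c i * zigzag' d (th i) (K + K).+1 (z i)) *: S i =
    \sum_i (rho i * c i) *: S i - Z.
  rewrite -sumrB; apply: eq_bigr => i _; rewrite zigzag'E // -scalerBl.
  by congr (_ *: _); rewrite /rho; ring.
have E : xi + symgrad (phi t) x =
    (A + M^-1 *: Rm) + cutoff d x *: \sum_i (rho i * c i) *: S i.
  rewrite (@symgrad_laminate _ _ _ d M _ c th _ a b d_bounds M0 x (D x)) //.
  rewrite -/Rm -/(z _) z'E /A scalerBr [_ *: _ - _]addrC [M^-1 *: _ + _]addrCA.
  by rewrite !addrA.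
have fA : f A <= f (xi - Z) + (1 - cutoff d x) * f xi.
  apply: le_trans (elastic_energy_segment ls0 ms0 sxi sZ (cutoff_bounds d x)) _.
  by rewrite lerD2r ler_piMl.
have gA : g A <= g (xi - Z) + g xi.
  apply: le_trans (elastic_energy_segment lw0 mw0 sxi sZ (cutoff_bounds d x)) _.
  by apply: lerD; rewrite ler_piMl // lerBlDr lerDl.
have M2 : 0 < (M ^+ 2)^-1 by rewrite invr_gt0 exprn_gt0.
have fR : f (M^-1 *: Rm) <= Kf / M ^+ 2.
  rewrite elastic_energyZ exprVn mulrC ler_pM2r //; apply: hKf => // l; exact: hmD.
have gR : g (M^-1 *: Rm) <= Kg / M ^+ 2.
  rewrite elastic_energyZ exprVn mulrC ler_pM2r //; apply: hKg => // l; exact: hmD.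
have sMR : symmx (M^-1 *: Rm) by exact: symmxZ.
have fE : f (A + M^-1 *: Rm) <= (1 + d) * (f (xi - Z) + (1 - cutoff d x) * f xi) +
    (1 + d^-1) * (Kf / M ^+ 2).
  apply: le_trans (elastic_energy_young ls0 ms0 d0 sA sMR) _.
  by apply: lerD; rewrite ler_wpM2l // addr_ge0 // ?invr_ge0 // ltW.
have gE : g (A + M^-1 *: Rm) <= 2 * (g (xi - Z) + g xi) + 2 * (Kg / M ^+ 2).
  apply: le_trans (elastic_energyD_le lw0 mw0 sA sMR) _.
  by apply: lerD; rewrite ler_wpM2l.
rewrite E.
have sE0 : symmx (A + M^-1 *: Rm) by exact: symmxD.
have rho0 i : ~~ (cell i x (t i) < k i * L)%N -> rho i = 0.
  move=> nact; have := rho_le i; rewrite /layer_weight (negbTE nact) mul0r mul0r.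
  by move=> /andP[? ?]; apply/eqP; rewrite eq_le; apply/andP; split.
have H := W_eps_layers_le lw0 mw0 ls0 ms0 kappa0 eta0 eps0 d0 c th0 sS sE0
  (cutoff_bounds d x) rho_le rho0.
apply: le_trans H _; rewrite lerD2r lerD2r /upper.
have ed : 0 <= eta * (1 + d^-1) by rewrite mulr_ge0 ?addr_ge0 ?invr_ge0 // ltW.
have := ler_wpM2l ed gE; have := he.
have -> : (1 + d^-1) * (Kf + 2 * eta * Kg) / M ^+ 2 =
  (1 + d^-1) * (Kf / M ^+ 2) + eta * (1 + d^-1) * (2 * (Kg / M ^+ 2)) by ring.
move: fE; lra.
Qed.

Let avg_pointwise (x : 'rV[R]_n) : unit_cube x ->
  avg (fun t : shifts => W (xi + symgrad (phi t) x)) <= upper x + oscillation.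
Proof.
move=> Cx; apply: (le_trans (@le_avg _ shifts _ _ (fun t => @pointwise x t Cx))).
have kJ' i : (k i <= J)%N by case/andP: (kJ i).
have k0 i : (0 < k i)%N by case/andP: (kJ i).
have L2 : (1 < L)%N by exact: leq_trans L4.
move: (upper x) => U; rewrite !avgD avg_cst ?card_shifts_gt0 // -addrA lerD2l !avgZ avgD !avg_sum.
apply: lerD.
  apply: ler_wpM2l; first by rewrite divr_ge0 // ltW.
  apply: ler_sum => i _.
  rewrite (@avg_coord _ _ _ N0 i (fun j => (cell i x j < k i * L)%:R)).
  by rewrite (@avg_layer _ J L (k i)) // /th.
have ed : 0 <= eta * (1 + d) by rewrite mulr_ge0 ?addr_ge0 // ltW.
have s0 i : 0 <= self i.
  by apply: mulr_ge0; [exact: sqr_ge0|exact: elastic_energy_ge0].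
have x0 i j : 0 <= cross i j.
  by apply: mulr_ge0 => //; rewrite invr_ge0 mulr_ge0 // ltW.
rewrite ler_wpM2l //; apply: lerD; apply: ler_sum => i _.
  rewrite avgZ ler_wpM2l // (@avg_coord _ _ _ N0 i (fun j => layer_weight L (k i) C (cell i x j) ^+ 2)).
  exact: (@avg_layer_weight_sq _ J L (k i) C).
rewrite avg_sum; apply: ler_sum => j ji; rewrite avgZ ler_wpM2l //.
rewrite (@avg_coord2 _ _ _ N0 i j (fun s => layer_weight L (k i) C (cell i x s))
  (fun s => layer_weight L (k j) C (cell j x s))) 1?eq_sym //.
have w0 l : 0 <= avg (fun s => layer_weight L (k l) C (cell l x s)).
  by rewrite mulr_ge0 ?invr_ge0 // sumr_ge0 // => s _; exact: layer_weight_ge0.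
by apply: ler_pM => //; exact: (@avg_layer_weight _ J L).
Qed.

(* Some choice of the shifts does no worse than the average over all of them, and in this average
   the crossings of two families have the product of their volume fractions as weight. *)
Lemma laminate_SQ_frequency :
  (SQ W xi <= ((1 + d) * (f (xi - Z) + 4 * n%:R * d * f xi) +
     eta * (1 + d^-1) * (2 * (g (xi - Z) + g xi)) + oscillation + e)%:E)%E.
Proof.
have cW t : continuous (fun x => W (xi + symgrad (phi t) x)).
  apply: continuous_W_eps => //; apply: continuous_translate => i j.
  by apply: continuous_symgrad; have [] := test_phi t.
have [t tle] := @exists_le_avg _ _ (fun t : shifts => cube_int (fun x => W (xi + symgrad (phi t) x)))
   (card_shifts_gt0 p N0).
apply: (@le_trans _ _ (cube_int (fun x => W (xi + symgrad (phi t) x)))%:E).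
  apply: ereal_inf_lbound; exists (phi t) => //.
  exact: SQ_integralE.
rewrite lee_fin; apply: (le_trans tle).
(* The average is a finite sum, so it passes under the integral by linearity. *)
have -> : avg (fun t : shifts => cube_int (fun x => W (xi + symgrad (phi t) x))) =
    cube_int (fun x => avg (fun t : shifts => W (xi + symgrad (phi t) x))).
  by rewrite /avg cube_intZ ?cube_int_sum //; apply: continuous_fun_sum.
have cz : continuous (cutoff d : 'rV[R]_n -> R) by exact: (@smooth_fun_continuous _ _ _ (smooth_cutoff d)).
have ccst (r : R) : continuous (fun _ : 'rV[R]_n => r) by exact: continuous_fun_cst.
pose cst0 : R := (1 + d) * (f (xi - Z) + f xi) + eta * (1 + d^-1) * (2 * (g (xi - Z) + g xi)) +
   e + oscillation.
have cz' : continuous (fun x : 'rV[R]_n => (- (1 + d) * f xi) * cutoff d x) by exact: continuous_funM.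
apply: (@le_trans _ _ (cube_int (fun x : 'rV[R]_n => cst0 + (- (1 + d) * f xi) * cutoff d x))).
  apply: le_cube_int => [| |x Cx].
  - by apply: continuous_funM => //; apply: continuous_fun_sum.
  - exact: continuous_funD.
  - by apply: le_trans (avg_pointwise Cx) _; rewrite /upper /cst0; lra.
rewrite cube_intD // cube_int_cst cube_intZ // /cst0.
have bern : 1 - 4 * n%:R * d <= cube_int (cutoff d : 'rV[R]_n -> R).
  apply: le_trans (cube_int_cutoff d0 d4).
  have d41 : 0 <= 4 * d <= 1 by apply/andP; split; [rewrite mulr_ge0 // ltW|have := d4; lra].
  elim: (n) => [|m IH]; first by rewrite expr0 mulr0 mul0r subr0.
  have /andP[h0 h1] := d41; rewrite exprS -[m.+1%:R]natr1.
  have h2 : 0 <= 1 - 4 * d by rewrite subr_ge0.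
  have m0 : 0 <= m%:R :> R by [].
  apply: (le_trans _ (ler_wpM2l h2 IH)); rewrite -subr_ge0.
  rewrite (_ : _ - _ = m%:R * (4 * d * (4 * d))); last by ring.
  by rewrite mulr_ge0 // mulr_ge0.
have h : 0 <= (1 + d) * f xi by rewrite mulr_ge0 ?addr_ge0 // ltW.
by have := ler_wpM2l h bern; lra.
Qed.

End fixed_frequency.

Lemma laminate_SQ (e : R) : 0 < e ->
  (SQ W xi <= ((1 + d) * (f (xi - Z) + 4 * n%:R * d * f xi) +
     eta * (1 + d^-1) * (2 * (g (xi - Z) + g xi)) +
     (kappa / eps * (\sum_i th i) +
      eta * (1 + d) * (\sum_i self i * (th i * (1 + 2 * C ^+ 2 / L%:R)) +
                   \sum_i \sum_(j | j != i) cross i j * (C * th i * (C * th j)))) + e)%:E)%E.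
Proof.
move=> e0.
have [D [mD [hD hmD]]] := @cutoff_gradient R n d.
have [Kf hKf] := elastic_energy_symdyads_bounded ls0 ms0 a c mD.
have [Kg hKg] := elastic_energy_symdyads_bounded lw0 mw0 a c mD.
pose A := `|(1 + d^-1) * (Kf + 2 * eta * Kg)|.
have A0 : 0 <= A by exact: normr_ge0.
(* With this frequency, [A <= e M <= e M^2]. *)
pose M := 1 + A / e.
have M1 : 1 <= M by rewrite lerDl divr_ge0 // ltW.
have M0 : 0 < M by exact: lt_le_trans M1.
apply: (@laminate_SQ_frequency M e D Kf Kg mD) => //.
rewrite ler_pdivrMr ?exprn_gt0 //; apply: le_trans (ler_norm _) _; rewrite -/A.
apply: (@le_trans _ _ (e * M)).
  by rewrite mulrDr mulr1 mulrCA divff ?gt_eqF // mulr1 lerDr ltW.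
by rewrite ler_pM2l // expr2 ler_peMr // ltW.
Qed.

End laminate_upper_bound.

(** * Passage to the limit in the upper bound *)

Section limits.
Context {R : realType} {n : nat}.
Variables (lw mw ls ms kappa alpha : R) (eta : R -> R).
Hypotheses (lw0 : 0 < lw) (mw0 : 0 < mw) (ls0 : 0 < ls) (ms0 : 0 < ms).
Hypotheses (kappa0 : 0 < kappa) (alpha0 : 0 < alpha).
Hypotheses (eta0 : forall eps : R, 0 < eps -> 0 < eta eps).
Hypotheses (eta_cvg : eta eps @[eps --> 0^'+] --> (0 : R)).
Hypotheses (eta_eps_cvg : eta eps / eps @[eps --> 0^'+] --> alpha).
Local Notation f := (elastic_energy ls ms).
Local Notation g := (elastic_energy lw mw).
Local Notation W eps := (W_eps lw mw ls ms kappa (eta eps) eps).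

Definition layered_energy (xi : 'M[R]_n) p (c : 'I_p -> R) (a b : 'I_p -> 'rV[R]_n) : R :=
  f (xi - \sum_i c i *: symdyad (a i) (b i)) +
  \sum_i c i * (alpha * g (symdyad (a i) (b i)) + kappa).

(** Order of choices: [L] from the tolerance, then [eps], then [J] from [eps], then the frequency
    inside [laminate_SQ]. [L] controls uniformly in [eps] the errors proportional to [d = 1 / L];
    the others vanish with [eps]. *)
Lemma limsup_SQ_layered (xi : 'M[R]_n) p (c : 'I_p -> R) (a b : 'I_p -> 'rV[R]_n) e :
  symmx xi -> (forall i, 0 < c i) -> 0 < e ->
  \forall eps \near 0^'+, (SQ (W eps) xi <= (layered_energy xi c a b + e)%:E)%E.
Proof.
move=> sxi c0 e0; pose S i := symdyad (a i) (b i).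
have sS i : symmx (S i) by exact: symmx_symdyad.
have sZ : symmx (\sum_i c i *: S i) by apply: symmx_sum => i; exact: symmxZ.
have [C0 hC0] := @step'_bounded R.
have C00 : 0 <= C0 by have /andP[] := hC0 0; exact: le_trans.
pose C := 1 + C0; have C1 : 1 <= C by rewrite lerDl.
set F := f (xi - \sum_i c i *: S i).
have F0 : 0 <= F by apply: elastic_energy_ge0 => //; exact: symmxB.
have X0 : 0 <= f xi by exact: elastic_energy_ge0.
have gS0 i : 0 <= g (S i) by exact: elastic_energy_ge0.
pose G0 := \sum_i c i * g (S i).
have G00 : 0 <= G0 by apply: sumr_ge0 => i _; apply: mulr_ge0 => //; exact: ltW.
pose Gs := g (xi - \sum_i c i *: S i) + g xi.
pose X := \sum_i \sum_(j | j != i) `|c i * c j * elastic_form lw mw (S i) (S j)|.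
(* Up to the additive [e / 4], the excess of [P0] over the layered energy is at most [d * K0]. *)
pose K0 := F + 8 * n%:R * f xi + alpha * G0 * (1 + 4 * C ^+ 2).
have K00 : 0 <= K0.
  have : 0 <= 8 * n%:R * f xi by rewrite mulr_ge0 // mulr_ge0.
  have : 0 <= alpha * G0 * (1 + 4 * C ^+ 2).
    apply: mulr_ge0; first by rewrite mulr_ge0 // ltW.
    by rewrite addr_ge0 // mulr_ge0 // sqr_ge0.
  by rewrite /K0; lra.
pose L := (Num.truncn (4 * K0 / e)).+4.
have L0 : 0 < L%:R :> R by rewrite ltr0n.
pose d : R := L%:R^-1.
have d0 : 0 < d by rewrite invr_gt0.
have d1 : d <= 1 by rewrite invf_le1 // ler1n.
have dK : d * K0 <= e / 4.
  have h : 4 * K0 / e < L%:R.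
    apply: lt_le_trans (truncnS_gt _) _; rewrite ler_nat /L; move: (Num.truncn _) => T.
    by rewrite ltnS -addn3 leq_addr.
  rewrite mulrC ler_pdivrMr //; rewrite ltr_pdivrMr // in h; lra.
have d2 : 0 < d <= 2^-1 by rewrite d0 lef_pV2 ?posrE // ler_nat.
have hC y : 0 <= ramp' d y <= C by exact: ramp'_le.
(* [P] dominates the bound of [laminate_SQ] as soon as [c i * eps <= th i <= c i * eps + eps^2];
   [P0] is its limit. *)
pose P eps : R := (1 + d) * (F + 4 * n%:R * d * f xi) + eta eps * (1 + d^-1) * (2 * Gs) +
  (kappa * (\sum_i c i + p%:R * eps) + (1 + d) * (1 + 2 * C ^+ 2 * d) * G0 * (eta eps / eps) +
   eta eps * ((1 + d) * (C ^+ 2 * X))) + e / 4.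
pose P0 : R := (1 + d) * (F + 4 * n%:R * d * f xi) + 0 * (1 + d^-1) * (2 * Gs) +
  (kappa * (\sum_i c i + p%:R * 0) + (1 + d) * (1 + 2 * C ^+ 2 * d) * G0 * alpha +
   0 * ((1 + d) * (C ^+ 2 * X))) + e / 4.
have eps_cvg : eps @[eps --> 0^'+] --> (0 : R) by exact: cvg_at_right_filter.
have cst_cvg (r : R) : r @[eps --> (0 : R)^'+] --> r by exact: cvg_cst.
have P_cvg : P eps @[eps --> 0^'+] --> P0.
  apply: cvgD => //; apply: cvgD.
    by apply: cvgD => //; do 2 apply: cvgM => //.
  apply: cvgD; last exact: cvgM.
  apply: cvgD; apply: cvgM => //; apply: cvgD => //; exact: cvgM.
have P0e : P0 <= layered_energy xi c a b + e / 2.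
  have -> : layered_energy xi c a b = F + (kappa * (\sum_i c i) + alpha * G0).
    rewrite /layered_energy -/F; congr (_ + _).
    rewrite /G0 !mulr_sumr -big_split /=; apply: eq_bigr => i _; rewrite -/(S i); ring.
  rewrite /P0 !mul0r mulr0 !addr0.
  have dd : d ^+ 2 <= d by rewrite expr2 ler_piMr // ltW.
  have h1 : (1 + d) * (F + 4 * n%:R * d * f xi) <= F + d * (F + 8 * n%:R * f xi).
    have := ler_wpM2r (mulr_ge0 (ler0n R n) X0) dd; lra.
  have h2 : (1 + d) * (1 + 2 * C ^+ 2 * d) <= 1 + d * (1 + 4 * C ^+ 2).
    have := ler_wpM2r (sqr_ge0 C) dd; lra.
  have aG : 0 <= alpha * G0 by rewrite mulr_ge0 // ltW.
  have := ler_wpM2r aG h2; move: dK; rewrite /K0; lra.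
have Plt : \forall eps \near 0^'+, P eps < P0 + e / 2.
  by apply: cvgr_lt P_cvg _ _; rewrite ltrDl divr_gt0.
have csmall i : \forall eps \near 0^'+, c i * eps < 2^-1.
  have : c i * eps @[eps --> 0^'+] --> c i * 0 by exact: cvgM.
  by move=> /cvgr_lt; apply; rewrite mulr0 invr_gt0.
near=> eps.
have ep0 : 0 < eps by near: eps; exact: nbhs_right_gt.
have et0 := eta0 ep0.
have cs i : c i * eps < 2^-1.
  by move: i; near: eps; apply: filter_forall => i; exact: csmall.
(* As [1 / J <= eps^2], rounding [c i * eps] up to [k i / J] adds at most [kappa * eps] per family
   to the damage cost. Rounding upwards keeps the fraction positive and gives
   [c^2 / th <= c / eps]. *)
pose J := (Num.truncn (eps ^- 2)).+2.
have J0 : 0 < J%:R :> R by rewrite ltr0n.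
have Je : J%:R^-1 <= eps ^+ 2.
  rewrite -[leRHS]invrK lef_pV2 ?posrE ?invr_gt0 ?exprn_gt0 //.
  apply: le_trans (ltW (truncnS_gt _)) _; by rewrite ler_nat leqnSn.
pose k i := (Num.truncn (c i * eps * J%:R)).+1.
have ce0 i : 0 <= c i * eps * J%:R by rewrite !mulr_ge0 // ltW.
have kJ i : (0 < k i <= J)%N.
  rewrite /= -(ltr_nat R) /k.
  have /andP[h _] := truncn_itv (ce0 i).
  apply: (@le_lt_trans _ _ (c i * eps * J%:R)) => //.
  have := cs i; rewrite -(ltr_pM2r J0); lra.
have th_ge i : c i * eps <= (k i)%:R / J%:R.
  by rewrite ler_pdivlMr // ltW // truncnS_gt.
have th_le i : (k i)%:R / J%:R <= c i * eps + eps ^+ 2.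
  rewrite -natr1 mulrDl mul1r lerD // ler_pdivrMr //.
  by have /andP[] := truncn_itv (ce0 i).
have e40 : 0 < e / 4 by rewrite divr_gt0.
have L4 : (4 <= L)%N by [].
have J0n : (0 < J)%N by [].
have := laminate_SQ c a b lw0 mw0 ls0 ms0 kappa0 et0 ep0 sxi J0n L4 kJ C1 hC e40.
move=> /le_trans; apply; rewrite lee_fin.
apply: (@le_trans _ _ (P eps)); last first.
  by have h : P eps < P0 + e / 2 by [near: eps; exact: Plt]; move: h P0e; lra.
rewrite lerD2r -/d -/F -/Gs lerD2l.
have ke : 0 <= kappa / eps by rewrite divr_ge0 // ltW.
rewrite -addrA; apply: lerD.
  have -> : \sum_i c i + p%:R * eps = \sum_i (c i + eps).
    by rewrite big_split /= sumr_const card_ord mulr_natl.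
  rewrite !mulr_sumr; apply: ler_sum => i _.
  rewrite (_ : kappa * (c i + eps) = kappa / eps * (c i * eps + eps ^+ 2)); last first.
    by field; rewrite gt_eqF.
  exact: ler_wpM2l.
have ed : 0 <= eta eps * (1 + d) by rewrite mulr_ge0 ?addr_ge0 // ltW.
rewrite -/(S _) mulrDr; apply: lerD.
  rewrite (_ : (1 + d) * (1 + 2 * C ^+ 2 * d) * G0 * (eta eps / eps) =
    eta eps * (1 + d) * (\sum_i c i * g (S i) / eps * (1 + 2 * C ^+ 2 * d))); last first.
    by rewrite -!mulr_suml -/G0; ring.
  apply: ler_wpM2l => //; apply: ler_sum => i _.
  rewrite /self_coef.
  have -> : (c i / ((k i)%:R / J%:R)) ^+ 2 * g (S i) * ((k i)%:R / J%:R * (1 + 2 * C ^+ 2 / L%:R)) =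
    (c i ^+ 2 / ((k i)%:R / J%:R)) * (g (S i) * (1 + 2 * C ^+ 2 * d)).
    by rewrite /d; field; rewrite !gt_eqF // ltr0n.
  have -> : c i * g (S i) / eps * (1 + 2 * C ^+ 2 * d) =
    (c i ^+ 2 / (c i * eps)) * (g (S i) * (1 + 2 * C ^+ 2 * d)).
    by field; rewrite !gt_eqF.
  apply: ler_wpM2r.
    apply: mulr_ge0 => //; rewrite addr_ge0 // mulr_ge0 ?(ltW d0) //.
    by rewrite mulr_ge0 // sqr_ge0.
  rewrite ler_wpM2l ?sqr_ge0 // lef_pV2 ?posrE //; first by rewrite divr_gt0 // ltr0n.
  by rewrite mulr_gt0.
(* The weight [th_i th_j] of a crossing cancels the factor [1 / (th_i th_j)] of its energy:
   crossings cost a constant times [eta eps]. *)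
rewrite (_ : eta eps * ((1 + d) * (C ^+ 2 * X)) = eta eps * (1 + d) * (C ^+ 2 * X)); last by ring.
apply: ler_wpM2l => //; rewrite /X mulr_sumr; apply: ler_sum => i _.
rewrite mulr_sumr; apply: ler_sum => j _.
rewrite le_eqVlt; apply/orP; left; apply/eqP; rewrite /cross_coef -/(S _) -/(S _).
by field; rewrite !gt_eqF // ltr0n.
Unshelve. all: by end_near. Qed.

End limits.

(** * The dual formula *)

Section dual_formula.
Context {R : realType} {n : nat}.
Variables (lw mw ls ms kappa alpha : R).
Hypotheses (n0 : (0 < n)%N).
Hypotheses (lw0 : 0 < lw) (mw0 : 0 < mw) (ls0 : 0 < ls) (ms0 : 0 < ms).
Hypotheses (kappa0 : 0 < kappa) (alpha0 : 0 < alpha).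
Local Notation f := (elastic_energy ls ms).
Local Notation g := (elastic_energy lw mw).
Local Notation A := (isotropic ls ms).
Local Notation Wbar := (W_bar lw mw ls ms kappa alpha).
Implicit Types (xi tau e : 'M[R]_n).

Lemma isotropicZ (lam mu r : R) e : isotropic lam mu (r *: e) = r *: isotropic lam mu e.
Proof.
by rewrite /isotropic mxtraceZ scalerDr scale_scalar_mx !scalerA mulrCA (mulrC (2 * mu)).
Qed.

(** [A e] is the gradient of [f] at [e], so the supremum is attained at [e]; the square completed
    around [e] is the defect elsewhere. *)
Lemma conjugate_energy e : symmx e -> conjugate (fun x => (f x)%:E) (A e) = (f e)%:E.
Proof.
move=> se; apply/eqP; rewrite eq_le; apply/andP; split.
  apply: ge_ereal_sup => _ [x sx <-]; rewrite -EFinB lee_fin.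
  rewrite (energy_complete_square ls ms se sx).
  have := elastic_energy_ge0 ls0 ms0 (symmxB sx se); lra.
apply: ereal_sup_ubound; exists e => //; rewrite -EFinB; congr _%:E.
by rewrite /elastic_energy; field.
Qed.

(** The trace of [A e] is [D] times that of [e], hence the correction by a multiple of the identity.
    The dual problem can therefore be parametrised by strains. *)
Lemma isotropic_surj tau : symmx tau -> exists2 e, symmx e & tau = A e.
Proof.
move=> st; pose D := 2 * ms + n%:R * ls.
have D0 : 0 < D by rewrite addr_gt0 // mulr_gt0 // ltr0n.
exists ((2 * ms)^-1 *: (tau - (ls * \tr tau / D)%:M)).
  by apply: symmxZ; apply: symmxB => //; exact: symmx_scalar.
rewrite /isotropic mxtraceZ linearB /= mxtrace_scalar scalerA divff ?scale1r; last first.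
  by rewrite gt_eqF // mulr_gt0.
rewrite addrCA [X in tau + X](_ : _ = 0) ?addr0 //.
rewrite -raddfB /= (_ : _ - _ = 0) ?raddf0 //.
by rewrite -mulr_natl /D; field; rewrite -/D !gt_eqF.
Qed.

Let K : set 'M[R]_n := [set tau | symmx tau /\ G lw mw tau <= 2 * alpha * kappa].

Let dual_energy xi tau : \bar R :=
  ((frobenius xi tau)%:E - (conjugate (fun x => (f x)%:E) tau + indicator K tau))%E.

Let W_barE xi : Wbar xi = ereal_sup [set dual_energy xi tau | tau in symmx].
Proof. by []. Qed.

Let dual_energy_in xi e : symmx e -> G lw mw (A e) <= 2 * alpha * kappa ->
  dual_energy xi (A e) = (frobenius (A e) xi - f e)%:E.
Proof.
move=> se GK; have AK : A e \in K by apply/mem_set; split => //; exact: symmx_isotropic.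
by rewrite /dual_energy conjugate_energy // /indicator AK adde0 frobeniusC.
Qed.

Let dual_energy_out xi e : symmx e -> A e \notin K -> dual_energy xi (A e) = -oo%E.
Proof.
by move=> se /negbTE AK; rewrite /dual_energy conjugate_energy // /indicator AK.
Qed.

Lemma W_bar_ge xi e : symmx e -> G lw mw (A e) <= 2 * alpha * kappa ->
  ((frobenius (A e) xi - f e)%:E <= Wbar xi)%E.
Proof.
move=> se GK; rewrite -dual_energy_in // W_barE; apply: ereal_sup_ubound.
by exists (A e) => //; exact: symmx_isotropic.
Qed.

Lemma W_bar_le xi : symmx xi -> (Wbar xi <= (f xi)%:E)%E.
Proof.
move=> sx; rewrite W_barE; apply: ge_ereal_sup => _ [tau /isotropic_surj[e se ->] <-].
have [/set_mem[_ GK]|nK] := boolP (A e \in K); last by rewrite dual_energy_out // leNye.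
rewrite dual_energy_in // lee_fin (energy_complete_square ls ms se sx).
have := elastic_energy_ge0 ls0 ms0 (symmxB sx se); lra.
Qed.

(** Stresses outside [K] have dual value [-oo], so a near maximiser of a finite supremum lies in
    [K]. *)
Lemma W_bar_adherent xi (eps : R) : Wbar xi \is a fin_num -> 0 < eps ->
  exists e, [/\ symmx e, G lw mw (A e) <= 2 * alpha * kappa &
    fine (Wbar xi) - eps < frobenius (A e) xi - f e].
Proof.
move=> wfin eps0; have wfin' := wfin; rewrite W_barE in wfin'.
have [_ [tau /isotropic_surj[e se ->] <-]] := ub_ereal_sup_adherent eps0 wfin'.
rewrite -W_barE -[X in (X - _)%E](fineK wfin) -EFinB.
have [/set_mem[_ GK]|nK] := boolP (A e \in K); last by rewrite dual_energy_out // ltNge leNye.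
by rewrite dual_energy_in // lte_fin => h; exists e.
Qed.

Let layered xi := [set v | exists p (c : 'I_p -> R) (a b : 'I_p -> 'rV[R]_n),
  (forall i, 0 < c i) /\ v = layered_energy lw mw ls ms kappa alpha xi c a b].

(* A near minimiser of the layered energy is stationary up to a small error when one more
   thin layer is inserted and when all layers are thickened; its stress is thus, after a
   small contraction, an admissible competitor in the dual problem. *)
Lemma layered_energy_le_dual xi (eps : R) : symmx xi -> 0 < eps ->
  exists p (c : 'I_p -> R) (a b : 'I_p -> 'rV[R]_n), (forall i, 0 < c i) /\
  ((layered_energy lw mw ls ms kappa alpha xi c a b)%:E <= Wbar xi + eps%:E)%E.
Proof.
move=> sxi eps0.
have X0 : 0 <= f xi by exact: elastic_energy_ge0.
pose C := ls / lw + ms / mw.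
have hC x : symmx x -> f x <= C * g x.
  move=> sx; apply: elastic_energy_compare => //.
    by rewrite /C mulrDl divfK ?gt_eqF // lerDl mulr_ge0 ?divr_ge0 // ltW.
  by rewrite /C mulrDl divfK ?gt_eqF // lerDr mulr_ge0 ?divr_ge0 // ltW.
have C0 : 0 <= C by rewrite addr_ge0 // divr_ge0 // ltW.
pose K1 := C / alpha + kappa^-1.
have K10 : 0 <= K1 by rewrite addr_ge0 ?divr_ge0 ?invr_ge0 // ltW.
(* [K2] collects the coefficients of the perturbation size [s] in the final estimate. *)
pose K2 := 4 * f xi + 3 + K1 * (f xi + 1).
have K20 : 0 < K2 by have := mulr_ge0 K10 (addr_ge0 X0 ler01); rewrite /K2; lra.
pose s := Num.min (2^-1) (eps / K2).
have s0 : 0 < s by rewrite lt_min invr_gt0 ltr0n divr_gt0.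
have s2 : s <= 2^-1 by rewrite ge_min lexx.
have sK2 : s * K2 <= eps by rewrite -ler_pdivlMr // ge_min lexx orbT.
have cost_ge0 p (c : 'I_p -> R) (a b : 'I_p -> 'rV[R]_n) : (forall i, 0 < c i) ->
    0 <= \sum_i c i * (alpha * g (symdyad (a i) (b i)) + kappa).
  move=> c0; apply: sumr_ge0 => i _; apply: mulr_ge0; first exact: ltW.
  rewrite addr_ge0 // ?(ltW kappa0) //; apply: mulr_ge0; first exact: ltW.
  by apply: elastic_energy_ge0 => //; exact: symmx_symdyad.
have lE0 : layered xi (f xi).
  exists 0, (fun=> 1), (fun=> 0), (fun=> 0); split => //.
  by rewrite /layered_energy !big_ord0 subr0 addr0.
have lbE : lbound (layered xi) 0.
  move=> _ [p [c [a [b [c0 ->]]]]]; rewrite addr_ge0 ?cost_ge0 //.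
  apply: elastic_energy_ge0 => //; apply: symmxB => //; apply: symmx_sum => i.
  by apply: symmxZ; exact: symmx_symdyad.
have infE : has_inf (layered xi) by split; [exists (f xi)|exists 0].
(* The tolerance is [s^2] because the comparisons below perturb at size [s] and are then divided by
   [s]. *)
have [v [p [c [a [b [c0 vE]]]]] vlt] := @inf_adherent _ _ (s ^+ 2) (exprn_gt0 2 s0) infE.
have inf_le p' (c' : 'I_p' -> R) (a' b' : 'I_p' -> 'rV[R]_n) : (forall i, 0 < c' i) ->
    v - s ^+ 2 <= layered_energy lw mw ls ms kappa alpha xi c' a' b'.
  move=> c'0; apply: (@le_trans _ _ (inf (layered xi))); first by lra.
  apply: ge_inf; first by exists 0.
  by exists p', c', a', b'.
exists p, c, a, b; split => //; rewrite -vE.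
pose S i := symdyad (a i) (b i); pose Z := \sum_i c i *: S i.
pose cost := \sum_i c i * (alpha * g (S i) + kappa).
have cost0 : 0 <= cost by exact: cost_ge0.
pose e0 := xi - Z; pose tau := A e0.
have sZ : symmx Z by apply: symmx_sum => i; apply: symmxZ; exact: symmx_symdyad.
have se0 : symmx e0 by exact: symmxB.
have fe0 : 0 <= f e0 by exact: elastic_energy_ge0.
have fZ0 : 0 <= f Z by exact: elastic_energy_ge0.
have {}vE : v = f e0 + cost by [].
have tauE x : frobenius tau x = 2 * elastic_form ls ms e0 x.
  by rewrite /elastic_form; field.
have v_le : v <= f xi + s ^+ 2.
  have := @inf_le 0 (fun=> 1) (fun=> 0) (fun=> 0) (fun=> ltr01).
  by rewrite /layered_energy !big_ord0 subr0 addr0; lra.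
have ss : s ^+ 2 <= s by rewrite expr2 ler_piMr ?(ltW s0) //; lra.
(* A layer of weight [s] is inserted. The error [s * (f + 1)] consists of the second-order term of
   [f] and the tolerance, both divided by [s]. *)
have new_layer a' b' : frobenius tau (symdyad a' b') <=
    alpha * g (symdyad a' b') + kappa + s * (f (symdyad a' b') + 1).
  pose ext T (F : 'I_p -> T) (t : T) (i : 'I_p.+1) := if unlift ord0 i is Some j then F j else t.
  have ext0 T F t : ext T F t ord0 = t by rewrite /ext unlift_none.
  have extS T F t i : ext T F t (lift ord0 i) = F i by rewrite /ext liftK.
  have c'0 i : 0 < ext _ c s i.
    by rewrite /ext; case: unliftP => //.
  have := @inf_le p.+1 (ext _ c s) (ext _ a a') (ext _ b b') c'0.
  rewrite /layered_energy !big_ord_recl !ext0.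
  under eq_bigr do rewrite !extS.
  under [X in _ + (_ + X)]eq_bigr do rewrite !extS.
  rewrite -/Z -/cost vE.
  have -> : xi - (s *: symdyad a' b' + Z) = e0 + (- s) *: symdyad a' b'.
    by rewrite opprD addrCA addrC scaleNr.
  rewrite elastic_energyD elastic_formZr elastic_energyZ sqrrN.
  have := tauE (symdyad a' b') => tE h.
  by rewrite tE -(ler_pM2l s0); lra.
(* All weights are multiplied by [1 - s], which gives [cost <= tau : Z] up to order [s]. Combined
   with [tau_xi], this bounds [v] by the dual value [tau : xi - f e0] up to order [s]. *)
have thicken : cost <= frobenius tau Z + s * (f Z + 1).
  have c'0 i : 0 < (1 - s) * c i by rewrite mulr_gt0 // subr_gt0; lra.
  have := @inf_le p (fun i => (1 - s) * c i) a b c'0.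
  rewrite /layered_energy.
  have -> : \sum_i ((1 - s) * c i) *: symdyad (a i) (b i) = (1 - s) *: Z.
    by rewrite /Z scaler_sumr; apply: eq_bigr => i _; rewrite -scalerA.
  have -> : \sum_i (1 - s) * c i * (alpha * g (symdyad (a i) (b i)) + kappa) = (1 - s) * cost.
    by rewrite /cost mulr_sumr; apply: eq_bigr => i _; rewrite -mulrA.
  have -> : xi - (1 - s) *: Z = e0 + s *: Z.
    by rewrite scalerBl scale1r opprB addrCA addrC.
  rewrite vE elastic_energyD elastic_formZr elastic_energyZ.
  have := tauE Z => tE h.
  by rewrite tE -(ler_pM2l s0); lra.
have tau_xi : frobenius tau Z = frobenius tau xi - 2 * f e0.
  have -> : Z = xi + (-1) *: e0 by rewrite scaleN1r /e0 opprB addrC subrK.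
  by rewrite frobeniusDr frobeniusZr [frobenius tau e0]tauE elastic_energyB; ring.
have fZ : f Z <= 4 * f xi + 2.
  have -> : Z = xi + (-1) *: e0 by rewrite scaleN1r /e0 opprB addrC subrK.
  have := elastic_energyD_le ls0 ms0 sxi (symmxZ (-1) se0).
  by rewrite elastic_energyZ sqrrN expr1n mul1r; move: v_le; rewrite vE; lra.
have v_dual : v <= frobenius tau xi - f e0 + s * (4 * f xi + 3).
  have := ler_wpM2l (ltW s0) fZ; move: thicken; rewrite tau_xi vE; lra.
(* [K1] satisfies [f / alpha + alpha <= K1 (g + alpha kappa)] on symmetrised dyads, so the error of
   [new_layer] amounts to a factor [1 + s K1], which the contraction by [r] removes. *)
pose r := (1 + s * K1)^-1.
have D0 : 0 < 1 + s * K1 by rewrite ltr_pwDl // mulr_ge0 // ltW.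
have r0 : 0 < r by rewrite invr_gt0.
have r1 : r <= 1 by rewrite invf_le1 // lerDl mulr_ge0 // ltW.
have rAE : A (r *: e0) = r *: tau.
  exact: isotropicZ.
have sr : symmx (r *: e0) by exact: symmxZ.
have Gr : G lw mw (A (r *: e0)) <= 2 * (alpha * kappa).
  apply: G_le_rank_one => //; first exact: symmx_isotropic.
  move=> a' b'; rewrite rAE frobeniusZl.
  (* Dividing [a'] by [alpha] turns [alpha g + kappa] into [g + alpha kappa], the form needed by
     [G_le_rank_one]. *)
  have := new_layer (alpha^-1 *: a') b'.
  have sS := symmx_symdyad a' b'.
  have gS : 0 <= g (symdyad a' b') by exact: elastic_energy_ge0.
  rewrite symdyadZl frobeniusZr !(elastic_energyZ _ _ alpha^-1) => h.
  have fg : f (symdyad a' b') <= C * g (symdyad a' b') by exact: hC.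
  rewrite ler_pdivrMl //.
  have h2 : frobenius tau (symdyad a' b') <= g (symdyad a' b') + alpha * kappa +
      s * (f (symdyad a' b') / alpha + alpha).
    rewrite -(ler_pM2l (_ : 0 < alpha^-1)) ?invr_gt0 //; apply: (le_trans h).
    rewrite le_eqVlt; apply/orP; left.
    by apply/eqP; field; rewrite gt_eqF.
  apply: (le_trans h2).
  have h3 : f (symdyad a' b') / alpha + alpha <= K1 * (g (symdyad a' b') + alpha * kappa).
    have -> : K1 * (g (symdyad a' b') + alpha * kappa) =
        C * g (symdyad a' b') / alpha + C * kappa + g (symdyad a' b') / kappa + alpha.
      by rewrite /K1; field; rewrite !gt_eqF.
    have := ler_wpM2r (ltW (_ : 0 < alpha^-1)) fg; rewrite invr_gt0 => /(_ alpha0).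
    have := mulr_ge0 C0 (ltW kappa0).
    have : 0 <= g (symdyad a' b') / kappa by rewrite divr_ge0 // ltW.
    lra.
  have := ler_wpM2l (ltW s0) h3; lra.
rewrite mulrA in Gr.
have := W_bar_ge xi sr Gr; rewrite rAE frobeniusZl elastic_energyZ => h.
apply: (@le_trans _ _ ((r * frobenius tau xi - r ^+ 2 * f e0)%:E + eps%:E)%E); last first.
  exact: leeD2r.
rewrite -EFinD lee_fin.
have rr : r ^+ 2 * f e0 <= r * f e0 by rewrite ler_wpM2r // expr2 ler_piMl // ltW.
have v0 : 0 <= v by rewrite vE addr_ge0.
have h1r : 1 - r <= s * K1.
  have -> : 1 - r = s * K1 * r by rewrite /r; field; rewrite gt_eqF.
  by rewrite ler_piMr // mulr_ge0 // ltW.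
have hr := ler_wpM2l (ltW r0) v_dual.
have h4 : r * (s * (4 * f xi + 3)) <= s * (4 * f xi + 3).
  by rewrite ler_piMl // mulr_ge0 ?(ltW s0) //; lra.
have h5 : (1 - r) * v <= s * K1 * (f xi + 1).
  by rewrite ler_pM ?subr_ge0 //; move: v_le; lra.
move: sK2; rewrite /K2; lra.
Qed.

End dual_formula.

(** * Lower bound *)

Section lower_limit.
Context {R : realType} {n : nat}.
Variables (lw mw ls ms kappa alpha : R) (eta : R -> R).
Hypotheses (n0 : (0 < n)%N).
Hypotheses (lw0 : 0 < lw) (mw0 : 0 < mw) (ls0 : 0 < ls) (ms0 : 0 < ms).
Hypotheses (kappa0 : 0 < kappa) (alpha0 : 0 < alpha).
Hypotheses (eta0 : forall eps : R, 0 < eps -> 0 < eta eps).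
Hypotheses (eta_cvg : eta eps @[eps --> 0^'+] --> (0 : R)).
Hypotheses (eta_eps_cvg : eta eps / eps @[eps --> 0^'+] --> alpha).
Local Notation f := (elastic_energy ls ms).
Local Notation g := (elastic_energy lw mw).
Local Notation A := (isotropic ls ms).
Local Notation W eps := (W_eps lw mw ls ms kappa (eta eps) eps).

(* Shrinking the stress by a factor [t < 1] makes the yield condition strict, and this
   slack is what absorbs the energy of the damaged phase as [eta] tends to 0. *)
Lemma liminf_SQ_dual (xi e : 'M[R]_n) (dl : R) : symmx xi -> symmx e ->
  G lw mw (A e) <= 2 * alpha * kappa -> 0 < dl ->
  \forall eps \near 0^'+, ((frobenius (A e) xi - f e - dl)%:E <= SQ (W eps) xi)%E.
Proof.
move=> sxi se GK dl0; set Y := frobenius (A e) xi - f e.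
have fe0 : 0 <= f e by exact: elastic_energy_ge0.
have ge0 : 0 <= g e by exact: elastic_energy_ge0.
(* Close enough to 1 for [t Y >= Y - dl / 2], and never below [1 / 2]. *)
pose t := 1 - dl / (2 * (`|Y| + dl)).
have Yd : 0 < `|Y| + dl by rewrite ltr_wpDl.
have q0 : 0 < dl / (2 * (`|Y| + dl)) by rewrite divr_gt0 // mulr_gt0.
have q1 : dl / (2 * (`|Y| + dl)) <= 2^-1.
  rewrite ler_pdivrMr ?mulr_gt0 // mulrA mulVf ?mul1r ?lerDr //.
have t0 : 0 < t by rewrite /t; lra.
have t1 : t < 1 by rewrite /t; lra.
have tY : Y - dl / 2 <= t * Y.
  have h : dl / (2 * (`|Y| + dl)) * Y <= dl / 2.
    apply: (@le_trans _ _ (dl / (2 * (`|Y| + dl)) * (`|Y| + dl))).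
      by rewrite ler_pM2l // (le_trans (ler_norm _)) // lerDl ltW.
    by rewrite le_eqVlt; apply/orP; left; apply/eqP; field; rewrite gt_eqF.
  by rewrite /t mulrBl mul1r; lra.
have sA : symmx (A e) by exact: symmx_isotropic.
have [r [s [s0 cs Gs]]] := G_opnorm lw0 mw0 n0 sA.
pose ak := 2 * alpha * kappa.
have ak0 : 0 < ak by rewrite !mulr_gt0.
pose Gam := ak * t; have Gam0 : 0 < Gam by rewrite mulr_gt0.
(* The radius [s] may be 0, while [SQ_lower_bound] wants a positive one; the slack between [t^2 ak]
   and [Gam = t ak] is spent on enlarging it. *)
pose s2 := t ^+ 2 * s ^+ 2 + mw * ak * (t * (1 - t)).
have m0 : 0 < mw * ak * (t * (1 - t)).
  by rewrite mulr_gt0 ?mulr_gt0 // subr_gt0.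
have s20 : 0 < s2 by rewrite /s2 ltr_wpDl // mulr_ge0 // sqr_ge0.
pose s' := Num.sqrt s2; have s'0 : 0 < s' by rewrite sqrtr_gt0.
have s'E : s' ^+ 2 = s2 by rewrite sqr_sqrtr // ltW.
have AtE : A (t *: e) = t *: A e by exact: isotropicZ.
have ct : opnorm_le s' (A (t *: e) - (t * r)%:M).
  move=> v; have -> : A (t *: e) - (t * r)%:M = t *: (A e - r%:M).
    by rewrite AtE scalerBr scale_scalar_mx.
  have -> : \sum_i ((t *: (A e - r%:M)) *m v) i 0 ^+ 2 =
      t ^+ 2 * \sum_i ((A e - r%:M) *m v) i 0 ^+ 2.
    rewrite mulr_sumr; apply: eq_bigr => i _.
    by rewrite -scalemxAl [in LHS]mxE exprMn.
  have vv : 0 <= \sum_i v i 0 ^+ 2 by apply: sumr_ge0 => i _; rewrite sqr_ge0.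
  rewrite s'E; apply: (@le_trans _ _ (t ^+ 2 * (s ^+ 2 * \sum_i v i 0 ^+ 2))).
    by rewrite ler_wpM2l ?sqr_ge0 //; exact: cs.
  by rewrite mulrA ler_wpM2r // lerDl ltW.
have Gt : (t * r) ^+ 2 / (lw + mw) + s' ^+ 2 / mw <= Gam.
  have lm : 0 < lw + mw by rewrite addr_gt0.
  have -> : (t * r) ^+ 2 / (lw + mw) + s' ^+ 2 / mw =
      t ^+ 2 * G lw mw (A e) + ak * (t * (1 - t)).
    by rewrite s'E -Gs /s2; field; rewrite !gt_eqF.
  have := ler_wpM2l (sqr_ge0 t) GK; rewrite -/ak /Gam; lra.
pose C := lw / ls + mw / ms.
have Cl : lw <= C * ls.
  by rewrite /C mulrDl divfK ?gt_eqF // lerDl mulr_ge0 ?divr_ge0 // ltW.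
have Cm : mw <= C * ms.
  by rewrite /C mulrDl divfK ?gt_eqF // lerDr mulr_ge0 ?divr_ge0 // ltW.
have C0 : 0 <= C by rewrite addr_ge0 // divr_ge0 // ltW.
(* As [eta / eps] tends to [alpha], the numerator of [(kappa (eta / eps) - kappa alpha t) / eta]
   tends to [2 q]. It is eventually at least [q], so the damaged phase lies above [q / eta], which
   exceeds any fixed value. *)
pose q := kappa * alpha * (1 - t) / 2.
have qq : 0 < q by rewrite divr_gt0 // mulr_gt0 ?subr_gt0 // mulr_gt0.
pose Y' := frobenius (A (t *: e)) xi - f (t *: e).
have Y'_ge : t * Y <= Y'.
  rewrite /Y' AtE frobeniusZl elastic_energyZ /Y mulrBr lerD2l lerN2.
  by rewrite ler_wpM2r // expr2 ler_piMl // ltW.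
have eta_lt (b : R) : 0 < b -> \forall eps \near 0^'+, eta eps < b.
  by move=> b0; apply: cvgr_lt eta_cvg _ b0.
have ratio : \forall eps \near 0^'+, kappa * (eta eps / eps) > kappa * alpha - q.
  have c : kappa * (eta eps / eps) @[eps --> 0^'+] --> kappa * alpha.
    by apply: cvgM eta_eps_cvg; exact: cvg_cst.
  by apply: cvgr_gt c _ _; rewrite ltrBlDr ltrDl.
have b1 : 0 < (2 * (C + 1))^-1 by rewrite invr_gt0 mulr_gt0 // ltr_wpDl.
have b2 : 0 < q / (`|Y'| + 1) by rewrite divr_gt0 // ltr_wpDl.
have b3 : 0 < dl / (4 * (g (t *: e) + 1)).
  have : 0 <= g (t *: e) by apply: elastic_energy_ge0 => //; exact: symmxZ.
  by move=> h; rewrite divr_gt0 // mulr_gt0 // ltr_wpDl.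
near=> eps.
have ep0 : 0 < eps by near: eps; exact: nbhs_right_gt.
have et0 := eta0 ep0.
have e1 : eta eps < (2 * (C + 1))^-1 by near: eps; exact: eta_lt.
have e2 : eta eps < q / (`|Y'| + 1) by near: eps; exact: eta_lt.
have e3 : eta eps < dl / (4 * (g (t *: e) + 1)) by near: eps; exact: eta_lt.
have e4 : kappa * alpha - q < kappa * (eta eps / eps) by near: eps; exact: ratio.
have st : symmx (t *: e) by exact: symmxZ.
have gt0 : 0 <= g (t *: e) by exact: elastic_energy_ge0.
have etaC : 2 * eta eps * C <= 1.
  have : eta eps * (2 * (C + 1)) <= 1.
    by rewrite -ler_pdivlMr ?div1r ?mulr_gt0 ?ltr_wpDl // ltW.
  have := ltW et0; lra.
have dam : Y' <= kappa / eps - Gam / (2 * eta eps).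
  apply: (@le_trans _ _ (q / eta eps)).
    rewrite ler_pdivlMr //; apply: (@le_trans _ _ ((`|Y'| + 1) * eta eps)).
      by rewrite ler_wpM2r ?(ltW et0) // (le_trans (ler_norm _)) // lerDl.
    by rewrite mulrC -ler_pdivlMr ?ltr_wpDl // ltW.
  have -> : kappa / eps - Gam / (2 * eta eps) =
      (kappa * (eta eps / eps) - kappa * alpha * t) / eta eps.
    by rewrite /Gam /ak; field; rewrite !gt_eqF.
  rewrite ler_pM2r ?invr_gt0 //; move: e4; rewrite /q; lra.
have := SQ_lower_bound lw0 mw0 ls0 ms0 sxi st s'0 ct Gam0 Gt et0 Cl Cm etaC dam.
apply: le_trans; rewrite lee_fin -/Y'.
have h : 2 * eta eps * g (t *: e) <= dl / 2.
  have : eta eps * (4 * (g (t *: e) + 1)) <= dl.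
    by rewrite -ler_pdivlMr ?mulr_gt0 ?ltr_wpDl // ltW.
  have := ltW et0; lra.
lra.
Unshelve. all: by end_near. Qed.

End lower_limit.

Theorem proposition3p3 (R : realType) (n : nat)
    (lambda_w mu_w lambda_s mu_s kappa alpha : R) (eta : R -> R) :
  (2 <= n)%N ->
  0 < lambda_w -> 0 < mu_w -> 0 < lambda_s -> 0 < mu_s ->
  0 < kappa ->
  (forall eps : R, 0 < eps -> 0 < eta eps) ->
  eta eps @[eps --> 0^'+] --> (0 : R) ->
  0 < alpha ->
  eta eps / eps @[eps --> 0^'+] --> alpha ->
  forall xi : 'M[R]_n, symmx xi ->
    SQ (W_eps lambda_w mu_w lambda_s mu_s kappa (eta eps) eps) xi @[eps --> 0^'+]
      --> W_bar lambda_w mu_w lambda_s mu_s kappa alpha xi.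
Proof.
move=> n2 lw0 mw0 ls0 ms0 kappa0 eta0 eta_cvg alpha0 eta_eps_cvg xi sxi.
have n0 : (0 < n)%N by exact: ltnW n2.
set w := W_bar _ _ _ _ _ _ xi.
have w_le : (w <= (elastic_energy lambda_s mu_s xi)%:E)%E by exact: W_bar_le.
have upper (e : R) : 0 < e -> exists p (c : 'I_p -> R) (a b : 'I_p -> 'rV[R]_n),
    (forall i, 0 < c i) /\
    ((layered_energy lambda_w mu_w lambda_s mu_s kappa alpha xi c a b)%:E <= w + e%:E)%E.
  by move=> e0; exact: layered_energy_le_dual.
(* [w_le] excludes [+oo]; [-oo] is excluded because [w + 1] bounds a real layered energy from
   above. *)
have w_fin : w \is a fin_num.
  rewrite fin_numE; apply/andP; split; apply/eqP => wE; last by rewrite wE leye_eq in w_le.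
  have [p [c [a [b [_]]]]] := upper 1 ltr01.
  by rewrite wE addNye leeNy_eq.
rewrite -(fineK w_fin); set v := fine w.
have lim (e : R) : 0 < e -> \forall eps \near 0^'+,
    ((v - e)%:E <= SQ (W_eps lambda_w mu_w lambda_s mu_s kappa (eta eps) eps) xi <= (v + e)%:E)%E.
  move=> e0; have e20 : 0 < e / 2 by rewrite divr_gt0.
  have [e' [se' Ge' ltv]] := W_bar_adherent n0 ls0 ms0 w_fin e20.
  have [p [c [a [b [c0 lev]]]]] := upper (e / 2) e20.
  have L := liminf_SQ_dual n0 lw0 mw0 ls0 ms0 kappa0 alpha0 eta0 eta_cvg eta_eps_cvg sxi se' Ge' e20.
  have U := @limsup_SQ_layered _ _ _ _ _ _ _ _ _ lw0 mw0 ls0 ms0 kappa0 alpha0 eta0 eta_cvg eta_eps_cvg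
    _ _ _ a b _ sxi c0 e20.
  near=> eps; apply/andP; split.
    have hL := near L eps; apply: le_trans (hL _) => //; rewrite lee_fin.
    by move: ltv; rewrite -/w -/v; lra.
  have hU := near U eps; apply: le_trans (hU _) _ => //.
  rewrite -(fineK w_fin) -/v -EFinD !lee_fin in lev *; lra.
apply/fine_cvgP; split.
  near=> eps; have /andP[l u] : ((v - 1)%:E <= SQ (W_eps lambda_w mu_w lambda_s mu_s kappa (eta eps) eps) xi <= (v + 1)%:E)%E.
    by near: eps; exact: lim.
  rewrite fin_numElt; apply/andP; split; first exact: lt_le_trans (ltNyr _) l.
  exact: le_lt_trans u (ltry _).
apply/cvgrPdist_le => e e0; near=> eps.
have /andP[] : ((v - e)%:E <= SQ (W_eps lambda_w mu_w lambda_s mu_s kappa (eta eps) eps) xi <= (v + e)%:E)%E.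
  by near: eps; exact: lim.
rewrite /=; case: (SQ _ _) => [x| |] //=; rewrite !lee_fin => l u.
by rewrite ler_norml; apply/andP; split; lra.
Unshelve. all: by end_near. Qed.
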